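(* Let $a,b\ne0$ be complex constants such that $\arg a\ne\arg b$ or $a=cb$ $(0<c<1)$, and let $n$ be a positive integer. Let $A(z),B(z)\not\equiv0$ be analytic functions in $D(0,R)=\{z\in\mathbb{C}:0<|z|<R\}$ with $\max\{\sigma(A,0),\sigma(B,0)\}<n$. Then every solution $f(z)\not\equiv0$ of the differential equation $$f''+A(z)\exp\left\{\frac{a}{z^n}\right\}f'+B(z)\exp\left\{\frac{b}{z^n}\right\}f=0$$ satisfies $\sigma_2(f,0)=n$.
   Context: For an analytic function $f$ in $D(0,R)=\{z\in\mathbb{C}:0<|z|<R\}$ let $M_0(r,f)=\max\{|f(z)|:|z|=r\}$. The order and the hyper-order (second iterated order) of $f$ near $0$ are $$\sigma(f,0)=\limsup_{r\to0}\frac{\log^+\log^+M_0(r,f)}{-\log r},\qquad \sigma_2(f,0)=\limsup_{r\to0}\frac{\log^+\log^+\log^+M_0(r,f)}{-\log r},$$ where $\log^+x=\max\{\log x,0\}$. *)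

(* Defs.v *)
From Stdlib Require Import Reals Lra.
From Coquelicot Require Import Coquelicot.
Open Scope R_scope.

Definition Cexp (z : C) : C := (exp (Re z) * cos (Im z), exp (Re z) * sin (Im z)).

(* Principal argument, with values in ]-PI, PI]; meaningful for z <> 0 only,
   see [Carg_spec]. *)
Definition Carg (z : C) : R :=
  if Rle_dec 0 (Im z) then acos (Re z / Cmod z) else - acos (Re z / Cmod z).

Lemma Carg_spec (z : C) : z <> RtoC 0 ->
  - PI < Carg z <= PI /\ z = (RtoC (Cmod z) * Cexp (Ci * RtoC (Carg z)))%C.
Proof.
intros Hz.
assert (Hm : 0 < Cmod z) by now apply Cmod_gt_0.
destruct z as [x y].
assert (Hsq : Cmod (x, y) * Cmod (x, y) = x * x + y * y).
{ unfold Cmod; simpl. rewrite sqrt_sqrt; nra. }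
unfold Carg, Cexp, Cmult, Ci, RtoC, Re, Im; simpl.
set (m := Cmod (x, y)) in *.
assert (Hu : x / m * m = x) by (field; lra).
set (u := x / m) in *.
assert (Hx : u * u <= 1).
{ apply Rmult_le_reg_r with (m * m); [nra|].
  replace (u * u * (m * m)) with (x * x) by (rewrite <- Hu; ring). nra. }
assert (Hu1 : -1 <= u <= 1) by (split; nra).
destruct (acos_bound u) as [H0 HP].
pose proof PI_RGT_0 as Hpi.
assert (Hs : m * sqrt (1 - u * u) = Rabs y).
{ rewrite <- (sqrt_Rsqr m) at 1 by lra.
  rewrite <- sqrt_mult by (unfold Rsqr; nra).
  rewrite <- sqrt_Rsqr_abs. f_equal. unfold Rsqr.
  transitivity (m * m - (u * m) * (u * m)); [ring | rewrite Hu; lra]. }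
destruct (Rle_dec 0 y) as [Hy|Hy].
- split; [lra|].
  replace (0 * acos u - 1 * 0) with 0 by ring.
  replace (0 * 0 + 1 * acos u) with (acos u) by ring.
  rewrite exp_0, cos_acos, sin_acos by lra.
  unfold Rsqr. rewrite Rabs_right in Hs by lra.
  f_equal; lra.
- assert (Hlt : acos u <> PI).
  { intros E. assert (Hc := cos_acos u Hu1). rewrite E, cos_PI in Hc.
    assert (y * y = 0) by (rewrite <- Hu, <- Hc in Hsq; nra). nra. }
  split; [lra|].
  replace (0 * - acos u - 1 * 0) with 0 by ring.
  replace (0 * 0 + 1 * - acos u) with (- acos u) by ring.
  rewrite exp_0, cos_neg, sin_neg, cos_acos, sin_acos by lra.
  unfold Rsqr. rewrite Rabs_left in Hs by lra.
  f_equal; lra.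
Qed.

Definition punctured_disc (rho : R) (z : C) : Prop := 0 < Cmod z < rho.

(* Local power series expansions; meant for open D. *)
Definition analytic_on (D : C -> Prop) (f : C -> C) : Prop :=
  forall z0 : C, D z0 ->
    exists (r : posreal) (a : nat -> C),
      forall z : C, Cmod (z - z0) < r ->
        @is_pseries C_AbsRing C_NormedModule a (z - z0)%C (f z).

Definition not_identically_zero_on (D : C -> Prop) (f : C -> C) : Prop :=
  exists z : C, D z /\ f z <> RtoC 0.

(* [ln x = 0] for [x <= 0], hence [log_plus 0 = 0] as usual. *)
Definition log_plus (x : R) : R := Rmax (ln x) 0.

(* For f continuous on the circle, the supremum is finite and is a maximum. *)
Definition M0 (r : R) (f : C -> C) : R :=
  real (Lub_Rbar (fun x => exists z : C, Cmod z = r /\ x = Cmod (f z))).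

Definition LimSup (F : (R -> Prop) -> Prop) (g : R -> R) : Rbar :=
  Rbar_glb (fun L => exists P : R -> Prop, F P /\
    L = Lub_Rbar (fun y => exists r : R, P r /\ y = g r)).

Definition order0 (f : C -> C) : Rbar :=
  LimSup (at_right 0) (fun r => log_plus (log_plus (M0 r f)) / (- ln r)).

Definition hyper_order0 (f : C -> C) : Rbar :=
  LimSup (at_right 0)
    (fun r => log_plus (log_plus (log_plus (M0 r f))) / (- ln r)).

Definition Rbar_max (x y : Rbar) : Rbar := if Rbar_le_dec x y then y else x.

(* f is an analytic (in particular single-valued) solution on D of f'' + P f' + Q f = 0. *)
Definition is_solution_on (D : C -> Prop) (P Q f : C -> C) : Prop :=
  analytic_on D f /\
  exists f1 f2 : C -> C,
    forall z : C, D z ->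
      @is_derive C_AbsRing C_NormedModule f z (f1 z) /\
      @is_derive C_AbsRing C_NormedModule f1 z (f2 z) /\
      (f2 z + P z * f1 z + Q z * f z)%C = RtoC 0.

(* Main.v *)
Require Import Defs.
From Stdlib Require Import Reals Lra Lia List Compare_dec Classical IndefiniteDescription.
From Coquelicot Require Import Coquelicot.
Open Scope R_scope.

(* Upper bound: near 0 the coefficients are at most exp(r^-(n+eps)) in modulus, and Gronwall's inequality
   for |f|^2 + |f'|^2 along rays bounds |f| by exp exp (r^-(n+eps)).

   Lower bound: let beta < n, |A|, |B| <= exp(r^-beta) and |f| <= exp exp (r^-beta). Some sector S satisfies Re(b/z^n) >= c0 r^-n
   and Re(a/z^n) <= c Re(b/z^n) with c < 1. On every small circle S contains a point where neither B nor f is too small: otherwise a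
   product of f B^k over rotations covering the circle would violate the three circles theorem. Around this point, the maximum of
   |f| |B|^k times a power of a radial weight is attained at a point w where |B(w)| is still not small and |f| <= 4 |f(w)| on a disc
   whose radius is not too small. Cauchy's estimates at w bound f'/f and f''/f there, and the equation then bounds |B(w) exp(b/w^n)|
   by a quantity which is too small as r -> 0. This avoids logarithmic derivative estimates. Complex analysis enters only through the
   maximum principle, which for twice differentiable f follows from the positive Laplacian of |f|^2 + eps |z|^2. *)

(** * Complex differentiability *)

(** The power [k] of [B] balances two scales. Write [X] for [r^-beta1] with [beta < beta1 < n]. The
    equation at [w] tolerates losses [exp (O(X))], because [|exp (b/w^n)|] is at least exponential
    in [r^-n]; but [f] itself is only known to be at most about [exp (exp X)]. The zeros of [f] and
    [B] in the sector are not controlled, so a point where [|f|] is locally largest could be one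
    where [|B|] is tiny. With [k] between [exp X] and [2 exp X], a factor [exp (-X)] lost in [|B|]
    costs [exp (-k X)] in [|f| |B|^k], more than the bound [exp k] for [|f|] can repay. The price is
    that near [w] only a disc of radius [exp (-6 X)] is under control, which in Cauchy's estimates
    costs again no more than [exp (O(X))]. *)

Lemma Cmod_sub_sym (z w : C) : Cmod (z - w) = Cmod (w - z).
Proof. rewrite <- Cmod_opp. f_equal; ring. Qed.

Lemma Cmod_sub_triangle (x y z : C) : Cmod (x - z) <= Cmod (x - y) + Cmod (y - z).
Proof. replace (x - z)%C with ((x - y) + (y - z))%C by ring. apply Cmod_triangle. Qed.

Lemma Cmod_triangle_rev (z w : C) : Cmod z - Cmod w <= Cmod (z - w).
Proof.
  pose proof (Cmod_triangle (z - w) w) as H.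
  replace (z - w + w)%C with z in H by ring. lra.
Qed.

Lemma Cmod_sub_le (z w : C) : Cmod (z - w) <= Cmod z + Cmod w.
Proof. rewrite <- (Cmod_opp w). apply Cmod_triangle. Qed.

Lemma Cmod_sub_0 (z : C) : Cmod (z - z) = 0.
Proof. replace (z - z)%C with (RtoC 0) by ring. apply Cmod_0. Qed.

Lemma Cmod_pos_neq0 (z : C) : 0 < Cmod z -> z <> RtoC 0.
Proof. intros H E. rewrite E, Cmod_0 in H. lra. Qed.

Lemma Cmod_sqr (z : C) : Cmod z * Cmod z = Re z * Re z + Im z * Im z.
Proof. unfold Cmod. rewrite sqrt_sqrt; [destruct z; simpl; ring | destruct z; simpl; nra]. Qed.

Lemma Cmod_le_abs_sum (z : C) : Cmod z <= Rabs (Re z) + Rabs (Im z).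
Proof.
  pose proof (Cmod_ge_0 z). pose proof (Cmod_sqr z).
  pose proof (Rabs_pos (Re z)). pose proof (Rabs_pos (Im z)).
  assert (Rabs (Re z) * Rabs (Re z) = Re z * Re z) by (rewrite <- Rabs_mult; apply Rabs_right; nra).
  assert (Rabs (Im z) * Rabs (Im z) = Im z * Im z) by (rewrite <- Rabs_mult; apply Rabs_right; nra).
  nra.
Qed.

Lemma abs_Re_le_Cmod (z : C) : Rabs (Re z) <= Cmod z.
Proof.
  pose proof (Cmod_ge_0 z). pose proof (Cmod_sqr z). apply Rabs_le. split; nra.
Qed.

Lemma abs_Im_le_Cmod (z : C) : Rabs (Im z) <= Cmod z.
Proof.
  pose proof (Cmod_ge_0 z). pose proof (Cmod_sqr z). apply Rabs_le. split; nra.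
Qed.

(** The little-o form of the derivative; with the non-strict inequality the point [w = z] needs no
    exception. *)
Definition Cdiff (f : C -> C) (z l : C) : Prop :=
  forall eps, 0 < eps -> exists d, 0 < d /\
    forall w, Cmod (w - z) < d -> Cmod (f w - f z - l * (w - z)) <= eps * Cmod (w - z).

Lemma is_derive_Cdiff (f : C -> C) (z l : C) :
  @is_derive C_AbsRing C_NormedModule f z l -> Cdiff f z l.
Proof.
  intros [_ H] eps He.
  assert (Hz : is_filter_lim (locally (T := AbsRing_UniformSpace C_AbsRing) z) z) by (intros P HP; exact HP).
  destruct (H z Hz (mkposreal eps He)) as [d Hd].
  exists d. split; [apply cond_pos|]. intros w Hw.
  specialize (Hd w Hw).
  replace (f w - f z - l * (w - z))%C with (f w - f z - (w - z) * l)%C by ring.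
  exact Hd.
Qed.

Definition Ccont (f : C -> C) (z : C) : Prop :=
  forall eps, 0 < eps -> exists d, 0 < d /\
    forall w, Cmod (w - z) < d -> Cmod (f w - f z) < eps.

Lemma Cdiff_local_lipschitz f z l : Cdiff f z l ->
  exists d, 0 < d /\ forall w, Cmod (w - z) < d ->
    Cmod (f w - f z) <= (Cmod l + 1) * Cmod (w - z).
Proof.
  intros H. destruct (H 1) as [d [Hd Hw]]; [lra|].
  exists d. split; auto. intros w Hwd. specialize (Hw w Hwd).
  replace (f w - f z)%C with ((f w - f z - l * (w - z)) + l * (w - z))%C by ring.
  eapply Rle_trans; [apply Cmod_triangle|]. rewrite Cmod_mult. lra.
Qed.

Lemma Cdiff_cont f z l : Cdiff f z l -> Ccont f z.
Proof.
  intros H eps He. destruct (Cdiff_local_lipschitz _ _ _ H) as [d [Hd Hw]].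
  assert (Hl : 0 < Cmod l + 1) by (pose proof (Cmod_ge_0 l); lra).
  exists (Rmin d (eps / (Cmod l + 1))). split.
  - apply Rmin_pos; auto. now apply Rdiv_lt_0_compat.
  - intros w Hwd. eapply Rle_lt_trans; [apply Hw; eapply Rlt_le_trans; [exact Hwd|apply Rmin_l]|].
    apply Rlt_le_trans with ((Cmod l + 1) * (eps / (Cmod l + 1))).
    + apply Rmult_lt_compat_l; auto. eapply Rlt_le_trans; [exact Hwd|apply Rmin_r].
    + right. field. lra.
Qed.

Lemma Cdiff_unique f z l1 l2 : Cdiff f z l1 -> Cdiff f z l2 -> l1 = l2.
Proof.
  intros H1 H2.
  destruct (Req_dec (Cmod (l1 - l2)) 0) as [E|E].
  { apply Cmod_eq_0 in E. replace l1 with ((l1 - l2) + l2)%C by ring. rewrite E. ring. }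
  assert (Hp : 0 < Cmod (l1 - l2)) by (pose proof (Cmod_ge_0 (l1 - l2)); lra).
  destruct (H1 (Cmod (l1 - l2) / 4)) as [d1 [Hd1 Hw1]]; [lra|].
  destruct (H2 (Cmod (l1 - l2) / 4)) as [d2 [Hd2 Hw2]]; [lra|].
  set (h := Rmin d1 d2 / 2).
  assert (Hm : 0 < Rmin d1 d2) by now apply Rmin_pos.
  assert (Hh : Cmod ((z + RtoC h) - z) = h).
  { replace (z + RtoC h - z)%C with (RtoC h) by ring. rewrite Cmod_R. apply Rabs_right. unfold h; lra. }
  pose proof (Rmin_l d1 d2). pose proof (Rmin_r d1 d2).
  specialize (Hw1 (z + RtoC h)%C). specialize (Hw2 (z + RtoC h)%C).
  rewrite Hh in Hw1, Hw2.
  assert (A1 := Hw1 ltac:(unfold h; lra)). assert (A2 := Hw2 ltac:(unfold h; lra)).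
  set (X1 := (f (z + RtoC h)%C - f z - l1 * (z + RtoC h - z))%C) in *.
  set (X2 := (f (z + RtoC h)%C - f z - l2 * (z + RtoC h - z))%C) in *.
  assert (HX : Cmod (X2 - X1) = Cmod (l1 - l2) * h).
  { rewrite <- Hh, <- Cmod_mult. f_equal. unfold X1, X2. ring. }
  pose proof (Cmod_sub_le X2 X1).
  assert (0 < h) by (unfold h; lra). nra.
Qed.

Lemma Cdiff_ext f g z l : (exists d, 0 < d /\ forall w, Cmod (w - z) < d -> f w = g w) ->
  Cdiff f z l -> Cdiff g z l.
Proof.
  intros [d0 [Hd0 E]] H eps He. destruct (H eps He) as [d [Hd Hw]].
  exists (Rmin d d0). split; [now apply Rmin_pos|]. intros w Hwd.
  rewrite <- E by (eapply Rlt_le_trans; [exact Hwd|apply Rmin_r]).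
  rewrite <- (E z) by (rewrite Cmod_sub_0; lra).
  apply Hw. eapply Rlt_le_trans; [exact Hwd|apply Rmin_l].
Qed.

Lemma Cdiff_const c z : Cdiff (fun _ => c) z (RtoC 0).
Proof.
  intros eps He. exists 1. split; [lra|]. intros w _.
  replace (c - c - RtoC 0 * (w - z))%C with (RtoC 0) by ring. rewrite Cmod_0.
  apply Rmult_le_pos; [lra|apply Cmod_ge_0].
Qed.

Lemma Cdiff_affine a c z : Cdiff (fun w => (a * w + c)%C) z a.
Proof.
  intros eps He. exists 1. split; [lra|]. intros w _.
  replace (a * w + c - (a * z + c) - a * (w - z))%C with (RtoC 0) by ring. rewrite Cmod_0.
  apply Rmult_le_pos; [lra|apply Cmod_ge_0].
Qed.

Lemma Cdiff_plus f g z l m : Cdiff f z l -> Cdiff g z m ->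
  Cdiff (fun w => (f w + g w)%C) z (l + m)%C.
Proof.
  intros Hf Hg eps He.
  destruct (Hf (eps / 2)) as [d1 [Hd1 H1]]; [lra|].
  destruct (Hg (eps / 2)) as [d2 [Hd2 H2]]; [lra|].
  exists (Rmin d1 d2). split; [now apply Rmin_pos|]. intros w Hw.
  assert (A1 := H1 w ltac:(eapply Rlt_le_trans; [exact Hw|apply Rmin_l])).
  assert (A2 := H2 w ltac:(eapply Rlt_le_trans; [exact Hw|apply Rmin_r])).
  replace (f w + g w - (f z + g z) - (l + m) * (w - z))%C
    with ((f w - f z - l * (w - z)) + (g w - g z - m * (w - z)))%C by ring.
  eapply Rle_trans; [apply Cmod_triangle|]. lra.
Qed.

Lemma Cdiff_mult f g z l m : Cdiff f z l -> Cdiff g z m ->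
  Cdiff (fun w => (f w * g w)%C) z (l * g z + f z * m)%C.
Proof.
  intros Hf Hg eps He.
  set (K := Cmod (f z) + Cmod (g z) + 1).
  pose proof (Cmod_ge_0 (f z)). pose proof (Cmod_ge_0 (g z)). pose proof (Cmod_ge_0 l).
  pose proof (Cmod_ge_0 m).
  assert (HK : 0 < K) by (unfold K; lra).
  assert (He' : 0 < eps / (2 * K)) by (apply Rdiv_lt_0_compat; lra).
  destruct (Hf _ He') as [d1 [Hd1 U1]].
  destruct (Hg _ He') as [d2 [Hd2 U2]].
  destruct (Cdiff_local_lipschitz _ _ _ Hf) as [d3 [Hd3 U3]].
  destruct (Cdiff_local_lipschitz _ _ _ Hg) as [d4 [Hd4 U4]].
  set (LL := (Cmod l + 1) * (Cmod m + 1)).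
  assert (HLL : 0 < LL) by (unfold LL; apply Rmult_lt_0_compat; lra).
  exists (Rmin (Rmin d1 d2) (Rmin (Rmin d3 d4) (eps / (2 * LL)))).
  split.
  { repeat apply Rmin_pos; auto. apply Rdiv_lt_0_compat; lra. }
  intros w Hw.
  pose proof (Rmin_l (Rmin d1 d2) (Rmin (Rmin d3 d4) (eps / (2 * LL)))).
  pose proof (Rmin_r (Rmin d1 d2) (Rmin (Rmin d3 d4) (eps / (2 * LL)))).
  pose proof (Rmin_l d1 d2). pose proof (Rmin_r d1 d2).
  pose proof (Rmin_l (Rmin d3 d4) (eps / (2 * LL))).
  pose proof (Rmin_r (Rmin d3 d4) (eps / (2 * LL))).
  pose proof (Rmin_l d3 d4). pose proof (Rmin_r d3 d4).
  assert (A1 := U1 w ltac:(lra)). assert (A2 := U2 w ltac:(lra)).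
  assert (A3 := U3 w ltac:(lra)). assert (A4 := U4 w ltac:(lra)).
  assert (A5 : Cmod (w - z) <= eps / (2 * LL)) by lra.
  pose proof (Cmod_ge_0 (w - z)) as Hwz.
  replace (f w * g w - f z * g z - (l * g z + f z * m) * (w - z))%C
    with ((f w - f z - l * (w - z)) * g z + f z * (g w - g z - m * (w - z))
          + (f w - f z) * (g w - g z))%C by ring.
  eapply Rle_trans; [apply Cmod_triangle|].
  eapply Rle_trans; [apply Rplus_le_compat_r, Cmod_triangle|].
  rewrite !Cmod_mult.
  assert (B1 : Cmod (f w - f z - l * (w - z)) * Cmod (g z) <= eps / (2 * K) * Cmod (w - z) * Cmod (g z))
    by (apply Rmult_le_compat_r; auto).
  assert (B2 : Cmod (f z) * Cmod (g w - g z - m * (w - z)) <= Cmod (f z) * (eps / (2 * K) * Cmod (w - z)))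
    by (apply Rmult_le_compat_l; auto).
  assert (B3 : Cmod (f w - f z) * Cmod (g w - g z) <= ((Cmod l + 1) * Cmod (w - z)) * ((Cmod m + 1) * Cmod (w - z)))
    by (apply Rmult_le_compat; auto using Cmod_ge_0).
  assert (B4 : ((Cmod l + 1) * Cmod (w - z)) * ((Cmod m + 1) * Cmod (w - z)) <= eps / 2 * Cmod (w - z)).
  { replace (((Cmod l + 1) * Cmod (w - z)) * ((Cmod m + 1) * Cmod (w - z))) with (LL * Cmod (w - z) * Cmod (w - z)) by (unfold LL; ring).
    apply Rmult_le_compat_r; auto.
    apply Rle_trans with (LL * (eps / (2 * LL))); [apply Rmult_le_compat_l; lra|right; field; lra]. }
  assert (B5 : eps / (2 * K) * Cmod (w - z) * Cmod (g z) + Cmod (f z) * (eps / (2 * K) * Cmod (w - z)) <= eps / 2 * Cmod (w - z)).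
  { replace (eps / (2 * K) * Cmod (w - z) * Cmod (g z) + Cmod (f z) * (eps / (2 * K) * Cmod (w - z)))
      with ((Cmod (f z) + Cmod (g z)) * (eps / (2 * K) * Cmod (w - z))) by ring.
    apply Rle_trans with (K * (eps / (2 * K) * Cmod (w - z))).
    - apply Rmult_le_compat_r; [apply Rmult_le_pos; lra|unfold K; lra].
    - right; field; lra. }
  lra.
Qed.

Lemma Cdiff_comp_affine f a c z l : Cdiff f (a * z + c)%C l ->
  Cdiff (fun w => f (a * w + c)%C) z (a * l)%C.
Proof.
  intros H eps He. pose proof (Cmod_ge_0 a) as Ha.
  destruct (H (eps / (Cmod a + 1))) as [d [Hd Hw]]; [apply Rdiv_lt_0_compat; lra|].
  exists (d / (Cmod a + 1)). split; [apply Rdiv_lt_0_compat; lra|].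
  intros w Hwd. specialize (Hw (a * w + c)%C).
  assert (E : (a * w + c - (a * z + c))%C = (a * (w - z))%C) by ring.
  rewrite E, Cmod_mult in Hw.
  pose proof (Cmod_ge_0 (w - z)) as Hwz.
  assert (Hlt : Cmod a * Cmod (w - z) < d).
  { apply Rle_lt_trans with ((Cmod a + 1) * Cmod (w - z)); [nra|].
    apply Rlt_le_trans with ((Cmod a + 1) * (d / (Cmod a + 1))); [nra|right; field; lra]. }
  specialize (Hw Hlt).
  replace (a * l * (w - z))%C with (l * (a * (w - z)))%C by ring.
  eapply Rle_trans; [exact Hw|]. rewrite <- Rmult_assoc. apply Rmult_le_compat_r; auto.
  apply Rle_trans with (eps / (Cmod a + 1) * (Cmod a + 1)); [|right; field; lra].
  apply Rmult_le_compat_l; [apply Rlt_le, Rdiv_lt_0_compat; lra|lra].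
Qed.

Lemma Cdiff_inv z : z <> RtoC 0 -> Cdiff Cinv z (- / (z * z))%C.
Proof.
  intros Hz eps He. assert (Hm : 0 < Cmod z) by now apply Cmod_gt_0.
  set (m := Cmod z) in *.
  exists (Rmin (m / 2) (eps * (m * m * m) / 2)). split.
  { apply Rmin_pos; [lra|]. assert (0 < m * m * m) by (repeat apply Rmult_lt_0_compat; auto). nra. }
  intros w Hw.
  pose proof (Rmin_l (m / 2) (eps * (m * m * m) / 2)). pose proof (Rmin_r (m / 2) (eps * (m * m * m) / 2)).
  pose proof (Cmod_triangle_rev z w) as T. rewrite Cmod_sub_sym in T. fold m in T.
  assert (Hmw : m / 2 <= Cmod w) by lra.
  assert (Hw0 : w <> RtoC 0) by (apply Cmod_pos_neq0; lra).
  replace (/ w - / z - - / (z * z) * (w - z))%C with ((w - z) * (w - z) * / (w * (z * z)))%C by (field; auto).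
  rewrite !Cmod_mult, Cmod_inv by (repeat apply Cmult_neq_0; auto).
  rewrite !Cmod_mult. fold m. pose proof (Cmod_ge_0 (w - z)).
  replace (Cmod (w - z) * Cmod (w - z) * / (Cmod w * (m * m)))
    with ((Cmod (w - z) * / (Cmod w * (m * m))) * Cmod (w - z)) by ring.
  apply Rmult_le_compat_r; auto.
  assert (Hp : 0 < Cmod w * (m * m)) by (repeat apply Rmult_lt_0_compat; lra).
  apply Rmult_le_reg_r with (Cmod w * (m * m)); auto.
  rewrite Rmult_assoc, Rinv_l, Rmult_1_r by lra.
  apply Rle_trans with (eps * (m * m * m) / 2); [lra|].
  replace (eps * (m * m * m) / 2) with (eps * (m / 2 * (m * m))) by field.
  apply Rmult_le_compat_l; [lra|]. apply Rmult_le_compat_r; nra.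
Qed.

(** Just the regularity that a second derivative test needs: nothing is asked of [f2] beyond
    existence. Even at boundary points of a closed [D] the derivatives are taken in a full
    neighbourhood. *)
Definition hol2 (D : C -> Prop) (f : C -> C) : Prop :=
  exists f1 f2 : C -> C, forall z, D z -> Cdiff f z (f1 z) /\ Cdiff f1 z (f2 z).

Lemma hol2_subset (D D' : C -> Prop) f : (forall z, D' z -> D z) -> hol2 D f -> hol2 D' f.
Proof. intros S [f1 [f2 H]]. exists f1, f2. auto. Qed.

Lemma hol2_cont D f z : hol2 D f -> D z -> Ccont f z.
Proof. intros [f1 [f2 H]] Hz. eapply Cdiff_cont. apply H; auto. Qed.

Lemma hol2_const D c : hol2 D (fun _ => c).
Proof. exists (fun _ => RtoC 0), (fun _ => RtoC 0). intros. split; apply Cdiff_const. Qed.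

Lemma hol2_sub_const D f c : hol2 D f -> hol2 D (fun z => (f z - c)%C).
Proof.
  intros [f1 [f2 H]]. exists f1, f2. intros z Hz. destruct (H z Hz) as [H1 H2]. split; auto.
  replace (f1 z) with (f1 z + RtoC 0)%C by ring.
  apply (Cdiff_plus f (fun _ => (- c)%C)); auto. apply Cdiff_const.
Qed.

Lemma hol2_mult D f g : hol2 D f -> hol2 D g -> hol2 D (fun z => (f z * g z)%C).
Proof.
  intros [f1 [f2 Hf]] [g1 [g2 Hg]].
  exists (fun z => (f1 z * g z + f z * g1 z)%C),
         (fun z => ((f2 z * g z + f1 z * g1 z) + (f1 z * g1 z + f z * g2 z))%C).
  intros z Hz. destruct (Hf z Hz). destruct (Hg z Hz). split.
  - now apply Cdiff_mult.
  - apply (Cdiff_plus (fun z => f1 z * g z)%C (fun z => f z * g1 z)%C); now apply Cdiff_mult.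
Qed.

Lemma hol2_pow D f k : hol2 D f -> hol2 D (fun z => (f z ^ k)%C).
Proof.
  intros H. induction k as [|k IH].
  - apply (hol2_const D (RtoC 1)).
  - apply (hol2_mult D f (fun z => (f z ^ k)%C) H IH).
Qed.

Lemma hol2_comp_affine (D D' : C -> Prop) f a c : (forall z, D' z -> D (a * z + c)%C) ->
  hol2 D f -> hol2 D' (fun z => f (a * z + c)%C).
Proof.
  intros S [f1 [f2 H]].
  exists (fun z => (a * f1 (a * z + c)%C)%C), (fun z => (a * (a * f2 (a * z + c)%C))%C).
  intros z Hz. destruct (H _ (S z Hz)) as [H1 H2]. split.
  - now apply Cdiff_comp_affine.
  - replace (a * (a * f2 (a * z + c)))%C with (RtoC 0 * f1 (a * z + c)%C + a * (a * f2 (a * z + c)%C))%C by ring.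
    apply (Cdiff_mult (fun _ => a) (fun w => f1 (a * w + c)%C)).
    + apply Cdiff_const.
    + now apply Cdiff_comp_affine.
Qed.

Lemma hol2_inv_sub (D : C -> Prop) c : (forall z, D z -> z <> c) -> hol2 D (fun z => (/ (z - c))%C).
Proof.
  intros HD.
  assert (H1 : forall z, z <> c -> Cdiff (fun z => (/ (z - c))%C) z (- / ((z - c) * (z - c)))%C).
  { intros z Hz. replace (- / ((z - c) * (z - c)))%C with (1 * - / ((z - c) * (z - c)))%C by ring.
    apply (Cdiff_ext (fun z => (/ (1 * z + - c))%C)).
    { exists 1. split; [lra|]. intros w _. f_equal. ring. }
    apply (Cdiff_comp_affine Cinv). replace (1 * z + - c)%C with (z - c)%C by ring.
    apply Cdiff_inv. intro E. apply Hz. replace z with (z - c + c)%C by ring. rewrite E. ring. }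
  exists (fun z => (- / ((z - c) * (z - c)))%C),
    (fun z => (-1 * ((- / ((z - c) * (z - c)) * / (z - c)) + / (z - c) * (- / ((z - c) * (z - c)))))%C).
  intros z Hz. specialize (HD z Hz). split; [now apply H1|].
  assert (Hzc : (z - c)%C <> RtoC 0).
  { intro E. apply HD. replace z with (z - c + c)%C by ring. rewrite E. ring. }
  assert (Hd : 0 < Cmod (z - c)) by now apply Cmod_gt_0.
  apply (Cdiff_ext (fun z => (-1 * (/ (z - c) * / (z - c)))%C)).
  { exists (Cmod (z - c)). split; auto. intros w Hw.
    assert (w - c <> 0)%C.
    { apply Cmod_pos_neq0. pose proof (Cmod_triangle_rev (z - c) (w - c)) as T.
      replace (z - c - (w - c))%C with (z - w)%C in T by ring. rewrite (Cmod_sub_sym z w) in T. lra. }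
    field. auto. }
  replace (-1 * ((- / ((z - c) * (z - c)) * / (z - c)) + / (z - c) * (- / ((z - c) * (z - c)))))%C
   with (RtoC 0 * (/ (z - c) * / (z - c)) + -1 * ((- / ((z - c) * (z - c)) * / (z - c)) + / (z - c) * (- / ((z - c) * (z - c)))))%C by ring.
  apply (Cdiff_mult (fun _ => (-1)%C) (fun z => (/ (z - c) * / (z - c))%C)); [apply Cdiff_const|].
  apply (Cdiff_mult (fun z => (/ (z - c))%C) (fun z => (/ (z - c))%C)); now apply H1.
Qed.

(** * The maximum principle *)

Definition cont_at (u : C -> R) (z : C) : Prop :=
  forall eps, 0 < eps -> exists d, 0 < d /\
    forall w, Cmod (w - z) < d -> Rabs (u w - u z) < eps.

Definition Cclosed (D : C -> Prop) : Prop :=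
  forall z, ~ D z -> exists d, 0 < d /\ forall w, Cmod (w - z) < d -> ~ D w.

(** Without a maximum, every point [p] has a disc on which [u] stays below its value at a chosen
    point of [D]. Finitely many such discs cover the square of half-side [K]; a point of [D] whose
    value is at least all the finitely many chosen ones lies in one of the discs, a contradiction.
    For [p] outside [D] the disc misses [D], and [z0] is a dummy choice. *)
Lemma compact_max (D : C -> Prop) (u : C -> R) (K : R) (z0 : C) :
  Cclosed D -> (forall z, D z -> Cmod z <= K) -> D z0 -> (forall z, D z -> cont_at u z) ->
  exists w, D w /\ forall z, D z -> u z <= u w.
Proof.
  intros Hcl Hb H0 Hu. apply NNPP. intro Hno.
  assert (Hex : forall w, D w -> exists z, D z /\ u w < u z).
  { intros w Hw. apply NNPP. intro Hn. apply Hno. exists w. split; auto.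
    intros z Hz. apply Rnot_lt_le. intro Hlt. apply Hn. now exists z. }
  assert (Hch : forall p : C, exists dz : posreal * C, D (snd dz) /\
     forall w, Cmod (w - p) < fst dz -> D w -> u w < u (snd dz)).
  { intros p. destruct (classic (D p)) as [Hp|Hp].
    - destruct (Hex p Hp) as [z [Hz Hlt]].
      destruct (Hu p Hp (u z - u p)) as [d [Hd Hw]]; [lra|].
      exists (mkposreal d Hd, z). split; auto. simpl. intros w Hwd _.
      specialize (Hw w Hwd). apply Rabs_def2 in Hw. lra.
    - destruct (Hcl p Hp) as [d [Hd Hw]].
      exists (mkposreal d Hd, z0). split; auto. simpl. intros w Hwd Dw. now destruct (Hw w Hwd). }
  apply functional_choice in Hch. destruct Hch as [g Hg].
  (* Half radii, because the cover is by squares: two coordinates, each off by less than half the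
     radius, differ by less than the radius in modulus. *)
  apply (compactness_list 2 (-K, (-K, tt)) (K, (K, tt))
    (fun t => pos_div_2 (fst (g (fst t, fst (snd t)))))).
  intros [l Hl].
  assert (Hmax : forall l : list (Compactness.Tn 2 R), exists z, D z /\ (u z0 <= u z) /\
     forall t, In t l -> u (snd (g (fst t, fst (snd t)))) <= u z).
  { clear Hl l. induction l as [|t l [z [Hz [H0z IH]]]].
    - exists z0. repeat split; auto; [lra|]. intros t [].
    - destruct (Rle_dec (u (snd (g (fst t, fst (snd t))))) (u z)) as [Hle|Hgt].
      + exists z. repeat split; auto. intros t' [<-|Ht']; auto.
      + exists (snd (g (fst t, fst (snd t)))). split; [apply Hg|]. split; [lra|].
        intros t' [<-|Ht']; [lra|]. specialize (IH t' Ht'). lra. }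
  destruct (Hmax l) as [z [Hz [_ Hzl]]].
  assert (HzK := Hb z Hz).
  pose proof (abs_Re_le_Cmod z) as HR. pose proof (abs_Im_le_Cmod z) as HI.
  apply Rabs_le_between in HR. apply Rabs_le_between in HI.
  destruct (Hl (Re z, (Im z, tt))) as [t [Ht [_ Hcl2]]].
  { simpl. repeat split; lra. }
  destruct t as [t1 [t2 []]]. simpl in Hcl2.
  destruct (Hg (t1, t2)) as [_ Hgt].
  assert (Hlt : u z < u (snd (g (t1, t2)))).
  { apply Hgt; auto. eapply Rle_lt_trans; [apply Cmod_le_abs_sum|].
    replace (Re (z - (t1, t2))) with (Re z - t1) by (destruct z; reflexivity).
    replace (Im (z - (t1, t2))) with (Im z - t2) by (destruct z; reflexivity).
    destruct Hcl2 as [A1 [A2 _]]. lra. }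
  specialize (Hzl _ Ht). simpl in Hzl. lra.
Qed.

Lemma Ccont_mod f z : Ccont f z -> cont_at (fun w => Cmod (f w)) z.
Proof.
  intros H eps He. destruct (H eps He) as [d [Hd Hw]]. exists d. split; auto.
  intros w Hwd. specialize (Hw w Hwd). apply Rabs_def1.
  - eapply Rle_lt_trans; [apply Cmod_triangle_rev|auto].
  - pose proof (Cmod_triangle_rev (f z) (f w)) as T. rewrite Cmod_sub_sym in T. lra.
Qed.

Lemma cont_at_of_continuity_pt (h : R -> R) u z :
  continuity_pt h (u z) -> cont_at u z -> cont_at (fun w => h (u w)) z.
Proof.
  intros Hh Hu eps He. destruct (Hh eps He) as [a [Ha Hx]].
  destruct (Hu a Ha) as [d [Hd Hw]]. exists d. split; auto. intros w Hwd.
  destruct (Req_dec (u z) (u w)) as [E|E].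
  - rewrite E, Rminus_diag, Rabs_R0. auto.
  - apply (Hx (u w)). split; [split; [exact I|auto]|]. now apply Hw.
Qed.

Lemma cont_at_plus u v z : cont_at u z -> cont_at v z -> cont_at (fun w => u w + v w) z.
Proof.
  intros Hu Hv eps He. destruct (Hu (eps / 2)) as [d1 [Hd1 H1]]; [lra|].
  destruct (Hv (eps / 2)) as [d2 [Hd2 H2]]; [lra|].
  exists (Rmin d1 d2). split; [now apply Rmin_pos|]. intros w Hw.
  assert (A1 := H1 w ltac:(eapply Rlt_le_trans; [exact Hw|apply Rmin_l])).
  assert (A2 := H2 w ltac:(eapply Rlt_le_trans; [exact Hw|apply Rmin_r])).
  apply Rabs_def2 in A1. apply Rabs_def2 in A2. apply Rabs_def1; lra.
Qed.

(** Polarization, [4 u v = (u + v)^2 - (u - v)^2], reduces products to sums and to composition with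
    functions of one real variable. *)
Lemma cont_at_mult u v z : cont_at u z -> cont_at v z -> cont_at (fun w => u w * v w) z.
Proof.
  intros Hu Hv.
  assert (Hsq : forall x, continuity_pt Rsqr x) by (intro; apply derivable_continuous, derivable_Rsqr).
  assert (Hc : forall c x, continuity_pt (fun y => c * y) x)
    by (intros; apply continuity_pt_scal, continuity_pt_id).
  intros eps He.
  destruct (cont_at_plus _ _ z
     (cont_at_of_continuity_pt (fun y => (/ 4) * y) _ z (Hc (/4) _)
        (cont_at_of_continuity_pt Rsqr _ z (Hsq _) (cont_at_plus u v z Hu Hv)))
     (cont_at_of_continuity_pt (fun y => (- / 4) * y) _ z (Hc (- / 4) _)
        (cont_at_of_continuity_pt Rsqr _ z (Hsq _)
           (cont_at_plus u (fun w => (-1) * v w) z Hu (cont_at_of_continuity_pt _ v z (Hc (-1) _) Hv)))) eps He)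
    as [d [Hd Hw]].
  exists d. split; auto. intros w Hwd. specialize (Hw w Hwd). unfold Rsqr in Hw.
  match goal with H : Rabs ?a < _ |- Rabs ?b < _ => replace b with a; auto end. field.
Qed.

Lemma cont_at_const c z : cont_at (fun _ => c) z.
Proof.
  intros eps He. exists 1. split; [lra|]. intros. rewrite Rminus_diag, Rabs_R0. auto.
Qed.

Lemma cont_at_pow u k z : cont_at u z -> cont_at (fun w => u w ^ k) z.
Proof.
  intros H. induction k as [|k IH]; simpl; [apply cont_at_const | now apply cont_at_mult].
Qed.

Lemma Ccont_id z : Ccont (fun w => w) z.
Proof. intros eps He. exists eps. auto. Qed.

(** At the maximum [phi1 0 = 0]; were [l] positive, [phi1] would be positive just to the right of 0
    and [phi] would increase there. *)
Lemma second_derivative_test (phi phi1 : R -> R) (l d : R) : 0 < d ->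
  (forall t, Rabs t < d -> is_derive phi t (phi1 t)) -> is_derive phi1 0 l ->
  (forall t, Rabs t < d -> phi t <= phi 0) -> l <= 0.
Proof.
  intros Hd Hphi Hphi1 Hmax.
  assert (H00 : phi1 0 = 0).
  { assert (Hp : derivable_pt_lim phi 0 (phi1 0))
      by (apply is_derive_Reals, Hphi; rewrite Rabs_R0; auto).
    set (pr := exist _ (phi1 0) Hp : derivable_pt phi 0).
    change (phi1 0) with (derive_pt phi 0 pr).
    apply (deriv_maximum phi (-d) d 0 pr); try lra.
    intros x Hx1 Hx2. apply Hmax. apply Rabs_def1; lra. }
  apply Rnot_lt_le. intro Hl.
  apply is_derive_Reals in Hphi1. destruct (Hphi1 (l / 2)) as [e He]; [lra|].
  set (t := Rmin (e / 2) (d / 2)).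
  pose proof (cond_pos e).
  assert (Ht0 : 0 < t) by (unfold t; apply Rmin_pos; lra).
  assert (Hte : t <= e / 2) by apply Rmin_l. assert (Htd : t <= d / 2) by apply Rmin_r.
  destruct (MVT_cor2 phi phi1 0 t Ht0) as [c [E Hc]].
  { intros x Hx. apply is_derive_Reals, Hphi. apply Rabs_def1; lra. }
  assert (Ht := Hmax t ltac:(apply Rabs_def1; lra)).
  assert (Hcp := He c ltac:(lra) ltac:(apply Rabs_def1; lra)).
  rewrite Rplus_0_l, H00, Rminus_0_r in Hcp. apply Rabs_def2 in Hcp.
  assert (0 < phi1 c).
  { replace (phi1 c) with (phi1 c / c * c) by (field; lra). apply Rmult_lt_0_compat; lra. }
  nra.
Qed.

(** Here [p] is [Re] or [Im]: additive, real-homogeneous and bounded by the modulus. *)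
Lemma Cdiff_real_part_line (p : C -> R) f w e t l :
  (forall x y, p (x - y)%C = p x - p y) -> (forall (r : R) x, p (RtoC r * x)%C = r * p x) ->
  (forall x, Rabs (p x) <= Cmod x) ->
  Cdiff f (w + RtoC t * e)%C l ->
  is_derive (fun t => p (f (w + RtoC t * e)%C)) t (p (l * e)%C).
Proof.
  intros Hsub Hscal Hle H. apply is_derive_Reals. intros eps He.
  pose proof (Cmod_ge_0 e) as Hce.
  destruct (H (eps / (2 * (Cmod e + 1)))) as [d [Hd Hw]]; [apply Rdiv_lt_0_compat; lra|].
  assert (Hd' : 0 < d / (Cmod e + 1)) by (apply Rdiv_lt_0_compat; lra).
  exists (mkposreal _ Hd'). simpl. intros h Hh0 Hh.
  specialize (Hw (w + RtoC (t + h) * e)%C).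
  assert (E : (w + RtoC (t + h) * e - (w + RtoC t * e) = RtoC h * e)%C) by (rewrite RtoC_plus; ring).
  rewrite E, Cmod_mult, Cmod_R in Hw.
  assert (Hha : 0 < Rabs h) by now apply Rabs_pos_lt.
  assert (Hlt : Rabs h * Cmod e < d).
  { apply Rle_lt_trans with (Rabs h * (Cmod e + 1)); [nra|].
    apply Rlt_le_trans with (d / (Cmod e + 1) * (Cmod e + 1)); [|right; field; lra].
    apply Rmult_lt_compat_r; lra. }
  specialize (Hw Hlt).
  assert (Hp : Rabs (p (f (w + RtoC (t + h) * e)%C) - p (f (w + RtoC t * e)%C) - h * p (l * e)%C)
    <= eps / (2 * (Cmod e + 1)) * (Rabs h * Cmod e)).
  { rewrite <- Hscal, <- !Hsub. eapply Rle_trans; [apply Hle|].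
    replace (RtoC h * (l * e))%C with (l * (RtoC h * e))%C by ring. exact Hw. }
  replace ((p (f (w + RtoC (t + h) * e)%C) - p (f (w + RtoC t * e)%C)) / h - p (l * e)%C)
    with ((p (f (w + RtoC (t + h) * e)%C) - p (f (w + RtoC t * e)%C) - h * p (l * e)%C) / h)
    by (field; auto).
  rewrite Rabs_div by auto.
  apply Rmult_lt_reg_r with (Rabs h); auto.
  unfold Rdiv at 1. rewrite Rmult_assoc, Rinv_l, Rmult_1_r by lra.
  eapply Rle_lt_trans; [exact Hp|].
  replace (eps / (2 * (Cmod e + 1)) * (Rabs h * Cmod e)) with (eps * Rabs h * (Cmod e / (2 * (Cmod e + 1)))) by (field; lra).
  assert (Cmod e / (2 * (Cmod e + 1)) < 1).
  { apply Rmult_lt_reg_r with (2 * (Cmod e + 1)); [lra|]. unfold Rdiv.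
    rewrite Rmult_assoc, Rinv_l by lra. lra. }
  assert (0 < eps * Rabs h) by now apply Rmult_lt_0_compat. nra.
Qed.

Lemma Cdiff_Re_line f w e t l : Cdiff f (w + RtoC t * e)%C l ->
  is_derive (fun t => Re (f (w + RtoC t * e)%C)) t (Re (l * e)%C).
Proof.
  apply Cdiff_real_part_line; [intros [] []; reflexivity | intros r []; unfold Re; simpl; ring | apply abs_Re_le_Cmod].
Qed.

Lemma Cdiff_Im_line f w e t l : Cdiff f (w + RtoC t * e)%C l ->
  is_derive (fun t => Im (f (w + RtoC t * e)%C)) t (Im (l * e)%C).
Proof.
  apply Cdiff_real_part_line; [intros [] []; reflexivity | intros r []; unfold Im; simpl; ring | apply abs_Im_le_Cmod].
Qed.

Definition sqmod (z : C) : R := Re z * Re z + Im z * Im z.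

Lemma is_derive_sqmod_line f w e t l : Cdiff f (w + RtoC t * e)%C l ->
  is_derive (fun t => sqmod (f (w + RtoC t * e)%C)) t
    (2 * (Re (f (w + RtoC t * e)%C) * Re (l * e)%C + Im (f (w + RtoC t * e)%C) * Im (l * e)%C)).
Proof.
  intros H. pose proof (Cdiff_Re_line _ _ _ _ _ H) as HR. pose proof (Cdiff_Im_line _ _ _ _ _ H) as HI.
  unfold sqmod.
  evar_last.
  - apply @is_derive_plus; apply @is_derive_mult; try exact HR; try exact HI; intros; apply Rmult_comm.
  - unfold plus, mult; simpl. ring.
Qed.

(** In the sum over the directions [e = 1] and [e = Ci] the terms with [l * e * e] cancel, because
    [e * e] changes sign; there remains [4 |f1 w|^2], the Laplacian of [|f|^2] at [w]. *)
Lemma is_derive_sqmod_line2 f f1 w e l :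
  Cdiff f w (f1 w) -> Cdiff f1 w l ->
  is_derive (fun t => 2 * (Re (f (w + RtoC t * e)%C) * Re (f1 (w + RtoC t * e)%C * e)%C
      + Im (f (w + RtoC t * e)%C) * Im (f1 (w + RtoC t * e)%C * e)%C)) 0
    (2 * (sqmod (f1 w * e) + Re (f w) * Re (l * e * e) + Im (f w) * Im (l * e * e))).
Proof.
  intros Hf Hf1.
  assert (E0 : (w + RtoC 0 * e)%C = w) by ring.
  assert (Hf' : Cdiff f (w + RtoC 0 * e)%C (f1 w)) by (rewrite E0; auto).
  assert (Hf1' : Cdiff (fun z => (f1 z * e)%C) (w + RtoC 0 * e)%C (l * e)%C).
  { rewrite E0. replace (l * e)%C with (l * e + f1 w * RtoC 0)%C by ring.
    apply (Cdiff_mult f1 (fun _ => e)); auto. apply Cdiff_const. }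
  pose proof (Cdiff_Re_line _ _ _ _ _ Hf') as HR. pose proof (Cdiff_Im_line _ _ _ _ _ Hf') as HI.
  pose proof (Cdiff_Re_line _ _ _ _ _ Hf1') as HR1. pose proof (Cdiff_Im_line _ _ _ _ _ Hf1') as HI1.
  evar_last.
  - apply @is_derive_scal. apply @is_derive_plus; apply @is_derive_mult;
      try exact HR; try exact HI; try exact HR1; try exact HI1; intros; apply Rmult_comm.
  - unfold plus, mult, sqmod, scal; simpl. unfold mult; simpl. rewrite E0. ring.
Qed.

(* |f|^2 + eps |z|^2 has positive Laplacian 4 |f'|^2 + 4 eps, hence no interior maximum. *)
Lemma maximum_principle (D Bd : C -> Prop) (f : C -> C) (K M : R) :
  Cclosed D -> (forall z, D z -> Cmod z <= K) -> hol2 D f ->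
  (forall z, D z -> ~ Bd z -> exists d, 0 < d /\ forall w, Cmod (w - z) < d -> D w) ->
  (forall z, D z -> Bd z -> Cmod (f z) <= M) -> 0 <= M ->
  forall z, D z -> Cmod (f z) <= M.
Proof.
  intros Hcl Hb [f1 [f2 Hf]] Hint HM HM0 z1 Hz1.
  apply Rnot_lt_le. intro Hgt.
  assert (HK : 0 <= K) by (pose proof (Hb _ Hz1); pose proof (Cmod_ge_0 z1); lra).
  assert (Hsq : forall z, sqmod z = Cmod z * Cmod z) by (intro; unfold sqmod; now rewrite Cmod_sqr).
  set (gap := Cmod (f z1) * Cmod (f z1) - M * M).
  assert (Hgap : 0 < gap) by (unfold gap; nra).
  (* Small enough that [eps |z|^2], with [|z| <= K], cannot make up for the gap between [|f z1|^2]
     and the boundary values; the [+ 1] covers [K = 0]. *)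
  set (eps := gap / (2 * (K * K + 1))).
  assert (Heps : 0 < eps) by (apply Rdiv_lt_0_compat; nra).
  assert (HepsK : eps * (K * K) < gap).
  { apply Rlt_le_trans with (eps * (2 * (K * K + 1))); [apply Rmult_lt_compat_l; nra|].
    right. unfold eps. field. nra. }
  destruct (compact_max D (fun z => sqmod (f z) + eps * sqmod z) K z1) as [w [Hw Hmax]]; auto.
  { intros z Hz eta Heta.
    assert (Hc : cont_at (fun z => Cmod (f z) * Cmod (f z) + eps * (Cmod z * Cmod z)) z).
    { assert (cont_at (fun z => Cmod (f z)) z) by (apply Ccont_mod; eapply Cdiff_cont; apply Hf; auto).
      assert (cont_at (fun z => Cmod z) z) by (apply (Ccont_mod (fun z => z)), Ccont_id).
      apply cont_at_plus; [now apply cont_at_mult|].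
      apply (cont_at_mult (fun _ => eps)); [apply cont_at_const|now apply cont_at_mult]. }
    destruct (Hc eta Heta) as [d [Hd Hx]]. exists d. split; auto. intros x Hxd. rewrite !Hsq. auto. }
  assert (Hnb : ~ Bd w).
  { intro Hbw. specialize (HM w Hw Hbw). specialize (Hmax z1 Hz1). simpl in Hmax. rewrite !Hsq in Hmax.
    pose proof (Hb _ Hw). pose proof (Cmod_ge_0 w). pose proof (Cmod_ge_0 (f w)). pose proof (Cmod_ge_0 z1).
    assert (Cmod w * Cmod w <= K * K) by nra.
    assert (eps * (Cmod w * Cmod w) <= eps * (K * K)) by (apply Rmult_le_compat_l; lra).
    assert (0 <= eps * (Cmod z1 * Cmod z1)) by (apply Rmult_le_pos; nra).
    unfold gap in *. nra. }
  destruct (Hint w Hw Hnb) as [d [Hd HD]].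
  assert (Hdir : forall e, Cmod e = 1 ->
     2 * (sqmod (f1 w * e) + Re (f w) * Re (f2 w * e * e) + Im (f w) * Im (f2 w * e * e))
     + eps * (2 * (sqmod (RtoC 1 * e) + Re w * Re (RtoC 0 * e * e) + Im w * Im (RtoC 0 * e * e))) <= 0).
  { intros e He.
    assert (Hline : forall t, Rabs t < d -> D (w + RtoC t * e)%C).
    { intros t Ht. apply HD. replace (w + RtoC t * e - w)%C with (RtoC t * e)%C by ring.
      rewrite Cmod_mult, Cmod_R, He. lra. }
    assert (Hid : forall z, Cdiff (fun z => z) z (RtoC 1)).
    { intros z. apply (Cdiff_ext (fun z => (RtoC 1 * z + RtoC 0)%C)).
      - exists 1. split; [lra|]. intros; ring.
      - apply Cdiff_affine. }
    eapply (second_derivative_test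
      (fun t => sqmod (f (w + RtoC t * e)%C) + eps * sqmod (w + RtoC t * e)%C)
      (fun t => 2 * (Re (f (w + RtoC t * e)%C) * Re (f1 (w + RtoC t * e)%C * e)%C
                     + Im (f (w + RtoC t * e)%C) * Im (f1 (w + RtoC t * e)%C * e)%C)
        + eps * (2 * (Re (w + RtoC t * e)%C * Re (RtoC 1 * e)%C
                     + Im (w + RtoC t * e)%C * Im (RtoC 1 * e)%C))) _ d Hd).
    - intros t Ht. apply @is_derive_plus.
      + apply is_derive_sqmod_line. apply Hf. auto.
      + apply @is_derive_scal. apply (is_derive_sqmod_line (fun z => z)). apply Hid.
    - apply @is_derive_plus.
      + apply is_derive_sqmod_line2; apply Hf; auto.
      + apply @is_derive_scal. apply (is_derive_sqmod_line2 (fun z => z) (fun _ => RtoC 1)).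
        * apply Hid.
        * apply Cdiff_const.
    - intros t Ht. replace (w + RtoC 0 * e)%C with w by ring. apply Hmax. auto. }
  assert (H1 := Hdir (RtoC 1) ltac:(rewrite Cmod_R; apply Rabs_R1)).
  assert (HCi : Cmod Ci = 1).
  { unfold Cmod, Ci. simpl. replace (0 * (0 * 1) + 1 * (1 * 1)) with 1 by ring. apply sqrt_1. }
  assert (H2 := Hdir Ci HCi).
  unfold sqmod, Re, Im, Ci, RtoC, Cmult in H1, H2; simpl in H1, H2.
  nra.
Qed.

(** * Annuli, Schwarz' lemma and Cauchy's estimates *)

Lemma Cclosed_annulus c s S : Cclosed (fun z => s <= Cmod (z - c) <= S).
Proof.
  intros z Hz.
  assert (Htri : forall w, Cmod (w - c) - Cmod (z - c) <= Cmod (w - z) /\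
    Cmod (z - c) - Cmod (w - c) <= Cmod (w - z)).
  { intros w. pose proof (Cmod_sub_triangle w z c). pose proof (Cmod_sub_triangle z w c) as T.
    rewrite (Cmod_sub_sym z w) in T. lra. }
  destruct (Rlt_dec (Cmod (z - c)) s).
  - exists (s - Cmod (z - c)). split; [lra|]. intros w Hw. destruct (Htri w). lra.
  - exists (Cmod (z - c) - S). split; [lra|]. intros w Hw. destruct (Htri w). lra.
Qed.

Lemma Cmod_le_center c z S : Cmod (z - c) <= S -> Cmod z <= Cmod c + S.
Proof. intros H. pose proof (Cmod_triangle_rev z c). lra. Qed.

Lemma bounded_on_compact (D : C -> Prop) (f : C -> C) K :
  Cclosed D -> (forall z, D z -> Cmod z <= K) -> (forall z, D z -> Ccont f z) ->
  exists M, 0 < M /\ forall z, D z -> Cmod (f z) <= M.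
Proof.
  intros Hcl Hb Hc. destruct (classic (exists z, D z)) as [[z0 H0]|Hn].
  - destruct (compact_max D (fun z => Cmod (f z)) K z0) as [w [Hw Hmax]]; auto.
    { intros; now apply Ccont_mod, Hc. }
    exists (Cmod (f w) + 1). split; [pose proof (Cmod_ge_0 (f w)); lra|].
    intros z Hz. specialize (Hmax z Hz). simpl in Hmax. lra.
  - exists 1. split; [lra|]. intros z Hz. destruct Hn. now exists z.
Qed.

(** The maximum principle for [g(z) / (z - c)^m], whose modulus on the two bounding circles is
    explicitly bounded. The free integer [m] plays the part of the real exponent in Hadamard's three
    circles theorem. *)
Lemma annulus_bound c s S g m M1 M2 : 0 < s -> s <= S -> 0 <= M1 -> 0 <= M2 ->
  hol2 (fun z => s <= Cmod (z - c) <= S) g ->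
  (forall z, Cmod (z - c) = s -> Cmod (g z) <= M1) ->
  (forall z, Cmod (z - c) = S -> Cmod (g z) <= M2) ->
  forall z, s <= Cmod (z - c) <= S ->
    Cmod (g z) <= Cmod (z - c) ^ m * Rmax (M1 / s ^ m) (M2 / S ^ m).
Proof.
  intros Hs HsS HM1 HM2 Hg B1 B2 z Hz.
  assert (Hps : 0 < s ^ m) by now apply pow_lt. assert (HpS : 0 < S ^ m) by (apply pow_lt; lra).
  assert (Hnz : forall w, s <= Cmod (w - c) -> (w - c)%C <> RtoC 0) by (intros; apply Cmod_pos_neq0; lra).
  assert (Hmod : forall w, s <= Cmod (w - c) ->
    Cmod (g w * (/ (w - c)) ^ m)%C = Cmod (g w) / Cmod (w - c) ^ m).
  { intros w Hw. rewrite Cmod_mult, Cmod_pow, Cmod_inv, pow_inv by auto. reflexivity. }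
  pose proof (Rmax_l (M1 / s ^ m) (M2 / S ^ m)). pose proof (Rmax_r (M1 / s ^ m) (M2 / S ^ m)).
  assert (HH : Cmod (g z * (/ (z - c)) ^ m)%C <= Rmax (M1 / s ^ m) (M2 / S ^ m)).
  { apply (maximum_principle (fun z => s <= Cmod (z - c) <= S)
      (fun z => Cmod (z - c) = s \/ Cmod (z - c) = S) (fun z => g z * (/ (z - c)) ^ m)%C (Cmod c + S)); auto.
    - apply Cclosed_annulus.
    - intros w [_ Hw]. now apply Cmod_le_center.
    - apply (hol2_mult _ g (fun z => (/ (z - c)) ^ m)%C); auto.
      apply (hol2_pow _ (fun z => / (z - c))%C). apply hol2_inv_sub.
      intros w [Hw _] E. apply (Hnz w Hw). rewrite E. ring.
    - intros w Hw Hn. assert (s < Cmod (w - c) < S).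
      { destruct Hw as [Hw1 Hw2]. split.
        - destruct Hw1 as [|E]; auto. exfalso. apply Hn. left. auto.
        - destruct Hw2 as [|E]; auto. exfalso. apply Hn. right. auto. }
      exists (Rmin (Cmod (w - c) - s) (S - Cmod (w - c))). split; [apply Rmin_pos; lra|].
      intros x Hx. pose proof (Rmin_l (Cmod (w - c) - s) (S - Cmod (w - c))).
      pose proof (Rmin_r (Cmod (w - c) - s) (S - Cmod (w - c))).
      pose proof (Cmod_sub_triangle x w c). pose proof (Cmod_sub_triangle w x c) as T.
      rewrite (Cmod_sub_sym w x) in T. lra.
    - intros w [Hw1 Hw2] Hb. rewrite Hmod by auto. destruct Hb as [E|E]; rewrite E.
      + eapply Rle_trans; [|apply Rmax_l]. apply Rmult_le_compat_r; auto.
        apply Rlt_le, Rinv_0_lt_compat; auto.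
      + eapply Rle_trans; [|apply Rmax_r]. apply Rmult_le_compat_r; auto.
        apply Rlt_le, Rinv_0_lt_compat; auto.
    - assert (0 <= M1 / s ^ m) by (apply Rdiv_le_0_compat; auto). lra. }
  rewrite Hmod in HH by apply Hz.
  assert (Hp : 0 < Cmod (z - c) ^ m) by (apply pow_lt; lra).
  replace (Cmod (g z)) with (Cmod (z - c) ^ m * (Cmod (g z) / Cmod (z - c) ^ m)) by (field; lra).
  apply Rmult_le_compat_l; lra.
Qed.

(** With 0 as bound on the inner circle, [annulus_bound] gives [|f z| <= M (x / S')^m] for every
    [m], where [x = |z - c| < S']. *)
Lemma zero_on_disc f c s S : 0 < s ->
  hol2 (fun z => Cmod (z - c) < S) f ->
  (forall z, Cmod (z - c) < s -> f z = RtoC 0) ->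
  forall z, Cmod (z - c) < S -> f z = RtoC 0.
Proof.
  intros Hs Hf H0 z Hz.
  destruct (Rlt_dec (Cmod (z - c)) s) as [|Hge]; auto.
  (* The outer circle has to stay inside the open disc, where [f] is known to be continuous and
     hence bounded on it. *)
  set (x := Cmod (z - c)) in *. set (S' := (x + S) / 2).
  assert (HS' : x < S' < S) by (unfold S'; lra).
  destruct (bounded_on_compact (fun z => S' <= Cmod (z - c) <= S') f (Cmod c + S')) as [M [HM HB]].
  - apply Cclosed_annulus.
  - intros w [_ Hw]. now apply Cmod_le_center.
  - intros w [_ Hw]. eapply hol2_cont; [exact Hf|]. simpl. lra.
  - apply Cmod_eq_0. apply Rle_antisym; [|apply Cmod_ge_0].
    apply Rnot_lt_le. intro Hpos.
    assert (Hq : Rabs (x / S') < 1).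
    { rewrite Rabs_right by (apply Rle_ge, Rdiv_le_0_compat; lra).
      apply Rmult_lt_reg_r with S'; [lra|]. unfold Rdiv. rewrite Rmult_assoc, Rinv_l; lra. }
    destruct (pow_lt_1_zero _ Hq (Cmod (f z) / M)) as [m Hm]; [now apply Rdiv_lt_0_compat|].
    specialize (Hm m (le_n m)).
    assert (Hb : Cmod (f z) <= x ^ m * Rmax (0 / (s / 2) ^ m) (M / S' ^ m)).
    { apply (annulus_bound c (s / 2) S' f m 0 M); try (unfold x in *; lra).
      - eapply hol2_subset; [|exact Hf]. simpl. intros w Hw. lra.
      - intros w Hw. rewrite H0, Cmod_0 by lra. lra.
      - intros w Hw. apply HB. lra. }
    rewrite Rmax_right in Hb.
    2:{ unfold Rdiv at 1. rewrite Rmult_0_l. apply Rdiv_le_0_compat; [lra|apply pow_lt; lra]. }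
    rewrite Rabs_right in Hm by (apply Rle_ge, pow_le, Rdiv_le_0_compat; lra).
    unfold Rdiv in Hm at 1. rewrite Rpow_mult_distr, pow_inv in Hm.
    apply (Rmult_lt_compat_r M) in Hm; auto.
    replace (Cmod (f z) / M * M) with (Cmod (f z)) in Hm by (field; lra).
    unfold Rdiv in Hb. lra.
Qed.

Lemma le_1_of_bounded_powers q K : (forall m : nat, q ^ m <= K) -> q <= 1.
Proof.
  intros H. apply Rnot_lt_le. intro Hq.
  destruct (INR_archimed (q - 1) K) as [m Hm]; [lra|].
  pose proof (poly m (q - 1)) as P. replace (1 + (q - 1)) with q in P by ring.
  specialize (H m). specialize (P ltac:(lra)). lra.
Qed.

(* The powers of f - f(c), divided by (z - c)^m, are estimated on s <= |z - c| <= S; first s -> 0, then m -> oo. *)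
Lemma schwarz_bound f c S M : 0 < S -> 0 < M ->
  hol2 (fun z => Cmod (z - c) <= S) f ->
  (forall z, Cmod (z - c) <= S -> Cmod (f z) <= M) ->
  forall z, Cmod (z - c) <= S -> Cmod (f z - f c) <= 2 * M / S * Cmod (z - c).
Proof.
  intros HS HM Hf HB z Hz.
  destruct (Req_dec (Cmod (z - c)) 0) as [E0|E0].
  { apply Cmod_eq_0 in E0. replace z with c by (replace z with ((z - c) + c)%C by ring; rewrite E0; ring).
    rewrite !Cmod_sub_0. lra. }
  assert (Hx : 0 < Cmod (z - c)) by (pose proof (Cmod_ge_0 (z - c)); lra).
  set (x := Cmod (z - c)) in *. set (y := Cmod (f z - f c)).
  assert (Hc : Cmod (c - c) <= S) by (rewrite Cmod_sub_0; lra).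
  assert (Hlip : exists L d, 0 < L /\ 0 < d /\ forall w, Cmod (w - c) < d -> Cmod (f w - f c) <= L * Cmod (w - c)).
  { destruct Hf as [f1 [f2 Hf]]. destruct (Hf c Hc) as [H1 _].
    destruct (Cdiff_local_lipschitz _ _ _ H1) as [d [Hd Hl]].
    exists (Cmod (f1 c) + 1), d. repeat split; auto. pose proof (Cmod_ge_0 (f1 c)); lra. }
  destruct Hlip as [L [d [HL [Hd Hlip]]]].
  assert (Hpow : forall m, y ^ (1 + m) <= x ^ m * ((2 * M) ^ (1 + m) / S ^ m)).
  { intros m.
    assert (HpL : 0 < L ^ (1 + m)) by now apply pow_lt.
    assert (HpM : 0 < (2 * M) ^ (1 + m) / S ^ m) by (apply Rdiv_lt_0_compat; apply pow_lt; lra).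
    (* On the inner circle [|f - f c| <= L s]. The power [1 + m] against the divisor [s^m] leaves
       one spare factor [s], and the last entry of the minimum uses it to make the inner term at
       most the outer one. *)
    set (s := Rmin (Rmin (d / 2) x) (((2 * M) ^ (1 + m) / S ^ m) / L ^ (1 + m))).
    assert (Hs : 0 < s) by (unfold s; repeat apply Rmin_pos; try lra; now apply Rdiv_lt_0_compat).
    assert (Hs1 : s <= d / 2) by (unfold s; eapply Rle_trans; [apply Rmin_l|apply Rmin_l]).
    assert (Hs2 : s <= x) by (unfold s; eapply Rle_trans; [apply Rmin_l|apply Rmin_r]).
    assert (Hs3 : L ^ (1 + m) * s <= (2 * M) ^ (1 + m) / S ^ m).
    { apply Rle_trans with (L ^ (1 + m) * (((2 * M) ^ (1 + m) / S ^ m) / L ^ (1 + m))).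
      - apply Rmult_le_compat_l; [lra|apply Rmin_r].
      - right. field. split; [apply pow_nonzero; lra|lra]. }
    assert (Hg : Cmod ((f z - f c) ^ (1 + m))%C <= x ^ m * Rmax ((L * s) ^ (1 + m) / s ^ m) ((2 * M) ^ (1 + m) / S ^ m)).
    { apply (annulus_bound c s S (fun z => (f z - f c) ^ (1 + m))%C m); try lra.
      - apply pow_le; nra.
      - apply pow_le; lra.
      - apply (hol2_pow _ (fun z => f z - f c)%C), hol2_sub_const.
        eapply hol2_subset; [|exact Hf]. simpl; intros; lra.
      - intros w Hw. rewrite Cmod_pow. apply pow_incr. split; [apply Cmod_ge_0|].
        rewrite <- Hw. apply Hlip. lra.
      - intros w Hw. rewrite Cmod_pow. apply pow_incr. split; [apply Cmod_ge_0|].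
        eapply Rle_trans; [apply Cmod_sub_le|]. pose proof (HB w ltac:(lra)). pose proof (HB c Hc). lra.
      - unfold x in *; lra. }
    rewrite Cmod_pow in Hg. fold y in Hg. rewrite Rmax_right in Hg; auto.
    rewrite Rpow_mult_distr. replace (L ^ (1 + m) * s ^ (1 + m) / s ^ m) with (L ^ (1 + m) * s); auto.
    simpl. field. apply pow_nonzero; lra. }
  assert (Hr : 0 < 2 * M / S * x) by (repeat apply Rmult_lt_0_compat; try lra; now apply Rinv_0_lt_compat).
  set (q := y / (2 * M / S * x)).
  assert (Hy : 0 <= y) by apply Cmod_ge_0.
  assert (Hq : q <= 1).
  (* [Hpow] says that [q^(m + 1) <= S / x] for all [m]; the entry 1 serves the power 0. *)
  { apply le_1_of_bounded_powers with (Rmax 1 (S / x)). intros [|m].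
    - apply Rmax_l.
    - eapply Rle_trans; [|apply Rmax_r]. unfold q, Rdiv at 1. rewrite Rpow_mult_distr, pow_inv.
      apply Rmult_le_reg_r with ((2 * M / S * x) ^ Datatypes.S m); [now apply pow_lt|].
      rewrite Rmult_assoc, Rinv_l, Rmult_1_r by (apply pow_nonzero; lra).
      eapply Rle_trans; [apply Hpow|]. right.
      unfold Rdiv. rewrite !Rpow_mult_distr, !pow_inv. simpl. field.
      repeat split; try lra; apply pow_nonzero; lra. }
  replace y with (q * (2 * M / S * x)) by (unfold q; field; lra).
  rewrite <- (Rmult_1_l (2 * M / S * x)) at 2. apply Rmult_le_compat_r; lra.
Qed.

(** The difference quotients at [c] are bounded by [schwarz_bound]. The factor 2 stems from
    [|f z - f c| <= 2 M]. *)
Lemma cauchy_bound1 f c S M l : 0 < S -> 0 < M ->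
  hol2 (fun z => Cmod (z - c) <= S) f ->
  (forall z, Cmod (z - c) <= S -> Cmod (f z) <= M) ->
  Cdiff f c l -> Cmod l <= 2 * M / S.
Proof.
  intros HS HM Hf HB Hl. apply Rnot_lt_le. intro Hlt.
  set (e := (Cmod l - 2 * M / S) / 2).
  destruct (Hl e) as [d [Hd Hw]]; [unfold e; lra|].
  set (h := Rmin (d / 2) S).
  assert (Hh : 0 < h) by (unfold h; apply Rmin_pos; lra).
  assert (Hh1 : h <= d / 2) by apply Rmin_l. assert (Hh2 : h <= S) by apply Rmin_r.
  assert (E : Cmod (c + RtoC h - c) = h).
  { replace (c + RtoC h - c)%C with (RtoC h) by ring. rewrite Cmod_R. apply Rabs_right; lra. }
  specialize (Hw (c + RtoC h)%C). rewrite E in Hw. specialize (Hw ltac:(lra)).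
  pose proof (schwarz_bound f c S M HS HM Hf HB (c + RtoC h)%C ltac:(lra)) as Hs. rewrite E in Hs.
  assert (Hlh : Cmod l * h <= (e + 2 * M / S) * h).
  { rewrite <- E at 1. rewrite <- Cmod_mult.
    replace (l * (c + RtoC h - c))%C with ((f (c + RtoC h) - f c) - (f (c + RtoC h) - f c - l * (c + RtoC h - c)))%C by ring.
    eapply Rle_trans; [apply Cmod_sub_le|]. lra. }
  apply Rmult_le_reg_r in Hlh; auto. unfold e in Hlh. lra.
Qed.

(** Two applications of [cauchy_bound1] with radius [S / 2]: around each point of the half-size disc
    for [f], giving [|f1| <= 4 M / S], then around [c] for [f1]. *)
Lemma cauchy_bound2 f f1 f2 c S M : 0 < S -> 0 < M ->
  hol2 (fun z => Cmod (z - c) <= S) f -> hol2 (fun z => Cmod (z - c) <= S) f1 ->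
  (forall z, Cmod (z - c) <= S -> Cdiff f z (f1 z)) -> Cdiff f1 c f2 ->
  (forall z, Cmod (z - c) <= S -> Cmod (f z) <= M) ->
  Cmod f2 <= 16 * M / (S * S).
Proof.
  intros HS HM Hf Hf1 Hd Hd1 HB.
  assert (HB1 : forall z, Cmod (z - c) <= S / 2 -> Cmod (f1 z) <= 4 * M / S).
  { intros z Hz. replace (4 * M / S) with (2 * M / (S / 2)) by (field; lra).
    assert (Hin : forall w, Cmod (w - z) <= S / 2 -> Cmod (w - c) <= S).
    { intros w Hw. pose proof (Cmod_sub_triangle w z c). lra. }
    apply (cauchy_bound1 f z (S / 2) M); try lra.
    - eapply hol2_subset; [|exact Hf]. auto.
    - auto.
    - apply Hd. lra. }
  replace (16 * M / (S * S)) with (2 * (4 * M / S) / (S / 2)) by (field; lra).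
  apply (cauchy_bound1 f1 c); try lra.
  - apply Rdiv_lt_0_compat; lra.
  - eapply hol2_subset; [|exact Hf1]. simpl; intros; lra.
  - auto.
  - auto.
Qed.

(** * Power series *)

Notation Cseries := (@is_series C_AbsRing C_NormedModule).
Notation Cpseries := (@is_pseries C_AbsRing C_NormedModule).

Lemma Cseries_eps (x : nat -> C) (l : C) :
  Cseries x l <-> forall eps, 0 < eps -> exists N, forall n, (N <= n)%nat ->
    Cmod (@sum_n C_AbelianMonoid x n - l) < eps.
Proof.
  unfold is_series. split.
  - intros H eps He.
    pose proof (proj1 (@filterlim_locally_ball_norm C_AbsRing nat C_NormedModule eventually _ _ _) H) as H'.
    destruct (H' (mkposreal eps He)) as [N HN]. exists N. intros n Hn. exact (HN n Hn).
  - intros H. apply (@filterlim_locally_ball_norm C_AbsRing nat C_NormedModule eventually _).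
    intros eps. destruct (H eps (cond_pos eps)) as [N HN]. exists N. intros n Hn. exact (HN n Hn).
Qed.

Lemma sum_n_C_S (x : nat -> C) n : @sum_n C_AbelianMonoid x (S n) = (@sum_n C_AbelianMonoid x n + x (S n))%C.
Proof. apply (sum_Sn (G := C_AbelianMonoid)). Qed.

Lemma Cmod_sum_le (x : nat -> C) (c : nat -> R) n : (forall k, Cmod (x k) <= c k) ->
  Cmod (@sum_n C_AbelianMonoid x n) <= sum_f_R0 c n.
Proof.
  intros H. induction n as [|n IH].
  - rewrite sum_O. apply H.
  - rewrite sum_n_C_S. simpl. eapply Rle_trans; [apply Cmod_triangle|]. specialize (H (S n)). lra.
Qed.

Lemma Cseries_bound x l c K : Cseries x l -> (forall k, Cmod (x k) <= c k) ->
  (forall n, sum_f_R0 c n <= K) -> Cmod l <= K.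
Proof.
  intros Hs Hx Hc. apply Rnot_lt_le. intro Hlt.
  destruct (proj1 (Cseries_eps x l) Hs (Cmod l - K)) as [N HN]; [lra|].
  specialize (HN N (le_n N)). rewrite Cmod_sub_sym in HN.
  pose proof (Cmod_triangle_rev l (@sum_n C_AbelianMonoid x N)).
  pose proof (Cmod_sum_le x c N Hx). specialize (Hc N). lra.
Qed.

Lemma Cseries_terms_bounded x l : Cseries x l -> exists M, 0 < M /\ forall n, Cmod (x n) <= M.
Proof.
  intros Hs. destruct (proj1 (Cseries_eps x l) Hs 1) as [N HN]; [lra|].
  assert (HT : forall n, (N <= n)%nat -> Cmod (x (S n)) <= 2).
  { intros n Hn. pose proof (HN n Hn) as H1. pose proof (HN (S n) ltac:(lia)) as H2.
    replace (x (S n)) with ((@sum_n C_AbelianMonoid x (S n) - l) - (@sum_n C_AbelianMonoid x n - l))%C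
      by (rewrite sum_n_C_S; ring).
    eapply Rle_trans; [apply Cmod_sub_le|]. lra. }
  assert (HF : forall m, exists M, 0 < M /\ forall n, (n < m)%nat -> Cmod (x n) <= M).
  { induction m as [|m [M [HM IH]]].
    - exists 1. split; [lra|]. intros; lia.
    - exists (M + Cmod (x m)). pose proof (Cmod_ge_0 (x m)). split; [lra|]. intros n Hn.
      destruct (Nat.eq_dec n m) as [->|]; [lra|]. specialize (IH n ltac:(lia)). lra. }
  destruct (HF (S N)) as [M [HM HF1]]. exists (M + 2). split; [lra|]. intros n.
  destruct (Compare_dec.le_lt_dec (S N) n) as [Hle|Hlt].
  - destruct n as [|n]; [lia|]. specialize (HT n ltac:(lia)). lra.
  - specialize (HF1 n Hlt). lra.
Qed.

Lemma pow_n_Cpow (z : C) k : @pow_n C_AbsRing z k = (z ^ k)%C.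
Proof. induction k as [|k IH]; [reflexivity|]. simpl. rewrite IH. reflexivity. Qed.

Lemma Cpseries_Cseries a z l : Cpseries a z l <-> Cseries (fun k => (a k * z ^ k)%C) l.
Proof.
  assert (E : forall k, @scal C_AbsRing C_NormedModule (@pow_n C_AbsRing z k) (a k) = (a k * z ^ k)%C).
  { intros k. rewrite pow_n_Cpow. apply Cmult_comm. }
  unfold is_pseries. split; apply is_series_ext; auto.
Qed.

(** Bernoulli's inequality for [(1 + d)^n] with [1 + d = / s]. *)
Lemma linear_times_geometric_bounded s : 0 < s < 1 ->
  exists K, 0 < K /\ forall n, INR (S n) * s ^ n <= K.
Proof.
  intros Hs. set (d := / s - 1).
  assert (Hd : 0 < d).
  { unfold d. assert (1 < / s) by (rewrite <- Rinv_1; apply Rinv_lt_contravar; lra). lra. }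
  assert (Hi : 0 < / d) by now apply Rinv_0_lt_compat.
  exists (1 + / d). split; [lra|]. intros n.
  pose proof (poly n d Hd) as P. replace (1 + d) with (/ s) in P by (unfold d; ring).
  rewrite pow_inv in P. assert (Hsn : 0 < s ^ n) by (apply pow_lt; lra).
  apply (Rmult_le_compat_r (s ^ n)) in P; [|lra]. rewrite Rinv_l in P by lra.
  rewrite S_INR. pose proof (pos_INR n).
  apply Rle_trans with ((1 + / d) * ((1 + INR n * d) * s ^ n)).
  - rewrite <- Rmult_assoc. apply Rmult_le_compat_r; [lra|].
    replace ((1 + / d) * (1 + INR n * d)) with (1 + / d + INR n * d + INR n) by (field; lra).
    assert (0 <= INR n * d) by (apply Rmult_le_pos; lra). lra.
  - rewrite <- (Rmult_1_r (1 + / d)) at 2. apply Rmult_le_compat_l; lra.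
Qed.

Lemma geometric_sum_le s n : 0 < s < 1 -> sum_f_R0 (fun k => s ^ k) n <= / (1 - s).
Proof.
  intros Hs. rewrite tech3 by lra. unfold Rdiv.
  rewrite <- (Rmult_1_l (/ (1 - s))) at 2. apply Rmult_le_compat_r.
  - apply Rlt_le, Rinv_0_lt_compat; lra.
  - assert (0 < s ^ S n) by (apply pow_lt; lra). lra.
Qed.

(** With [X_n] the remainder and [N = n + 1], the recursion is [X_(n+1) = (u + h) X_n + N h^2 u^n],
    and [N^2 + N <= (N + 1)^2]. The factor [rho * rho] on the left avoids the exponent [n - 1] on
    the right. *)
Lemma binomial_remainder_bound (u h : C) rho n : 0 < rho -> Cmod u + Cmod h <= rho ->
  Cmod ((u + h) ^ S n - u ^ S n - RtoC (INR (S n)) * h * u ^ n)%C * (rho * rho)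
    <= Cmod h * Cmod h * (INR (S n) * INR (S n) * rho ^ S n).
Proof.
  intros Hr Huh. pose proof (Cmod_ge_0 u). pose proof (Cmod_ge_0 h).
  assert (Hh2 : 0 <= Cmod h * Cmod h) by nra.
  induction n as [|n IH].
  - replace ((u + h) ^ 1 - u ^ 1 - RtoC (INR 1) * h * u ^ 0)%C with (RtoC 0) by (simpl; ring).
    rewrite Cmod_0, Rmult_0_l. apply Rmult_le_pos; auto. simpl. nra.
  - set (X := ((u + h) ^ S n - u ^ S n - RtoC (INR (S n)) * h * u ^ n)%C) in *.
    replace ((u + h) ^ S (S n) - u ^ S (S n) - RtoC (INR (S (S n))) * h * u ^ S n)%C
      with ((u + h) * X + RtoC (INR (S n)) * (h * h) * u ^ n)%C
      by (unfold X; rewrite (S_INR (S n)), RtoC_plus; simpl; ring).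
    assert (Hn : 0 <= INR (S n)) by apply pos_INR.
    assert (H1 : Cmod ((u + h) * X) <= rho * Cmod X).
    { rewrite Cmod_mult. apply Rmult_le_compat_r; [apply Cmod_ge_0|].
      eapply Rle_trans; [apply Cmod_triangle|auto]. }
    assert (H2 : Cmod (RtoC (INR (S n)) * (h * h) * u ^ n)%C <= INR (S n) * (Cmod h * Cmod h) * rho ^ n).
    { rewrite !Cmod_mult, Cmod_R, Cmod_pow, Rabs_right by lra.
      apply Rmult_le_compat_l; [nra|]. apply pow_incr. lra. }
    pose proof (Cmod_triangle ((u + h) * X) (RtoC (INR (S n)) * (h * h) * u ^ n)) as HT.
    assert (Hrr : 0 <= rho * rho) by nra.
    apply Rle_trans with ((rho * Cmod X + INR (S n) * (Cmod h * Cmod h) * rho ^ n) * (rho * rho)).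
    { apply Rmult_le_compat_r; lra. }
    rewrite Rmult_plus_distr_r, (Rmult_assoc rho).
    apply Rle_trans with (rho * (Cmod h * Cmod h * (INR (S n) * INR (S n) * rho ^ S n))
                           + INR (S n) * (Cmod h * Cmod h) * rho ^ n * (rho * rho)).
    { apply Rplus_le_compat_r. apply Rmult_le_compat_l; lra. }
    rewrite (S_INR (S n)). set (N := INR (S n)) in *.
    replace (rho * (Cmod h * Cmod h * (N * N * rho ^ S n)) + N * (Cmod h * Cmod h) * rho ^ n * (rho * rho))
      with (Cmod h * Cmod h * ((N * N + N) * rho ^ S (S n))) by (simpl; ring).
    apply Rmult_le_compat_l; auto. apply Rmult_le_compat_r; [apply pow_le; lra|]. nra.
Qed.

Definition shift_derive (a : nat -> C) (n : nat) : C := (RtoC (INR (S n)) * a (S n))%C.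

(** The remainder [f (u + h) - f u - l * h] is summed term by term and is at most [Q |h|^2]. This
    requires a geometric majorant of [(n + 1)^2 |a n| rho^n] for some [rho > |u|]. Since [|a n| t^n]
    is bounded, [rho = s^3 t] serves: two of the factors [s^n] absorb [(n + 1)^2], the third is the
    majorant. *)
Lemma pseries_derivative (r : R) (a : nat -> C) (f : C -> C) :
  (forall z, Cmod z < r -> Cpseries a z (f z)) ->
  exists g : C -> C, forall z, Cmod z < r -> Cpseries (shift_derive a) z (g z) /\ Cdiff f z (g z).
Proof.
  intros Hf.
  assert (HH : forall u : C, exists l, Cmod u < r -> Cpseries (shift_derive a) u l /\ Cdiff f u l).
  2:{ apply functional_choice in HH. destruct HH as [g Hg]. exists g. auto. }
  intros u. destruct (Rlt_dec (Cmod u) r) as [Hu|]; [|exists (RtoC 0); lra].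
  pose proof (Cmod_ge_0 u) as Hu0.
  set (t := (Cmod u + r) / 2). assert (Ht : Cmod u < t < r) by (unfold t; lra).
  set (q := Cmod u / t).
  assert (Hq : 0 <= q < 1).
  { unfold q. split; [apply Rdiv_le_0_compat; lra|].
    apply Rmult_lt_reg_r with t; [lra|]. unfold Rdiv. rewrite Rmult_assoc, Rinv_l; lra. }
  (* With [e = (1 - q) / 4] one has [s^3 >= 1 - 3 e > 1 - 4 e = q], hence [rho > |u|]. *)
  set (s := 1 - (1 - q) / 4). assert (Hs : 0 < s < 1) by (unfold s; lra).
  assert (Hqs : q < s * s * s).
  { unfold s. set (e := (1 - q) / 4). assert (0 < e <= 1 / 4) by (unfold e; lra).
    replace q with (1 - 4 * e) by (unfold e; field). nra. }
  set (rho := s * s * s * t).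
  assert (Hrho : Cmod u < rho).
  { unfold rho. replace (Cmod u) with (q * t) by (unfold q; field; lra). apply Rmult_lt_compat_r; lra. }
  assert (Hrp : 0 < rho) by lra.
  destruct (Cseries_terms_bounded _ _ (proj1 (Cpseries_Cseries a (RtoC t) (f (RtoC t))) (Hf (RtoC t) ltac:(rewrite Cmod_R, Rabs_right; lra))))
    as [M [HM HMt]].
  destruct (linear_times_geometric_bounded s Hs) as [K [HK HKs]].
  set (W := M * (K * K)).
  assert (HW : 0 < W) by (unfold W; repeat apply Rmult_lt_0_compat; auto).
  assert (Hterm : forall n, Cmod (a n) * (INR (S n) * INR (S n) * rho ^ n) <= W * s ^ n).
  { intros n. specialize (HMt n). specialize (HKs n).
    rewrite Cmod_mult, Cmod_pow, Cmod_R, Rabs_right in HMt by lra.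
    assert (Hsn : 0 < s ^ n) by (apply pow_lt; lra). pose proof (pos_INR (S n)).
    unfold rho. rewrite !Rpow_mult_distr.
    replace (Cmod (a n) * (INR (S n) * INR (S n) * (s ^ n * s ^ n * s ^ n * t ^ n)))
      with ((Cmod (a n) * t ^ n) * ((INR (S n) * s ^ n) * (INR (S n) * s ^ n)) * s ^ n) by ring.
    apply Rmult_le_compat_r; [lra|]. unfold W.
    assert (0 <= INR (S n) * s ^ n) by (apply Rmult_le_pos; lra).
    apply Rmult_le_compat; [apply Rmult_le_pos; [apply Cmod_ge_0|apply pow_le; lra]|nra|exact HMt|apply Rmult_le_compat; lra]. }
  assert (Hterm1 : forall n, Cmod (a (S n)) * (INR (S n) * INR (S n) * rho ^ S n) <= W * s ^ n).
  { intros n. eapply Rle_trans; [|eapply Rle_trans; [apply (Hterm (S n))|]].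
    - apply Rmult_le_compat_l; [apply Cmod_ge_0|]. apply Rmult_le_compat_r; [apply pow_le; lra|].
      pose proof (pos_INR (S n)). rewrite (S_INR (S n)). nra.
    - simpl. assert (0 < s ^ n) by (apply pow_lt; lra). apply Rmult_le_compat_l; nra. }
  assert (Hconv : exists l, Cpseries (shift_derive a) u l).
  { destruct (@ex_series_le C_AbsRing C_CompleteNormedModule
      (fun k => (shift_derive a k * u ^ k)%C) (fun k => W / rho * s ^ k)) as [l Hl].
    - intros n. change (Cmod (shift_derive a n * u ^ n)%C <= W / rho * s ^ n).
      unfold shift_derive. rewrite !Cmod_mult, Cmod_pow, Cmod_R. pose proof (pos_INR (S n)).
      rewrite Rabs_right by lra.
      apply Rmult_le_reg_r with rho; auto.
      replace (W / rho * s ^ n * rho) with (W * s ^ n) by (field; lra).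
      eapply Rle_trans; [|apply Hterm1].
      assert (Hpu : Cmod u ^ n <= rho ^ n) by (apply pow_incr; lra).
      assert (1 <= INR (S n)) by (rewrite S_INR; pose proof (pos_INR n); lra).
      pose proof (Cmod_ge_0 (a (S n))). assert (0 <= Cmod u ^ n) by (apply pow_le; lra).
      replace (INR (S n) * Cmod (a (S n)) * Cmod u ^ n * rho) with (Cmod (a (S n)) * (INR (S n) * 1 * (Cmod u ^ n * rho))) by ring.
      apply Rmult_le_compat_l; auto. simpl (rho ^ S n). rewrite (Rmult_comm rho).
      apply Rmult_le_compat; try nra.
    - apply (@ex_series_scal R_AbsRing R_NormedModule (W / rho) (fun k => s ^ k)). exists (/ (1 - s)).
      apply is_series_geom. rewrite Rabs_right; lra.
    - exists l. apply Cpseries_Cseries. exact Hl. }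
  destruct Hconv as [l Hl]. exists l. intros _. split; auto.
  set (Q := W / (rho * rho) * / (1 - s)).
  assert (HQ : 0 < Q).
  { unfold Q. apply Rmult_lt_0_compat; [apply Rdiv_lt_0_compat; nra|apply Rinv_0_lt_compat; lra]. }
  assert (Hquad : forall w, Cmod (w - u) <= rho - Cmod u ->
     Cmod (f w - f u - l * (w - u)) <= Q * (Cmod (w - u) * Cmod (w - u))).
  { intros w Hw. set (h := (w - u)%C) in *. replace w with (u + h)%C by (unfold h; ring).
    assert (Huh : Cmod (u + h) < r).
    { eapply Rle_lt_trans; [apply Cmod_triangle|]. apply Rle_lt_trans with rho; [lra|].
      unfold rho. assert (s * s * s < 1) by nra. nra. }
    pose proof (proj1 (Cpseries_Cseries _ _ _) (Hf (u + h)%C Huh)) as S1.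
    pose proof (proj1 (Cpseries_Cseries _ _ _) (Hf u Hu)) as S2.
    pose proof (proj1 (Cpseries_Cseries _ _ _) Hl) as S3.
    pose proof (@is_series_minus C_AbsRing C_NormedModule _ _ _ _ S1 S2) as S4.
    apply (@is_series_scal C_AbsRing C_NormedModule h) in S3.
    (* The derived series is shifted by one index, with 0 in front, so that its terms align with
       those of [f]. *)
    assert (S5 : Cseries (fun k => match k with O => RtoC 0 | S n => (h * (shift_derive a n * u ^ n))%C end) (h * l)%C).
    { apply (@is_series_decr_1 C_AbsRing C_NormedModule).
      refine (eq_rect _ (fun y => Cseries (fun k => (h * (shift_derive a k * u ^ k))%C) y) S3 _ _).
      change ((h * l)%C = (h * l + - RtoC 0)%C). ring. }
    pose proof (@is_series_minus C_AbsRing C_NormedModule _ _ _ _ S4 S5) as S6.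
    replace (f (u + h) - f u - l * h)%C with ((f (u + h) + - f u) + - (h * l))%C by ring.
    assert (Hh2 : 0 <= Cmod h * Cmod h) by (pose proof (Cmod_ge_0 h); nra).
    assert (HC : 0 <= W / (rho * rho) * (Cmod h * Cmod h)).
    { apply Rmult_le_pos; auto. apply Rdiv_le_0_compat; nra. }
    apply (Cseries_bound _ _ (fun k => match k with O => 0 | S n => W / (rho * rho) * (Cmod h * Cmod h) * s ^ n end) _ S6).
    - intros [|n].
      + change (Cmod ((a O * (u + h) ^ 0 + - (a O * u ^ 0)) + - RtoC 0)%C <= 0).
        replace ((a O * (u + h) ^ 0 + - (a O * u ^ 0)) + - RtoC 0)%C with (RtoC 0) by (simpl; ring).
        rewrite Cmod_0. lra.
      + change (Cmod ((a (S n) * (u + h) ^ (S n) + - (a (S n) * u ^ (S n))) + - (h * (shift_derive a n * u ^ n)))%C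
           <= W / (rho * rho) * (Cmod h * Cmod h) * s ^ n).
        replace ((a (S n) * (u + h) ^ (S n) + - (a (S n) * u ^ (S n))) + - (h * (shift_derive a n * u ^ n)))%C
          with (a (S n) * ((u + h) ^ S n - u ^ S n - RtoC (INR (S n)) * h * u ^ n))%C
          by (unfold shift_derive; ring).
        rewrite Cmod_mult.
        pose proof (binomial_remainder_bound u h rho n Hrp ltac:(lra)) as HB.
        apply Rmult_le_reg_r with (rho * rho); [nra|].
        rewrite Rmult_assoc.
        eapply Rle_trans; [apply Rmult_le_compat_l; [apply Cmod_ge_0|exact HB]|].
        replace (W / (rho * rho) * (Cmod h * Cmod h) * s ^ n * (rho * rho)) with (Cmod h * Cmod h * (W * s ^ n)) by (field; lra).
        rewrite <- Rmult_assoc, (Rmult_comm (Cmod (a (S n)))), Rmult_assoc.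
        apply Rmult_le_compat_l; auto.
    - intros n. destruct n as [|n].
      + simpl. apply Rmult_le_pos; lra.
      + rewrite decomp_sum by lia. simpl (pred (S n)). rewrite Rplus_0_l.
        replace (sum_f_R0 (fun i => W / (rho * rho) * (Cmod h * Cmod h) * s ^ i) n)
          with (W / (rho * rho) * (Cmod h * Cmod h) * sum_f_R0 (fun i => s ^ i) n) by (rewrite scal_sum; apply sum_eq; intros; ring).
        replace (Q * (Cmod h * Cmod h)) with (W / (rho * rho) * (Cmod h * Cmod h) * / (1 - s)) by (unfold Q; ring).
        apply Rmult_le_compat_l; auto. now apply geometric_sum_le. }
  intros eps He. exists (Rmin (rho - Cmod u) (eps / Q)). split.
  { apply Rmin_pos; [lra|now apply Rdiv_lt_0_compat]. }
  intros w Hw. pose proof (Rmin_l (rho - Cmod u) (eps / Q)). pose proof (Rmin_r (rho - Cmod u) (eps / Q)).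
  eapply Rle_trans; [apply Hquad; lra|]. rewrite <- Rmult_assoc.
  apply Rmult_le_compat_r; [apply Cmod_ge_0|].
  apply Rle_trans with (Q * (eps / Q)); [apply Rmult_le_compat_l; lra|right; field; lra].
Qed.

Definition Copen (D : C -> Prop) : Prop :=
  forall z, D z -> exists d, 0 < d /\ forall w, Cmod (w - z) < d -> D w.

(** Each local power series is differentiated separately. The values of [f1] are chosen pointwise,
    and uniqueness of the derivative identifies [f1] with every local sum, which makes it
    analytic. *)
Lemma analytic_derivative (D : C -> Prop) (f : C -> C) : Copen D -> analytic_on D f ->
  exists f1, analytic_on D f1 /\ forall z, D z -> Cdiff f z (f1 z).
Proof.
  intros HD Hf.
  assert (Hloc : forall z0, D z0 -> exists d a g, 0 < d /\ forall z, Cmod (z - z0) < d ->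
     D z /\ Cpseries a (z - z0)%C (g z) /\ Cdiff f z (g z)).
  { intros z0 Hz0. destruct (Hf z0 Hz0) as [r [a Ha]]. destruct (HD z0 Hz0) as [d [Hd HdD]].
    destruct (pseries_derivative r a (fun z => f (z + z0)%C)) as [g Hg].
    { intros z Hz. specialize (Ha (z + z0)%C). replace (z + z0 - z0)%C with z in Ha by ring. auto. }
    exists (Rmin d r), (shift_derive a), (fun z => g (z - z0)%C).
    split; [apply Rmin_pos; auto; apply cond_pos|]. intros z Hz.
    pose proof (Rmin_l d r). pose proof (Rmin_r d r).
    destruct (Hg (z - z0)%C ltac:(lra)) as [H1 H2]. split; [apply HdD; lra|]. split; auto.
    replace (g (z - z0)%C) with (1 * g (z - z0))%C by ring.
    apply (Cdiff_ext (fun w => f (1 * w + - z0 + z0)%C)).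
    { exists 1. split; [lra|]. intros w _. f_equal. ring. }
    apply (Cdiff_comp_affine (fun w => f (w + z0)%C)). replace (1 * z + - z0)%C with (z - z0)%C by ring. auto. }
  assert (Hch : forall z, exists l, D z -> Cdiff f z l).
  { intros z. destruct (classic (D z)) as [Hz|]; [|exists (RtoC 0); tauto].
    destruct (Hloc z Hz) as [d [a [g [Hd H]]]]. exists (g z). intros _. apply H. rewrite Cmod_sub_0. auto. }
  apply functional_choice in Hch. destruct Hch as [f1 Hf1]. exists f1. split; auto.
  intros z0 Hz0. destruct (Hloc z0 Hz0) as [d [a [g [Hd H]]]].
  exists (mkposreal d Hd), a. intros z Hz. destruct (H z Hz) as [HDz [Hs Hdz]].
  rewrite (Cdiff_unique f z (f1 z) (g z)); auto.
Qed.

Lemma analytic_ext D f g : Copen D -> (forall z, D z -> f z = g z) -> analytic_on D f -> analytic_on D g.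
Proof.
  intros HD E Hf z0 Hz0. destruct (Hf z0 Hz0) as [r [a Ha]]. destruct (HD z0 Hz0) as [d [Hd HdD]].
  assert (Hm : 0 < Rmin d r) by (apply Rmin_pos; auto; apply cond_pos).
  exists (mkposreal _ Hm), a. simpl. intros z Hz. pose proof (Rmin_l d r). pose proof (Rmin_r d r).
  rewrite <- E by (apply HdD; lra). apply Ha. lra.
Qed.

Lemma analytic_hol2 D f : Copen D -> analytic_on D f -> hol2 D f.
Proof.
  intros HD Hf. destruct (analytic_derivative D f HD Hf) as [f1 [Hf1 H1]].
  destruct (analytic_derivative D f1 HD Hf1) as [f2 [Hf2 H2]]. exists f1, f2. auto.
Qed.

(** Meant for the derivative that comes with a solution: on [D] it agrees with the analytic one, so
    it is itself twice differentiable, as [cauchy_bound2] demands. *)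
Lemma analytic_hol2_derivative D f f1 : Copen D -> analytic_on D f -> (forall z, D z -> Cdiff f z (f1 z)) ->
  hol2 D f1.
Proof.
  intros HD Hf H1. destruct (analytic_derivative D f HD Hf) as [g [Hg Hd]].
  apply analytic_hol2; auto. apply (analytic_ext D g); auto.
  intros z Hz. apply (Cdiff_unique f z); auto.
Qed.

Lemma Copen_punctured_disc rho : Copen (punctured_disc rho).
Proof.
  intros z [Hz0 Hz]. exists (Rmin (Cmod z) (rho - Cmod z)). split; [apply Rmin_pos; lra|].
  intros w Hw. pose proof (Rmin_l (Cmod z) (rho - Cmod z)). pose proof (Rmin_r (Cmod z) (rho - Cmod z)).
  pose proof (Cmod_triangle_rev z w). pose proof (Cmod_triangle_rev w z).
  rewrite (Cmod_sub_sym z w) in *. unfold punctured_disc. lra.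
Qed.

(** * The identity theorem in the punctured disc *)

Definition cis (t : R) : C := (cos t, sin t).

Lemma Cmod_cis t : Cmod (cis t) = 1.
Proof.
  unfold Cmod, cis; simpl. transitivity (sqrt 1); [f_equal|apply sqrt_1].
  pose proof (sin2_cos2 t) as H. unfold Rsqr in H. lra.
Qed.

Lemma cis_plus x y : cis (x + y) = (cis x * cis y)%C.
Proof. unfold cis, Cmult; simpl. rewrite cos_plus, sin_plus. f_equal; ring. Qed.

Lemma cis_2PI x : cis (x + 2 * PI) = cis x.
Proof. unfold cis. f_equal; [rewrite cos_plus|rewrite sin_plus]; rewrite cos_2PI, sin_2PI; ring. Qed.

Lemma cis_pow t k : (cis t ^ k)%C = cis (INR k * t).
Proof.
  induction k as [|k IH].
  - simpl. rewrite Rmult_0_l. unfold cis. rewrite cos_0, sin_0. reflexivity.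
  - rewrite Cpow_S, IH, <- cis_plus. f_equal. rewrite S_INR. ring.
Qed.

Lemma abs_sin_le x : Rabs (sin x) <= Rabs x.
Proof.
  assert (Hpos : forall y, 0 <= y -> Rabs (sin y) <= y).
  { intros y Hy. pose proof (SIN_bound y). destruct (Rle_dec 1 y).
    - apply Rabs_le. lra.
    - destruct (Req_dec y 0) as [->|]; [rewrite sin_0, Rabs_R0; lra|].
      pose proof PI2_1. rewrite Rabs_right.
      + apply Rlt_le, sin_lt_x. lra.
      + apply Rle_ge, sin_ge_0; [auto|]. lra. }
  destruct (Rle_dec 0 x).
  - rewrite (Rabs_right x) by lra. auto.
  - rewrite (Rabs_left x), <- Rabs_Ropp, <- sin_neg by lra. apply Hpos. lra.
Qed.

Lemma cis_lipschitz x y : Cmod (cis x - cis y) <= Rabs (x - y).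
Proof.
  apply Rsqr_incr_0; [|apply Cmod_ge_0|apply Rabs_pos].
  unfold Rsqr. rewrite Cmod_sqr.
  assert (E : Re (cis x - cis y) * Re (cis x - cis y) + Im (cis x - cis y) * Im (cis x - cis y)
    = 2 * sin ((x - y) / 2) * (2 * sin ((x - y) / 2))).
  { unfold Re, Im, cis; simpl.
    pose proof (sin2_cos2 x) as Hx. pose proof (sin2_cos2 y) as Hy. unfold Rsqr in *.
    assert (Hc : cos (x - y) = 1 - 2 * sin ((x - y) / 2) * sin ((x - y) / 2)).
    { replace (x - y) with (2 * ((x - y) / 2)) at 1 by field. apply cos_2a_sin. }
    rewrite cos_minus in Hc. nra. }
  rewrite E. pose proof (abs_sin_le ((x - y) / 2)) as Hs.
  assert (Hh : Rabs (2 * sin ((x - y) / 2)) <= Rabs (x - y)).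
  { rewrite Rabs_mult, (Rabs_right 2) by lra. unfold Rdiv in Hs.
    rewrite (Rabs_mult (x - y)), (Rabs_right (/ 2)) in Hs by lra. unfold Rdiv. lra. }
  rewrite <- (Rabs_right (2 * sin _ * _)) by (apply Rle_ge; nra).
  rewrite Rabs_mult. apply Rmult_le_compat; auto using Rabs_pos.
Qed.

Lemma polar z : z <> RtoC 0 -> z = (RtoC (Cmod z) * cis (Carg z))%C.
Proof.
  intros Hz. destruct (Carg_spec z Hz) as [_ E]. rewrite E at 1. f_equal.
  unfold Cexp, cis, Cmult, Ci, RtoC, Re, Im; simpl.
  replace (0 * Carg z - 1 * 0) with 0 by ring. replace (0 * 0 + 1 * Carg z) with (Carg z) by ring.
  rewrite exp_0. f_equal; ring.
Qed.

(** The curve [g] interpolates modulus and argument linearly and keeps distance at least [eta] from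
    0 and from the outer circle. It is cut into [m] steps shorter than [eta / 2], so the disc of
    radius [eta / 2] around each new point lies in the disc of radius [eta] around the previous one,
    on which [zero_on_disc] makes [f] vanish. *)
Lemma hol2_zero_propagates rho f z1 z2 s : hol2 (punctured_disc rho) f ->
  punctured_disc rho z1 -> punctured_disc rho z2 -> 0 < s ->
  (forall w, Cmod (w - z1) < s -> f w = RtoC 0) -> f z2 = RtoC 0.
Proof.
  intros Hf [H10 H1] [H20 H2] Hs H0.
  set (r1 := Cmod z1) in *. set (r2 := Cmod z2) in *.
  set (a1 := Carg z1). set (a2 := Carg z2).
  set (eta := Rmin (Rmin r1 r2) (Rmin (rho - r1) (rho - r2))).
  assert (Heta : 0 < eta) by (unfold eta; repeat apply Rmin_pos; lra).
  assert (E1 : eta <= r1) by (unfold eta; eapply Rle_trans; [apply Rmin_l|apply Rmin_l]).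
  assert (E2 : eta <= r2) by (unfold eta; eapply Rle_trans; [apply Rmin_l|apply Rmin_r]).
  assert (E3 : eta <= rho - r1) by (unfold eta; eapply Rle_trans; [apply Rmin_r|apply Rmin_l]).
  assert (E4 : eta <= rho - r2) by (unfold eta; eapply Rle_trans; [apply Rmin_r|apply Rmin_r]).
  set (g := fun t => (RtoC (r1 + t * (r2 - r1)) * cis (a1 + t * (a2 - a1)))%C).
  assert (Hmod : forall t, 0 <= t <= 1 -> eta <= Cmod (g t) <= rho - eta).
  { intros t Ht. unfold g. rewrite Cmod_mult, Cmod_cis, Cmod_R, Rmult_1_r, Rabs_right; nra. }
  set (L := Rabs (r2 - r1) + rho * Rabs (a2 - a1) + 1).
  assert (HL : 1 <= L).
  { unfold L. pose proof (Rabs_pos (r2 - r1)). pose proof (Rabs_pos (a2 - a1)).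
    assert (0 <= rho * Rabs (a2 - a1)) by (apply Rmult_le_pos; lra). lra. }
  assert (Hlip : forall t u, 0 <= t <= 1 -> 0 <= u <= 1 -> Cmod (g u - g t) <= L * Rabs (u - t)).
  { intros t u Ht Hu. unfold g.
    replace (RtoC (r1 + u * (r2 - r1)) * cis (a1 + u * (a2 - a1)) - RtoC (r1 + t * (r2 - r1)) * cis (a1 + t * (a2 - a1)))%C
     with (RtoC ((u - t) * (r2 - r1)) * cis (a1 + u * (a2 - a1)) + RtoC (r1 + t * (r2 - r1)) * (cis (a1 + u * (a2 - a1)) - cis (a1 + t * (a2 - a1))))%C.
    2:{ replace ((u - t) * (r2 - r1)) with ((r1 + u * (r2 - r1)) - (r1 + t * (r2 - r1))) by ring. rewrite RtoC_minus. ring. }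
    eapply Rle_trans; [apply Cmod_triangle|]. rewrite !Cmod_mult, !Cmod_R, Cmod_cis, Rmult_1_r.
    pose proof (cis_lipschitz (a1 + u * (a2 - a1)) (a1 + t * (a2 - a1))) as HC.
    replace (a1 + u * (a2 - a1) - (a1 + t * (a2 - a1))) with ((u - t) * (a2 - a1)) in HC by ring.
    rewrite Rabs_mult in HC. rewrite Rabs_mult.
    assert (HR : Rabs (r1 + t * (r2 - r1)) <= rho) by (rewrite Rabs_right; nra).
    pose proof (Rabs_pos (u - t)). pose proof (Rabs_pos (a2 - a1)).
    assert (Rabs (r1 + t * (r2 - r1)) * Cmod (cis (a1 + u * (a2 - a1)) - cis (a1 + t * (a2 - a1))) <= rho * (Rabs (u - t) * Rabs (a2 - a1)))
      by (apply Rmult_le_compat; auto using Rabs_pos, Cmod_ge_0).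
    unfold L. nra. }
  destruct (INR_archimed 1 (2 * L / eta)) as [m Hm]; [lra|]. rewrite Rmult_1_r in Hm.
  assert (Hm0 : 0 < INR m) by (eapply Rle_lt_trans; [|exact Hm]; apply Rdiv_le_0_compat; lra).
  assert (Hstep : L * / INR m < eta / 2).
  { apply Rmult_lt_reg_r with (INR m); auto. rewrite Rmult_assoc, Rinv_l, Rmult_1_r by lra.
    apply (Rmult_lt_compat_r (eta / 2)) in Hm; [|lra].
    replace (2 * L / eta * (eta / 2)) with L in Hm by (field; lra). lra. }
  assert (Hind : forall j, (j <= m)%nat -> exists e, 0 < e /\ forall w, Cmod (w - g (INR j / INR m)) < e -> f w = RtoC 0).
  { induction j as [|j IH]; intros Hj.
    - exists s. split; auto. intros w Hw. apply H0.
      replace z1 with (g (INR 0 / INR m)); auto. unfold g.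
      replace (INR 0 / INR m) with 0 by (simpl; field; lra).
      rewrite !Rmult_0_l, !Rplus_0_r. symmetry. apply polar, Cmod_pos_neq0. auto.
    - destruct (IH ltac:(lia)) as [e [He Hz]]. exists (eta / 2). split; [lra|].
      apply le_INR in Hj. rewrite S_INR in Hj. pose proof (pos_INR j).
      assert (T1 : 0 <= INR j / INR m <= 1).
      { split; [apply Rdiv_le_0_compat; lra|]. apply Rmult_le_reg_r with (INR m); auto.
        unfold Rdiv. rewrite Rmult_assoc, Rinv_l; lra. }
      assert (T2 : 0 <= INR (S j) / INR m <= 1).
      { rewrite S_INR. split; [apply Rdiv_le_0_compat; lra|]. apply Rmult_le_reg_r with (INR m); auto.
        unfold Rdiv. rewrite Rmult_assoc, Rinv_l; lra. }
      assert (HT := Hlip _ _ T1 T2).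
      replace (INR (S j) / INR m - INR j / INR m) with (/ INR m) in HT by (rewrite S_INR; field; lra).
      rewrite (Rabs_right (/ INR m)) in HT by (apply Rle_ge, Rlt_le, Rinv_0_lt_compat; auto).
      intros w Hw. apply (zero_on_disc f (g (INR j / INR m)) e eta); auto.
      + eapply hol2_subset; [|exact Hf]. simpl. intros x Hx. specialize (Hmod _ T1).
        pose proof (Cmod_triangle_rev x (g (INR j / INR m))). pose proof (Cmod_triangle_rev (g (INR j / INR m)) x) as T.
        rewrite (Cmod_sub_sym _ x) in T. unfold punctured_disc. lra.
      + eapply Rle_lt_trans; [apply (Cmod_sub_triangle w (g (INR (S j) / INR m)))|]. lra. }
  destruct (Hind m (le_n m)) as [e [He Hz]]. apply Hz.
  replace (g (INR m / INR m)) with z2; [rewrite Cmod_sub_0; auto|]. unfold g.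
  replace (INR m / INR m) with 1 by (field; lra).
  replace (r1 + 1 * (r2 - r1)) with r2 by ring. replace (a1 + 1 * (a2 - a1)) with a2 by ring.
  apply polar, Cmod_pos_neq0. auto.
Qed.

(** By the identity theorem, [g] cannot vanish on the whole disc that is good for the rest of the
    list; continuity then gives a smaller good disc. A disc rather than a point is what makes the
    induction work. *)
Lemma common_nonzero rho (l : list (C -> C)) : 0 < rho ->
  (forall g, In g l -> hol2 (punctured_disc rho) g /\ not_identically_zero_on (punctured_disc rho) g) ->
  exists z s, 0 < s /\ forall w, Cmod (w - z) < s -> punctured_disc rho w /\ forall g, In g l -> g w <> RtoC 0.
Proof.
  intros Hrho. induction l as [|g l IH]; intros H.
  - exists (RtoC (rho / 2)).
    assert (Hz : punctured_disc rho (RtoC (rho / 2))) by (unfold punctured_disc; rewrite Cmod_R, Rabs_right; lra).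
    destruct (Copen_punctured_disc rho _ Hz) as [d [Hd HdD]]. exists d. split; [exact Hd|].
    intros w Hw. split; [auto|intros g []].
  - destruct IH as [z [s [Hs Hz]]]; [intros; apply H; now right|].
    destruct (H g (or_introl eq_refl)) as [Hg [z2 [Hz2 Hn]]].
    assert (Hex : exists w, Cmod (w - z) < s /\ g w <> RtoC 0).
    { apply NNPP. intro Hno. apply Hn.
      apply (hol2_zero_propagates rho g z z2 s); auto.
      - apply Hz. rewrite Cmod_sub_0. auto.
      - intros w Hw. apply NNPP. intro Hgw. apply Hno. now exists w. }
    destruct Hex as [w [Hw Hgw]].
    destruct (hol2_cont _ _ w Hg (proj1 (Hz w Hw)) (Cmod (g w))) as [d [Hd Hc]]; [now apply Cmod_gt_0|].
    exists w, (Rmin d (s - Cmod (w - z))). split; [apply Rmin_pos; lra|].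
    intros x Hx. pose proof (Rmin_l d (s - Cmod (w - z))). pose proof (Rmin_r d (s - Cmod (w - z))).
    destruct (Hz x) as [Hx1 Hx2].
    { eapply Rle_lt_trans; [apply (Cmod_sub_triangle x w)|]. lra. }
    split; auto. intros g' [<-|Hin]; auto.
    intro E. specialize (Hc x ltac:(lra)). rewrite E in Hc.
    replace (RtoC 0 - g w)%C with (- g w)%C in Hc by ring. rewrite Cmod_opp in Hc. lra.
Qed.

(** * Orders of growth *)

Lemma Rbar_glb_is_glb E : Rbar_is_glb E (Rbar_glb E).
Proof. destruct (Rbar_ex_glb E) as [l Hl]. now rewrite (Rbar_is_glb_unique _ _ Hl). Qed.

Lemma LimSup_lt_eventually g x : Rbar_lt (LimSup (at_right 0) g) (Finite x) ->
  exists y d, y < x /\ 0 < d /\ forall r, 0 < r < d -> g r <= y.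
Proof.
  unfold LimSup. set (E := fun L => _). intros H.
  destruct (Rbar_glb_is_glb E) as [_ Hg].
  assert (Hex : exists L, E L /\ Rbar_lt L (Finite x)).
  { apply NNPP. intro Hno. apply (Rbar_lt_not_le _ _ H). apply Hg.
    intros L HL. apply Rbar_not_lt_le. intro Hlt. apply Hno. now exists L. }
  destruct Hex as [L [[P [[d Hd] HL]] Hlt]].
  destruct (Lub_Rbar_correct (fun y => exists r, P r /\ y = g r)) as [Hub _]. rewrite <- HL in Hub.
  assert (Hr : forall r, 0 < r < d -> Rbar_le (g r) L).
  { intros r Hr. apply Hub. exists r. split; auto. apply Hd; [|lra].
    change (Rabs (r - 0) < d). rewrite Rabs_right; lra. }
  destruct L as [y| |]; simpl in Hlt.
  - exists y, d. repeat split; auto. apply cond_pos.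
  - contradiction.
  (* No real value lies below [-oo], so the estimate is vacuous and any [y < x] would do. *)
  - exists (x - 1), d. split; [lra|]. split; [apply cond_pos|]. intros r Hr'. destruct (Hr r Hr').
Qed.

Lemma LimSup_le_of_eventually g x d : 0 < d -> (forall r, 0 < r < d -> g r <= x) ->
  Rbar_le (LimSup (at_right 0) g) (Finite x).
Proof.
  intros Hd Hg. unfold LimSup. set (E := fun L => _).
  destruct (Rbar_glb_is_glb E) as [Hlb _].
  set (P := fun r => 0 < r < d).
  eapply Rbar_le_trans with (Lub_Rbar (fun y => exists r, P r /\ y = g r)).
  - apply Hlb. exists P. split; auto. exists (mkposreal d Hd). intros y Hy Hy0.
    change (Rabs (y - 0) < d) in Hy. rewrite Rabs_right in Hy by lra. unfold P. lra.
  - apply Lub_Rbar_correct. intros y [r [Hr ->]]. apply Hg. auto.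
Qed.

(** Continuity keeps the supremum over the circle finite; [real] would turn an infinite one into
    0. *)
Lemma Cmod_le_M0 rho f z : (forall z, punctured_disc rho z -> Ccont f z) -> punctured_disc rho z ->
  Cmod (f z) <= M0 (Cmod z) f.
Proof.
  intros Hc Hz. pose proof Hz as [Hz0 Hz1].
  destruct (bounded_on_compact (fun w => Cmod z <= Cmod (w - RtoC 0) <= Cmod z) f (Cmod (RtoC 0) + Cmod z)) as [M [HM HB]].
  - apply Cclosed_annulus.
  - intros w [_ Hw]. now apply Cmod_le_center.
  - intros w Hw. apply Hc. replace (w - RtoC 0)%C with w in Hw by ring. unfold punctured_disc. lra.
  - unfold M0. set (E := fun x => _). destruct (Lub_Rbar_correct E) as [Hub Hl].
    assert (H1 : Rbar_le (Cmod (f z)) (Lub_Rbar E)) by (apply Hub; exists z; auto).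
    assert (H2 : Rbar_le (Lub_Rbar E) M).
    { apply Hl. intros x [w [Hw ->]]. apply HB. replace (w - RtoC 0)%C with w by ring. lra. }
    destruct (Lub_Rbar E); simpl in *; try contradiction; auto.
Qed.

Lemma M0_le f r X : 0 <= X -> (forall z, Cmod z = r -> Cmod (f z) <= X) -> M0 r f <= X.
Proof.
  intros HX H. unfold M0. set (E := fun x => _). destruct (Lub_Rbar_correct E) as [_ Hl].
  assert (H2 : Rbar_le (Lub_Rbar E) X) by (apply Hl; intros x [w [Hw ->]]; simpl; auto).
  destruct (Lub_Rbar E); simpl in *; auto.
Qed.

(** * Passing between iterated logarithms and iterated exponentials *)

Lemma exp_le_compat x y : x <= y -> exp x <= exp y.
Proof. intros [H| ->]; [left; now apply exp_increasing | lra]. Qed.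

Lemma le_exp_of_log_plus_le x y : log_plus x <= y -> x <= exp y.
Proof.
  unfold log_plus. intros H. pose proof (Rmax_l (ln x) 0).
  destruct (Rlt_dec 0 x) as [Hx|Hx].
  - rewrite <- (exp_ln x) by auto. apply exp_le_compat. lra.
  - pose proof (exp_pos y). lra.
Qed.

Lemma log_plus_le_of_le_exp x y : 0 <= y -> x <= exp y -> log_plus x <= y.
Proof.
  intros Hy H. unfold log_plus. apply Rmax_lub; auto.
  destruct (Rlt_dec 0 x) as [Hx|Hx].
  - rewrite <- (ln_exp y). now apply ln_le.
  - unfold ln. destruct (Rlt_dec 0 x); [contradiction|auto].
Qed.

Lemma neg_ln_pos r : 0 < r < 1 -> 0 < - ln r.
Proof. intros H. pose proof (ln_increasing r 1). rewrite ln_1 in *. lra. Qed.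

(** Below radius 1 the denominator [- ln r] is positive and can be cleared; the two [log_plus] are
    then undone. The exponent [y] may be negative here. *)
Lemma order0_lt_bound rho f (n : R) : 0 < rho -> hol2 (punctured_disc rho) f -> Rbar_lt (order0 f) n ->
  exists y d, y < n /\ 0 < d /\ forall z, 0 < Cmod z < d ->
    Cmod (f z) <= exp (exp (y * - ln (Cmod z))).
Proof.
  intros Hrho Hf H. destruct (LimSup_lt_eventually _ _ H) as [y [d [Hy [Hd Hg]]]].
  exists y, (Rmin d (Rmin rho 1)). split; [auto|split; [repeat apply Rmin_pos; lra|]].
  intros z [Hz0 Hz].
  pose proof (Rmin_l d (Rmin rho 1)). pose proof (Rmin_r d (Rmin rho 1)).
  pose proof (Rmin_l rho 1). pose proof (Rmin_r rho 1).
  eapply Rle_trans; [apply (Cmod_le_M0 rho)|].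
  - intros w Hw. eapply hol2_cont; eauto.
  - unfold punctured_disc. lra.
  - specialize (Hg (Cmod z) ltac:(lra)). pose proof (neg_ln_pos (Cmod z) ltac:(lra)) as HL.
    do 2 apply le_exp_of_log_plus_le.
    apply (Rmult_le_compat_r (- ln (Cmod z))) in Hg; [|lra].
    unfold Rdiv in Hg. rewrite Rmult_assoc, Rinv_l, Rmult_1_r in Hg by lra. auto.
Qed.

Lemma hyper_order0_lt_bound rho f (n : R) : 0 < rho -> hol2 (punctured_disc rho) f -> Rbar_lt (hyper_order0 f) n ->
  exists y d, y < n /\ 0 < d /\ forall z, 0 < Cmod z < d ->
    Cmod (f z) <= exp (exp (exp (y * - ln (Cmod z)))).
Proof.
  intros Hrho Hf H. destruct (LimSup_lt_eventually _ _ H) as [y [d [Hy [Hd Hg]]]].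
  exists y, (Rmin d (Rmin rho 1)). split; [auto|split; [repeat apply Rmin_pos; lra|]].
  intros z [Hz0 Hz].
  pose proof (Rmin_l d (Rmin rho 1)). pose proof (Rmin_r d (Rmin rho 1)).
  pose proof (Rmin_l rho 1). pose proof (Rmin_r rho 1).
  eapply Rle_trans; [apply (Cmod_le_M0 rho)|].
  - intros w Hw. eapply hol2_cont; eauto.
  - unfold punctured_disc. lra.
  - specialize (Hg (Cmod z) ltac:(lra)). pose proof (neg_ln_pos (Cmod z) ltac:(lra)) as HL.
    do 3 apply le_exp_of_log_plus_le.
    apply (Rmult_le_compat_r (- ln (Cmod z))) in Hg; [|lra].
    unfold Rdiv in Hg. rewrite Rmult_assoc, Rinv_l, Rmult_1_r in Hg by lra. auto.
Qed.

Lemma hyper_order0_le f y d : 0 <= y -> 0 < d ->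
  (forall z, 0 < Cmod z < d -> Cmod (f z) <= exp (exp (exp (y * - ln (Cmod z))))) ->
  Rbar_le (hyper_order0 f) y.
Proof.
  intros Hy Hd H. apply (LimSup_le_of_eventually _ y (Rmin d 1)); [apply Rmin_pos; lra|].
  intros r [Hr0 Hr]. pose proof (Rmin_l d 1). pose proof (Rmin_r d 1).
  pose proof (neg_ln_pos r ltac:(lra)) as HL.
  apply Rmult_le_reg_r with (- ln r); auto. unfold Rdiv. rewrite Rmult_assoc, Rinv_l, Rmult_1_r by lra.
  apply log_plus_le_of_le_exp; [apply Rmult_le_pos; lra|].
  apply log_plus_le_of_le_exp; [apply Rlt_le, exp_pos|].
  apply log_plus_le_of_le_exp; [apply Rlt_le, exp_pos|].
  apply M0_le; [apply Rlt_le, exp_pos|]. intros z Hz. rewrite <- Hz. apply H. lra.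
Qed.

(* L stands for - ln r, so that exp (gamma * L) is r^-gamma. *)
Lemma exp_dominates alpha gamma K : alpha < gamma -> 0 < K ->
  exists L0, 0 < L0 /\ forall L, L0 <= L -> K * exp (alpha * L) <= exp (gamma * L).
Proof.
  intros H HK. assert (0 < K / (gamma - alpha)) by (apply Rdiv_lt_0_compat; lra).
  exists (K / (gamma - alpha)). split; auto. intros L HL.
  replace (gamma * L) with ((gamma - alpha) * L + alpha * L) by ring. rewrite exp_plus.
  apply Rmult_le_compat_r; [apply Rlt_le, exp_pos|].
  pose proof (exp_ineq1_le ((gamma - alpha) * L)).
  apply (Rmult_le_compat_l (gamma - alpha)) in HL; [|lra].
  replace ((gamma - alpha) * (K / (gamma - alpha))) with K in HL by (field; lra). lra.
Qed.

Lemma exp_dominates_linear gamma K : 0 < gamma -> 0 < K ->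
  exists L0, 0 < L0 /\ forall L, L0 <= L -> K * (1 + L) <= exp (gamma * L).
Proof.
  intros H HK.
  destruct (exp_dominates (gamma / 2) gamma (K * (1 + 2 / gamma))) as [L0 [HL0 HL]]; [lra| |].
  { assert (0 < 2 / gamma) by (apply Rdiv_lt_0_compat; lra). apply Rmult_lt_0_compat; lra. }
  exists L0. split; auto. intros L HLL. specialize (HL L HLL).
  eapply Rle_trans; [|exact HL]. rewrite Rmult_assoc. apply Rmult_le_compat_l; [lra|].
  pose proof (exp_ineq1_le (gamma / 2 * L)) as He.
  assert (0 < 2 / gamma) by (apply Rdiv_lt_0_compat; lra).
  apply Rle_trans with ((1 + 2 / gamma) * (1 + gamma / 2 * L)); [|apply Rmult_le_compat_l; lra].
  replace ((1 + 2 / gamma) * (1 + gamma / 2 * L)) with (1 + L + 2 / gamma + gamma / 2 * L) by (field; lra).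
  assert (0 <= gamma / 2 * L) by (apply Rmult_le_pos; lra). lra.
Qed.

(** * Upper bound *)

Lemma Cmod_Cexp z : Cmod (Cexp z) = exp (Re z).
Proof.
  replace (Cexp z) with (RtoC (exp (Re z)) * cis (Im z))%C.
  - rewrite Cmod_mult, Cmod_cis, Cmod_R, Rabs_right; [ring|]. apply Rle_ge, Rlt_le, exp_pos.
  - unfold Cexp, cis, RtoC, Cmult; simpl. f_equal; ring.
Qed.

Lemma Cmod_Cexp_le z : Cmod (Cexp z) <= exp (Cmod z).
Proof.
  rewrite Cmod_Cexp. apply exp_le_compat. pose proof (abs_Re_le_Cmod z) as H.
  apply Rabs_le_between in H. lra.
Qed.

Lemma exp_mult_INR k x : exp (INR k * x) = exp x ^ k.
Proof.
  induction k as [|k IH]; [simpl; rewrite Rmult_0_l; apply exp_0|].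
  rewrite S_INR, Rmult_plus_distr_r, Rmult_1_l, exp_plus, IH. simpl. ring.
Qed.

Lemma Cmod_div_pow a z n : 0 < Cmod z -> Cmod (a / z ^ n)%C = Cmod a * exp (INR n * - ln (Cmod z)).
Proof.
  intros Hz. assert (Hz0 : z <> RtoC 0) by now apply Cmod_pos_neq0.
  unfold Cdiv. rewrite Cmod_mult, Cmod_inv, Cmod_pow by now apply Cpow_nz.
  rewrite exp_mult_INR, exp_Ropp, exp_ln, pow_inv by auto. reflexivity.
Qed.

Lemma Re_Im_inner_le x y : Rabs (Re x * Re y + Im x * Im y) <= Cmod x * Cmod y.
Proof.
  assert (E : Re x * Re y + Im x * Im y = Re (x * Cconj y)%C) by (destruct x, y; unfold Re, Im; simpl; ring).
  rewrite E. eapply Rle_trans; [apply abs_Re_le_Cmod|]. rewrite Cmod_mult, Cmod_conj. lra.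
Qed.

(** Put [x = |f|], [y = |f1|] and [E = x^2 + y^2]. The equation gives [|f2| <= K (x + y)], hence [-
    E' <= 2 x y + 2 K y (x + y) <= (1 + 3 K) E]. So [E t * exp ((1 + 3 * K) * t)] does not decrease,
    and its values at [r] and [r0] compare. *)
Lemma gronwall_along_ray (f f1 f2 P Q : C -> C) u r r0 K :
  Cmod u = 1 -> 0 < r -> r <= r0 -> 0 <= K ->
  (forall t, r <= t <= r0 -> let z := (RtoC t * u)%C in
     Cdiff f z (f1 z) /\ Cdiff f1 z (f2 z) /\ (f2 z + P z * f1 z + Q z * f z)%C = RtoC 0 /\
     Cmod (P z) <= K /\ Cmod (Q z) <= K) ->
  sqmod (f (RtoC r * u)%C) + sqmod (f1 (RtoC r * u)%C) <=
    (sqmod (f (RtoC r0 * u)%C) + sqmod (f1 (RtoC r0 * u)%C)) * exp ((1 + 3 * K) * (r0 - r)).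
Proof.
  intros Hu Hr Hr0 HK H.
  set (E := fun t => sqmod (f (RtoC 0 + RtoC t * u)%C) + sqmod (f1 (RtoC 0 + RtoC t * u)%C)).
  assert (E0 : forall t, E t = sqmod (f (RtoC t * u)%C) + sqmod (f1 (RtoC t * u)%C)).
  { intros t. unfold E. replace (RtoC 0 + RtoC t * u)%C with (RtoC t * u)%C by ring. auto. }
  rewrite <- !E0.
  destruct Hr0 as [Hr0| <-]; [|rewrite Rminus_diag, Rmult_0_r, exp_0; lra].
  assert (Hder : forall t, r <= t <= r0 -> exists e', is_derive E t e' /\ - ((1 + 3 * K) * E t) <= e').
  { intros t Ht. destruct (H t Ht) as [H1 [H2 [Hode [HP HQ]]]].
    replace (RtoC t * u)%C with (RtoC 0 + RtoC t * u)%C in * by ring.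
    set (z := (RtoC 0 + RtoC t * u)%C) in *.
    eexists. split.
    - apply @is_derive_plus; apply is_derive_sqmod_line; [exact H1|exact H2].
    - unfold plus; cbn -[Re Im Cmult]. fold z. unfold E. fold z.
      pose proof (Re_Im_inner_le (f z) (f1 z * u)) as I1. pose proof (Re_Im_inner_le (f1 z) (f2 z * u)) as I2.
      rewrite Cmod_mult, Hu, Rmult_1_r in I1, I2.
      apply Rabs_le_between in I1. apply Rabs_le_between in I2.
      assert (Hf2 : Cmod (f2 z) <= K * Cmod (f1 z) + K * Cmod (f z)).
      { replace (f2 z) with ((f2 z + P z * f1 z + Q z * f z) - (P z * f1 z + Q z * f z))%C by ring.
        rewrite Hode. eapply Rle_trans; [apply Cmod_sub_le|]. rewrite Cmod_0, Rplus_0_l.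
        eapply Rle_trans; [apply Cmod_triangle|]. rewrite !Cmod_mult.
        apply Rplus_le_compat; apply Rmult_le_compat_r; auto using Cmod_ge_0. }
      unfold sqmod at 1 2. rewrite <- !Cmod_sqr.
      pose proof (Cmod_ge_0 (f z)). pose proof (Cmod_ge_0 (f1 z)).
      set (x := Cmod (f z)) in *. set (y := Cmod (f1 z)) in *.
      assert (y * Cmod (f2 z) <= y * (K * y + K * x)) by (apply Rmult_le_compat_l; auto).
      assert (0 <= (x - y) * (x - y)) by apply Rle_0_sqr.
      assert (0 <= K * ((x - y) * (x - y))) by (apply Rmult_le_pos; auto).
      assert (0 <= K * (x * x)) by (apply Rmult_le_pos; [auto|apply Rle_0_sqr]).
      nra. }
  assert (Hch : forall t, exists e', r <= t <= r0 -> is_derive E t e' /\ - ((1 + 3 * K) * E t) <= e').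
  { intros t. destruct (Rle_dec r t), (Rle_dec t r0); try (exists 0; intros; exfalso; lra).
    destruct (Hder t ltac:(lra)) as [e' He]. exists e'. auto. }
  apply functional_choice in Hch. destruct Hch as [E' HE'].
  destruct (MVT_cor2 (fun t => E t * exp ((1 + 3 * K) * t))
    (fun t => (E' t + (1 + 3 * K) * E t) * exp ((1 + 3 * K) * t)) r r0 Hr0) as [c [Hc1 Hc2]].
  { intros t Ht. destruct (HE' t Ht) as [Hd _]. apply is_derive_Reals.
    evar_last.
    - apply @is_derive_mult; [exact Hd| |intros; apply Rmult_comm].
      auto_derive; [auto|reflexivity].
    - unfold plus, mult; simpl. ring. }
  destruct (HE' c ltac:(lra)) as [_ Hge].
  assert (Hmono : E r * exp ((1 + 3 * K) * r) <= E r0 * exp ((1 + 3 * K) * r0)).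
  { assert (0 <= (E' c + (1 + 3 * K) * E c) * exp ((1 + 3 * K) * c) * (r0 - r)).
    { apply Rmult_le_pos; [apply Rmult_le_pos; [lra|apply Rlt_le, exp_pos]|lra]. }
    lra. }
  replace ((1 + 3 * K) * (r0 - r)) with ((1 + 3 * K) * r0 + - ((1 + 3 * K) * r)) by ring.
  rewrite exp_plus, exp_Ropp.
  apply Rmult_le_reg_r with (exp ((1 + 3 * K) * r)); [apply exp_pos|].
  replace (E r0 * (exp ((1 + 3 * K) * r0) * / exp ((1 + 3 * K) * r)) * exp ((1 + 3 * K) * r))
    with (E r0 * exp ((1 + 3 * K) * r0)); auto.
  field. apply Rgt_not_eq, exp_pos.
Qed.

(** Half of [eps] absorbs the constant [ab] in the common bound [K] for both coefficients on the ray
    from [z] out to radius [r0]; the other half absorbs the constant [E0 + 4] in the bound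
    [exp ((E0 + 4) * K)] that results from Gronwall's inequality. *)
Lemma hyper_order0_upper a b n rho A B f f1 f2 y d eps :
  (0 < n)%nat -> 0 < rho -> y < INR n -> 0 < d -> 0 < eps ->
  (forall z, 0 < Cmod z < d -> Cmod (A z) <= exp (exp (y * - ln (Cmod z)))) ->
  (forall z, 0 < Cmod z < d -> Cmod (B z) <= exp (exp (y * - ln (Cmod z)))) ->
  (forall z, punctured_disc rho z -> Cdiff f z (f1 z) /\ Cdiff f1 z (f2 z) /\
     (f2 z + A z * Cexp (a / z ^ n) * f1 z + B z * Cexp (b / z ^ n) * f z)%C = RtoC 0) ->
  (forall z, punctured_disc rho z -> Ccont f1 z) ->
  Rbar_le (hyper_order0 f) (INR n + eps).
Proof.
  intros Hn Hrho Hy Hd Heps HA HB Hf Hf1.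
  pose proof (lt_0_INR n Hn) as Hn0.
  set (r0 := Rmin (Rmin (d / 2) (rho / 2)) (/ 2)).
  assert (Hr0 : 0 < r0) by (unfold r0; repeat apply Rmin_pos; lra).
  assert (Hr1 : r0 <= d / 2) by (unfold r0; eapply Rle_trans; [apply Rmin_l|apply Rmin_l]).
  assert (Hr2 : r0 <= rho / 2) by (unfold r0; eapply Rle_trans; [apply Rmin_l|apply Rmin_r]).
  assert (Hr3 : r0 <= / 2) by (unfold r0; apply Rmin_r).
  assert (Hbd : forall g, (forall z, punctured_disc rho z -> Ccont g z) ->
     exists M, 0 < M /\ forall z, Cmod z = r0 -> Cmod (g z) <= M).
  { intros g Hg. destruct (bounded_on_compact (fun w => r0 <= Cmod (w - RtoC 0) <= r0) g (Cmod (RtoC 0) + r0)) as [M [HM HBM]].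
    - apply Cclosed_annulus.
    - intros w [_ Hw]. now apply Cmod_le_center.
    - intros w Hw. apply Hg. replace (w - RtoC 0)%C with w in Hw by ring. unfold punctured_disc. lra.
    - exists M. split; auto. intros z Hz. apply HBM. replace (z - RtoC 0)%C with z by ring. lra. }
  destruct (Hbd f) as [M [HM HMf]].
  { intros z Hz. eapply Cdiff_cont. apply Hf. auto. }
  destruct (Hbd f1 Hf1) as [M1 [HM1 HMf1]].
  set (E0 := M * M + M1 * M1). assert (HE0 : 0 < E0) by (unfold E0; nra).
  (* The summand 1 pays for the factor [A] or [B], whose growth exponent [y] is below [n]; the
     moduli pay for the exponential factors. *)
  set (ab := 1 + Cmod a + Cmod b).
  assert (Hab : 1 <= ab) by (unfold ab; pose proof (Cmod_ge_0 a); pose proof (Cmod_ge_0 b); lra).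
  destruct (exp_dominates (INR n) (INR n + eps / 2) ab) as [L1 [HL1 HD1]]; [lra|lra|].
  assert (Hln : 0 < ln (E0 + 4)) by (rewrite <- ln_1; apply ln_increasing; lra).
  destruct (exp_dominates (INR n + eps / 2) (INR n + eps) (1 + ln (E0 + 4))) as [L2 [HL2 HD2]]; [lra|lra|].
  set (Lm := Rmax L1 L2). assert (L1 <= Lm) by apply Rmax_l. assert (L2 <= Lm) by apply Rmax_r.
  apply (hyper_order0_le f _ (Rmin r0 (exp (- Lm)))); [lra|apply Rmin_pos; auto; apply exp_pos|].
  intros z [Hz0 Hz]. pose proof (Rmin_l r0 (exp (- Lm))). pose proof (Rmin_r r0 (exp (- Lm))).
  set (L := - ln (Cmod z)).
  assert (HL : Lm <= L).
  { unfold L. assert (ln (Cmod z) < - Lm); [|lra]. rewrite <- (ln_exp (- Lm)). apply ln_increasing; lra. }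
  set (K := exp (exp ((INR n + eps / 2) * L))).
  assert (HK1 : 1 <= K).
  { unfold K. rewrite <- exp_0. apply exp_le_compat, Rlt_le, exp_pos. }
  set (u := (RtoC (/ Cmod z) * z)%C).
  assert (Hu : Cmod u = 1).
  { unfold u. rewrite Cmod_mult, Cmod_R, Rabs_right.
    - field. lra.
    - apply Rle_ge, Rlt_le, Rinv_0_lt_compat; auto. }
  assert (Hzu : (RtoC (Cmod z) * u)%C = z).
  { unfold u. rewrite Cmult_assoc, <- RtoC_mult, Rinv_r by lra. ring. }
  assert (Hcoef : forall c G w, Cmod c <= ab - 1 -> Cmod z <= Cmod w <= r0 ->
     (forall z, 0 < Cmod z < d -> Cmod (G z) <= exp (exp (y * - ln (Cmod z)))) ->
     Cmod (G w * Cexp (c / w ^ n))%C <= K).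
  { intros c G w Hc Hw HG. rewrite Cmod_mult.
    assert (HLw : 0 < - ln (Cmod w) <= L).
    { split; [apply neg_ln_pos; lra|]. unfold L. apply Ropp_le_contravar. apply ln_le; lra. }
    set (Lw := - ln (Cmod w)) in *.
    apply Rle_trans with (exp (exp (INR n * L)) * exp ((ab - 1) * exp (INR n * L))).
    - apply Rmult_le_compat; try apply Cmod_ge_0.
      + eapply Rle_trans; [apply HG; lra|]. apply exp_le_compat, exp_le_compat. fold Lw. nra.
      + eapply Rle_trans; [apply Cmod_Cexp_le|]. apply exp_le_compat.
        rewrite Cmod_div_pow by lra. fold Lw. apply Rmult_le_compat; auto using Cmod_ge_0.
        * apply Rlt_le, exp_pos.
        * apply exp_le_compat. nra.
    - rewrite <- exp_plus. unfold K. apply exp_le_compat.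
      replace (exp (INR n * L) + (ab - 1) * exp (INR n * L)) with (ab * exp (INR n * L)) by ring.
      apply HD1. lra. }
  assert (Hg : sqmod (f (RtoC (Cmod z) * u)%C) + sqmod (f1 (RtoC (Cmod z) * u)%C) <=
    (sqmod (f (RtoC r0 * u)%C) + sqmod (f1 (RtoC r0 * u)%C)) * exp ((1 + 3 * K) * (r0 - Cmod z))).
  { apply (gronwall_along_ray f f1 f2 (fun z => A z * Cexp (a / z ^ n))%C (fun z => B z * Cexp (b / z ^ n))%C);
      auto; try lra.
    intros t Ht w. assert (Hw : Cmod w = t).
    { unfold w. rewrite Cmod_mult, Cmod_R, Hu, Rabs_right; lra. }
    destruct (Hf w) as [H1' [H2' H3']]; [unfold punctured_disc; lra|].
    pose proof (Cmod_ge_0 a). pose proof (Cmod_ge_0 b).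
    repeat split; auto; apply Hcoef; auto; try (unfold ab; lra); lra. }
  rewrite Hzu in Hg.
  assert (Hr0u : Cmod (RtoC r0 * u)%C = r0) by (rewrite Cmod_mult, Cmod_R, Hu, Rabs_right; lra).
  assert (HE : sqmod (f (RtoC r0 * u)%C) + sqmod (f1 (RtoC r0 * u)%C) <= E0).
  { unfold sqmod. rewrite <- !Cmod_sqr. specialize (HMf _ Hr0u). specialize (HMf1 _ Hr0u).
    pose proof (Cmod_ge_0 (f (RtoC r0 * u)%C)). pose proof (Cmod_ge_0 (f1 (RtoC r0 * u)%C)). unfold E0. nra. }
  assert (Hsq : Cmod (f z) * Cmod (f z) <= E0 * exp (4 * K)).
  { apply Rle_trans with (sqmod (f z) + sqmod (f1 z)).
    - unfold sqmod. rewrite <- !Cmod_sqr. pose proof (Cmod_ge_0 (f1 z)). nra.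
    - eapply Rle_trans; [exact Hg|]. apply Rmult_le_compat; auto.
      + unfold sqmod. rewrite <- !Cmod_sqr. pose proof (Cmod_ge_0 (f (RtoC r0 * u)%C)). pose proof (Cmod_ge_0 (f1 (RtoC r0 * u)%C)). nra.
      + apply Rlt_le, exp_pos.
      + apply exp_le_compat. nra. }
  assert (Hfz : Cmod (f z) <= exp ((E0 + 4) * K)).
  { assert (Cmod (f z) * Cmod (f z) <= exp ((E0 + 4) * K) * exp ((E0 + 4) * K)).
    { eapply Rle_trans; [exact Hsq|]. rewrite <- exp_plus.
      apply Rle_trans with (exp E0 * exp (4 * K)).
      - apply Rmult_le_compat_r; [apply Rlt_le, exp_pos|]. pose proof (exp_ineq1_le E0). lra.
      - rewrite <- exp_plus. apply exp_le_compat. nra. }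
    pose proof (exp_pos ((E0 + 4) * K)). pose proof (Cmod_ge_0 (f z)). nra. }
  eapply Rle_trans; [exact Hfz|]. apply exp_le_compat.
  rewrite <- (exp_ln (E0 + 4)) by lra. unfold K. rewrite <- exp_plus. apply exp_le_compat.
  fold L. eapply Rle_trans; [|apply HD2; lra].
  assert (1 <= exp ((INR n + eps / 2) * L)).
  { rewrite <- exp_0. apply exp_le_compat. apply Rmult_le_pos; lra. }
  nra.
Qed.

(** * Sectors and rotations *)

Lemma Re_scal r z : Re (RtoC r * z)%C = r * Re z.
Proof. destruct z; unfold Re; simpl; ring. Qed.

Lemma Re_minus z w : Re (z - w)%C = Re z - Re w.
Proof. destruct z, w; reflexivity. Qed.

(** The angle [phi] stands for [- n arg z]. If the arguments differ, the rotation that moves their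
    mean to the imaginary axis makes the real part of [b] positive and that of [a] negative, so
    [c = 0] will do. If [a] is a multiple of [b], then [b] is turned to the positive axis, and
    [(1 + c) / 2] leaves room for a strict inequality. *)
Lemma direction_exists (a b : C) : a <> RtoC 0 -> b <> RtoC 0 ->
  (Carg a <> Carg b \/ exists c : R, 0 < c < 1 /\ a = (RtoC c * b)%C) ->
  exists phi c, 0 <= c < 1 /\ 0 < Re (b * cis phi)%C /\ Re (a * cis phi)%C < c * Re (b * cis phi)%C.
Proof.
  intros Ha Hb H.
  assert (Hma : 0 < Cmod a) by now apply Cmod_gt_0. assert (Hmb : 0 < Cmod b) by now apply Cmod_gt_0.
  assert (Hrot : forall z phi, z <> RtoC 0 -> Re (z * cis phi)%C = Cmod z * cos (Carg z + phi)).
  { intros z phi Hz. rewrite (polar z Hz) at 1.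
    replace (RtoC (Cmod z) * cis (Carg z) * cis phi)%C with (RtoC (Cmod z) * (cis (Carg z) * cis phi))%C by ring.
    rewrite <- cis_plus, Re_scal. reflexivity. }
  destruct H as [Hne|[c [Hc E]]].
  - destruct (Carg_spec a Ha) as [Ra _]. destruct (Carg_spec b Hb) as [Rb _].
    set (al := Carg a) in *. set (be := Carg b) in *.
    set (D := (be - al) / 2).
    destruct (Rlt_dec al be) as [Hlt|Hge].
    + exists (- (al + be) / 2 - PI / 2), 0. rewrite !Hrot by auto. fold al be.
      assert (HD : 0 < sin D) by (apply sin_gt_0; unfold D; lra).
      replace (be + (- (al + be) / 2 - PI / 2)) with (- (PI / 2 - D)) by (unfold D; field).
      replace (al + (- (al + be) / 2 - PI / 2)) with (- (PI / 2 + D)) by (unfold D; field).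
      rewrite !cos_neg, cos_shift.
      replace (cos (PI / 2 + D)) with (- sin D) by (rewrite sin_cos; ring).
      repeat split; try lra; nra.
    + exists (- (al + be) / 2 + PI / 2), 0. rewrite !Hrot by auto. fold al be.
      assert (HD : 0 < sin (- D)) by (apply sin_gt_0; unfold D; lra).
      replace (be + (- (al + be) / 2 + PI / 2)) with (PI / 2 - (- D)) by (unfold D; field).
      replace (al + (- (al + be) / 2 + PI / 2)) with (PI / 2 + (- D)) by (unfold D; field).
      rewrite cos_shift. replace (cos (PI / 2 + - D)) with (- sin (- D)) by (rewrite (sin_cos (- D)); ring).
      repeat split; try lra; nra.
  - exists (- Carg b), ((1 + c) / 2). subst a.
    replace (RtoC c * b * cis (- Carg b))%C with (RtoC c * (b * cis (- Carg b)))%C by ring.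
    rewrite Re_scal, Hrot by auto. rewrite Rplus_opp_r, cos_0. repeat split; try lra; nra.
Qed.

(** At [z = cis theta] one has [1 / z^n = cis phi], where the inequalities of [direction_exists]
    hold with room to spare. They persist nearby by continuity, and [a / z^n], [b / z^n] are
    homogeneous in [|z|], which extends them to a cone. *)
Lemma sector_exists (a b : C) (n : nat) : a <> RtoC 0 -> b <> RtoC 0 -> (0 < n)%nat ->
  (Carg a <> Carg b \/ exists c : R, 0 < c < 1 /\ a = (RtoC c * b)%C) ->
  exists theta delta c0 c, 0 < delta < 1 /\ 0 < c0 /\ 0 <= c < 1 /\
    forall z, 0 < Cmod z -> Cmod (z - RtoC (Cmod z) * cis theta) < delta * Cmod z ->
      c0 * exp (INR n * - ln (Cmod z)) <= Re (b / z ^ n)%C /\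
      Re (a / z ^ n)%C <= c * Re (b / z ^ n)%C.
Proof.
  intros Ha Hb Hn H. destruct (direction_exists a b Ha Hb H) as [phi [c [Hc [Hp Hq]]]].
  pose proof (lt_0_INR n Hn) as Hn0.
  set (theta := - phi / INR n).
  set (p := Re (b * cis phi)%C) in *. set (q := c * p - Re (a * cis phi)%C).
  assert (Hq0 : 0 < q) by (unfold q; lra).
  (* The first entry preserves half of [p]. For the second, the errors [eps] from [a] and
     [c * eps <= eps] from [b] must stay below [q] together. *)
  set (eps := Rmin (p / 2) (q / 4)).
  assert (Heps : 0 < eps) by (unfold eps; apply Rmin_pos; lra).
  assert (He1 : eps <= p / 2) by apply Rmin_l. assert (He2 : eps <= q / 4) by apply Rmin_r.
  assert (Hcis0 : forall t, cis t <> RtoC 0) by (intros t; apply Cmod_pos_neq0; rewrite Cmod_cis; lra).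
  assert (Hlim : ((/ cis theta) ^ n)%C = cis phi).
  { assert (Hinv : (/ cis theta)%C = cis (- theta)).
    { assert (E : (cis theta * cis (- theta))%C = RtoC 1).
      { rewrite <- cis_plus, Rplus_opp_r. unfold cis. rewrite cos_0, sin_0. reflexivity. }
      replace (cis (- theta)) with (/ cis theta * (cis theta * cis (- theta)))%C; [rewrite E; ring|].
      field. apply Hcis0. }
    rewrite Hinv, cis_pow. f_equal. unfold theta. field. lra. }
  assert (Hcont : forall g, exists d, 0 < d /\ forall w, Cmod (w - cis theta) < d -> Cmod (g * (/ w) ^ n - g * cis phi)%C < eps).
  { intros g.
    assert (Hh : hol2 (fun z => z <> RtoC 0) (fun w => (g * (/ (w - RtoC 0)) ^ n)%C)).
    { apply (hol2_mult _ (fun _ => g)); [apply hol2_const|]. apply (hol2_pow _ (fun w => / (w - RtoC 0))%C).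
      now apply hol2_inv_sub. }
    destruct (hol2_cont _ _ (cis theta) Hh (Hcis0 theta) eps Heps) as [d [Hd Hw]].
    exists d. split; auto. intros w Hwd. specialize (Hw w Hwd). rewrite <- Hlim.
    replace (w - RtoC 0)%C with w in Hw by ring. replace (cis theta - RtoC 0)%C with (cis theta) in Hw by ring. auto. }
  destruct (Hcont a) as [d1 [Hd1 H1]]. destruct (Hcont b) as [d2 [Hd2 H2]].
  set (delta := Rmin (Rmin d1 d2) (/ 2)).
  assert (Hdl1 : delta <= d1) by (unfold delta; eapply Rle_trans; [apply Rmin_l|apply Rmin_l]).
  assert (Hdl2 : delta <= d2) by (unfold delta; eapply Rle_trans; [apply Rmin_l|apply Rmin_r]).
  assert (Hdl3 : delta <= / 2) by apply Rmin_r.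
  assert (Hdl0 : 0 < delta) by (unfold delta; repeat apply Rmin_pos; lra).
  exists theta, delta, (p / 2), c. split; [lra|]. split; [lra|]. split; [lra|].
  intros z Hz Hzd.
  set (w := (RtoC (/ Cmod z) * z)%C).
  assert (Hz0 : z <> RtoC 0) by now apply Cmod_pos_neq0.
  assert (Hmz : RtoC (Cmod z) <> RtoC 0) by (intro E; apply RtoC_inj in E; lra).
  assert (Hw : Cmod (w - cis theta) < delta).
  { replace (w - cis theta)%C with (RtoC (/ Cmod z) * (z - RtoC (Cmod z) * cis theta))%C
      by (unfold w; rewrite RtoC_inv by lra; field; auto).
    rewrite Cmod_mult, Cmod_R, Rabs_right by (apply Rle_ge, Rlt_le, Rinv_0_lt_compat; auto).
    apply Rmult_lt_reg_l with (Cmod z); auto. rewrite <- Rmult_assoc, Rinv_r by lra. lra. }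
  assert (Hs : forall g, (g / z ^ n)%C = (RtoC (exp (INR n * - ln (Cmod z))) * (g * (/ w) ^ n))%C).
  { intros g. rewrite exp_mult_INR, exp_Ropp, exp_ln by auto.
    unfold w. rewrite RtoC_pow, !RtoC_inv by lra.
    assert (E : (/ (/ RtoC (Cmod z) * z))%C = (RtoC (Cmod z) * / z)%C) by (field; auto).
    rewrite E, Cpow_mult_l, !Cpow_inv by auto. unfold Cdiv.
    field. split; now apply Cpow_nz. }
  assert (B1 := H1 w ltac:(lra)). assert (B2 := H2 w ltac:(lra)).
  rewrite !Hs, !Re_scal.
  pose proof (abs_Re_le_Cmod (a * (/ w) ^ n - a * cis phi)) as R1.
  pose proof (abs_Re_le_Cmod (b * (/ w) ^ n - b * cis phi)) as R2.
  rewrite Re_minus in R1, R2. apply Rabs_le_between in R1. apply Rabs_le_between in R2.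
  fold p in R2.
  set (sc := exp (INR n * - ln (Cmod z))). assert (Hsc : 0 < sc) by apply exp_pos.
  split.
  - rewrite Rmult_comm. apply Rmult_le_compat_l; lra.
  - set (ra := Re (a * (/ w) ^ n)%C) in *. set (rb := Re (b * (/ w) ^ n)%C) in *.
    replace (c * (sc * rb)) with (sc * (c * rb)) by ring. apply Rmult_le_compat_l; [lra|].
    assert (c * (p - eps) <= c * rb) by (apply Rmult_le_compat_l; lra).
    assert (c * eps <= eps) by (assert (0 <= (1 - c) * eps) by (apply Rmult_le_pos; lra); lra).
    unfold q in *. lra.
Qed.

(** Steps of size [h] advance the argument of [z] until it is within [h] of the target. Their number
    is bounded independently of [z], since principal arguments lie in a bounded interval. *)
Lemma rotation_into_sector theta h : 0 < h -> exists N, forall z, 0 < Cmod z ->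
  exists j, (j < N)%nat /\
    Cmod (cis (INR j * h) * z - RtoC (Cmod z) * cis theta) <= h * Cmod z.
Proof.
  intros Hh. pose proof PI_RGT_0 as Hpi.
  (* Full turns are added to [theta] until it exceeds every principal argument, so that the number
     of steps is the floor of a nonnegative number. *)
  destruct (INR_archimed (2 * PI) (PI - theta)) as [m Hm]; [lra|].
  set (th := theta + INR m * (2 * PI)).
  assert (Hth : cis th = cis theta).
  { unfold th. clear Hm th. induction m as [|m IH]; [f_equal; simpl; ring|].
    rewrite <- IH, <- (cis_2PI (theta + INR m * (2 * PI))). f_equal. rewrite S_INR. ring. }
  destruct (INR_archimed h (th + PI)) as [N HN]; auto.
  exists N. intros z Hz. assert (Hz0 : z <> RtoC 0) by now apply Cmod_pos_neq0.
  destruct (Carg_spec z Hz0) as [Hal _]. set (al := Carg z) in *.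
  assert (Hd : 0 <= (th - al) / h) by (apply Rdiv_le_0_compat; unfold th; lra).
  destruct (nfloor_ex _ Hd) as [j [Hj1 Hj2]].
  assert (Hj1' : INR j * h <= th - al).
  { apply (Rmult_le_compat_r h) in Hj1; [|lra]. unfold Rdiv in Hj1. rewrite Rmult_assoc, Rinv_l in Hj1; lra. }
  assert (Hj2' : th - al < (INR j + 1) * h).
  { apply (Rmult_lt_compat_r h) in Hj2; [|lra]. unfold Rdiv in Hj2. rewrite Rmult_assoc, Rinv_l in Hj2; lra. }
  exists j. split.
  - apply INR_lt. apply Rmult_lt_reg_r with h; auto. lra.
  - rewrite (polar z Hz0) at 1. fold al.
    replace (cis (INR j * h) * (RtoC (Cmod z) * cis al) - RtoC (Cmod z) * cis theta)%C
      with (RtoC (Cmod z) * (cis (INR j * h + al) - cis th))%C by (rewrite Hth, cis_plus; ring).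
    rewrite Cmod_mult, Cmod_R, Rabs_right by lra. rewrite Rmult_comm. apply Rmult_le_compat_r; [lra|].
    eapply Rle_trans; [apply cis_lipschitz|]. apply Rabs_le. lra.
Qed.

(** * Products over rotations *)

Fixpoint Cprod (x : nat -> C) (N : nat) : C :=
  match N with O => RtoC 1 | S N => (Cprod x N * x N)%C end.

Lemma Cprod_mult_pow x y k N :
  (Cprod x N * Cprod y N ^ k)%C = Cprod (fun j => x j * y j ^ k)%C N.
Proof.
  induction N as [|N IH]; simpl.
  - rewrite Cpow_1_l. ring.
  - rewrite <- IH, Cpow_mult_l. ring.
Qed.

Lemma Cprod_neq0 x N : (forall j, (j < N)%nat -> x j <> RtoC 0) -> Cprod x N <> RtoC 0.
Proof.
  induction N as [|N IH]; intros H; simpl.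
  - apply C1_nz.
  - apply Cmult_neq_0; [apply IH; auto|apply H; auto].
Qed.

Lemma hol2_Cprod D (g : nat -> C -> C) N : (forall j, hol2 D (g j)) ->
  hol2 D (fun z => Cprod (fun j => g j z) N).
Proof.
  intros H. induction N as [|N IH]; simpl.
  - apply hol2_const.
  - now apply (hol2_mult D (fun z => Cprod (fun j => g j z) N)).
Qed.

Lemma Cmod_Cprod_le x N E : 0 <= E -> (forall j, (j < N)%nat -> Cmod (x j) <= E) ->
  Cmod (Cprod x N) <= E ^ N.
Proof.
  intros HE. induction N as [|N IH]; intros H; simpl.
  - rewrite Cmod_1. lra.
  - rewrite Cmod_mult, Rmult_comm. apply Rmult_le_compat; auto using Cmod_ge_0.
Qed.

Lemma Cmod_Cprod_le_one_small x N E delta j0 : 0 <= E -> (j0 < N)%nat ->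
  (forall j, (j < N)%nat -> Cmod (x j) <= E) -> Cmod (x j0) <= E * delta ->
  Cmod (Cprod x N) <= E ^ N * delta.
Proof.
  intros HE. induction N as [|N IH]; intros Hj H H0; [lia|]. simpl. rewrite Cmod_mult.
  destruct (Nat.eq_dec j0 N) as [->|Hne].
  - apply Rle_trans with (E ^ N * (E * delta)); [|right; ring].
    apply Rmult_le_compat; auto using Cmod_ge_0. apply Cmod_Cprod_le; auto.
  - apply Rle_trans with ((E ^ N * delta) * E); [|right; ring].
    apply Rmult_le_compat; auto using Cmod_ge_0. apply IH; auto. lia.
Qed.

(** Rotations are written with [+ RtoC 0] to have the form of the affine maps in
    [hol2_comp_affine]. *)
Lemma rotation_in_disc rho t z : punctured_disc rho z -> punctured_disc rho (cis t * z + RtoC 0)%C.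
Proof.
  unfold punctured_disc. replace (cis t * z + RtoC 0)%C with (cis t * z)%C by ring.
  rewrite Cmod_mult, Cmod_cis. lra.
Qed.

Lemma hol2_rotation rho f t : hol2 (punctured_disc rho) f ->
  hol2 (punctured_disc rho) (fun z => f (cis t * z + RtoC 0)%C).
Proof. apply hol2_comp_affine. intros; now apply rotation_in_disc. Qed.

Lemma nonzero_rotation rho f t : not_identically_zero_on (punctured_disc rho) f ->
  not_identically_zero_on (punctured_disc rho) (fun z => f (cis t * z + RtoC 0)%C).
Proof.
  intros [z [Hz Hn]]. exists (cis (- t) * z + RtoC 0)%C. split; [now apply rotation_in_disc|].
  replace (cis t * (cis (- t) * z + RtoC 0) + RtoC 0)%C with ((cis t * cis (- t)) * z)%C by ring.
  rewrite <- cis_plus, Rplus_opp_r. unfold cis. rewrite cos_0, sin_0.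
  replace ((1, 0) * z)%C with z by (change (z = RtoC 1 * z)%C; ring). auto.
Qed.

(* If f or B were too small at all points of the circle |z| = r in the sector, the product over all rotations of f B^k
   would be small on the whole circle; dividing by z^(k L0) and comparing with a fixed outer circle and a fixed intermediate point z* where the
   product does not vanish (three circles) gives a contradiction. *)
Lemma large_point_in_sector rho d f B beta beta1 theta h :
  0 < rho -> 0 < d -> 0 < beta < beta1 -> 0 < h ->
  hol2 (punctured_disc rho) f -> hol2 (punctured_disc rho) B ->
  not_identically_zero_on (punctured_disc rho) f -> not_identically_zero_on (punctured_disc rho) B ->
  (forall z, 0 < Cmod z < d -> Cmod (B z) <= exp (exp (beta * - ln (Cmod z)))) ->
  (forall z, 0 < Cmod z < d -> Cmod (f z) <= exp (exp (exp (beta * - ln (Cmod z))))) ->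
  exists Lm, 0 < Lm /\ forall r k, 0 < r -> Lm <= - ln r ->
    exp (exp (beta1 * - ln r)) <= INR k ->
    exists z, Cmod z = r /\ Cmod (z - RtoC r * cis theta) <= h * r /\
      exp (- exp (beta1 * - ln r)) <= Cmod (B z) /\
      exp (- (INR k * exp (beta1 * - ln r))) <= Cmod (f z).
Proof.
  intros Hrho Hd [Hb0 Hb1] Hh Hf HB Hfn HBn BB Bf.
  destruct (rotation_into_sector theta h Hh) as [N HN].
  set (rf := fun j z => f (cis (INR j * h) * z + RtoC 0)%C).
  set (rB := fun j z => B (cis (INR j * h) * z + RtoC 0)%C).
  set (Hpf := fun z => Cprod (fun j => rf j z) N). set (HpB := fun z => Cprod (fun j => rB j z) N).
  assert (HHf : hol2 (punctured_disc rho) Hpf) by (apply hol2_Cprod; intros; now apply hol2_rotation).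
  assert (HHB : hol2 (punctured_disc rho) HpB) by (apply hol2_Cprod; intros; now apply hol2_rotation).
  destruct (common_nonzero rho (map rf (seq 0 N) ++ map rB (seq 0 N)) Hrho) as [zs [s [Hs Hzs]]].
  { intros g Hg. apply in_app_or in Hg. destruct Hg as [Hg|Hg]; apply in_map_iff in Hg;
      destruct Hg as [j [<- _]]; split; try (now apply hol2_rotation); now apply nonzero_rotation. }
  destruct (Hzs zs) as [[Hzs0 Hzs1] Hnz]; [rewrite Cmod_sub_0; auto|].
  assert (Hf0 : 0 < Cmod (Hpf zs)).
  { apply Cmod_gt_0, Cprod_neq0. intros j Hj. apply (Hnz (rf j)). apply in_or_app. left.
    apply in_map, in_seq. lia. }
  assert (HB0 : 0 < Cmod (HpB zs)).
  { apply Cmod_gt_0, Cprod_neq0. intros j Hj. apply (Hnz (rB j)). apply in_or_app. right.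
    apply in_map, in_seq. lia. }
  set (r1 := Cmod zs) in *. set (R0 := (r1 + rho) / 2).
  assert (HR0 : r1 < R0 < rho) by (unfold R0; lra).
  assert (Hbd : forall g, hol2 (punctured_disc rho) g -> exists M, 0 < M /\ forall z, Cmod z = R0 -> Cmod (g z) <= M).
  { intros g Hg. destruct (bounded_on_compact (fun w => R0 <= Cmod (w - RtoC 0) <= R0) g (Cmod (RtoC 0) + R0)) as [M [HM HBM]].
    - apply Cclosed_annulus.
    - intros w [_ Hw]. now apply Cmod_le_center.
    - intros w Hw. eapply hol2_cont; [exact Hg|]. replace (w - RtoC 0)%C with w in Hw by ring. unfold punctured_disc. lra.
    - exists M. split; auto. intros z Hz. apply HBM. replace (z - RtoC 0)%C with z by ring. lra. }
  destruct (Hbd _ HHf) as [Mf [HMf HMf']]. destruct (Hbd _ HHB) as [MB [HMB HMB']].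
  (* One constant for the four fixed quantities: [exp C0] bounds both products on the outer circle
     from above, and [exp (- C0)] bounds them at [zs] from below. *)
  set (C0 := Mf + MB + / Cmod (Hpf zs) + / Cmod (HpB zs)).
  assert (Hif : 0 < / Cmod (Hpf zs)) by now apply Rinv_0_lt_compat.
  assert (HiB : 0 < / Cmod (HpB zs)) by now apply Rinv_0_lt_compat.
  assert (HC0 : 0 < C0) by (unfold C0; lra).
  assert (Hup : forall M, M <= C0 -> M <= exp C0) by (intros M HM; pose proof (exp_ineq1_le C0); lra).
  assert (Hlow : forall x, 0 < x -> / x <= C0 -> exp (- C0) <= x).
  { intros x Hx Hxi. rewrite exp_Ropp, <- (Rinv_inv x). apply Rinv_le_contravar.
    - now apply Rinv_0_lt_compat.
    - auto. }
  (* Division by [z^(L0 k)] gains [exp (- 4 C0 k)] between the outer circle and [zs], which pays for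
     the upper bound [exp (2 C0 k)] there and the lower bound [exp (- 2 C0 k)] at [zs]. *)
  destruct (pow_lt_1_zero (r1 / R0)) with (y := exp (- (4 * C0))) as [L0 HL0]; [|apply exp_pos|].
  { rewrite Rabs_right by (apply Rle_ge, Rdiv_le_0_compat; lra).
    apply Rmult_lt_reg_r with R0; [lra|]. unfold Rdiv. rewrite Rmult_assoc, Rinv_l; lra. }
  specialize (HL0 L0 (le_n L0)).
  rewrite Rabs_right in HL0 by (apply Rle_ge, pow_le, Rdiv_le_0_compat; lra).
  pose proof (pos_INR L0) as HL0p. pose proof (pos_INR N) as HNp. pose proof (Rabs_pos (ln r1)) as Hlr.
  (* This makes [2 N Y] at most half of [X], so that [T] below is at least [X / 2]; the factor 2 in
     [KK] then lets [X / 2] dominate the terms that the division by [z^(L0 k)] produces on the inner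
     circle. *)
  destruct (exp_dominates beta beta1 (4 * INR N + 4)) as [La [HLa HDa]]; [lra|lra|].
  set (KK := 2 * ((INR L0 + 1) * (1 + Rabs (ln r1)) + 2 * C0 + 1)).
  destruct (exp_dominates_linear beta1 KK) as [Lb [HLb HDb]]; [lra| |].
  { unfold KK. assert (0 <= (INR L0 + 1) * (1 + Rabs (ln r1))) by (apply Rmult_le_pos; lra). lra. }
  set (rr := Rmin (Rmin d r1) 1).
  assert (Hrr : 0 < rr) by (unfold rr; repeat apply Rmin_pos; lra).
  assert (Hrr1 : rr <= d) by (unfold rr; eapply Rle_trans; [apply Rmin_l|apply Rmin_l]).
  assert (Hrr2 : rr <= r1) by (unfold rr; eapply Rle_trans; [apply Rmin_l|apply Rmin_r]).
  exists (La + Lb + (- ln rr + 1)).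
  assert (Hlnrr : 0 <= - ln rr).
  { assert (ln rr <= ln 1) by (apply ln_le; [auto|apply Rmin_r]). rewrite ln_1 in *. lra. }
  split; [lra|]. intros r k Hr HL Hk.
  set (L := - ln r) in *.
  assert (Hrlt : r < rr) by (apply ln_lt_inv; auto; unfold L in HL; lra).
  apply NNPP. intro Hno.
  set (X := exp (beta1 * L)) in *. set (Y := exp (beta * L)).
  specialize (HDa L ltac:(lra)). fold X Y in HDa. specialize (HDb L ltac:(lra)). fold X in HDb.
  assert (HY : 1 <= Y) by (unfold Y; rewrite <- exp_0; apply exp_le_compat, Rmult_le_pos; lra).
  assert (HYX : Y <= X) by nra.
  (* Since [k] is so large, the bound [exp (exp Y)] for [f] becomes [exp (k Y)], the same as the
     bound for [B^k]. *)
  assert (HkY : exp Y <= INR k * Y).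
  { apply Rle_trans with (INR k); [|pose proof (pos_INR k); nra].
    eapply Rle_trans; [|exact Hk]. now apply exp_le_compat. }
  assert (Hk1 : 1 <= INR k).
  { eapply Rle_trans; [|exact Hk]. rewrite <- exp_0. apply exp_le_compat. lra. }
  set (g := fun z => (Hpf z * HpB z ^ k)%C).
  assert (Hg : hol2 (punctured_disc rho) g) by (apply hol2_mult; auto; now apply hol2_pow).
  assert (Hpt : forall w, Cmod w = r -> Cmod (f w * B w ^ k)%C <= exp (2 * INR k * Y)).
  { intros w Hw. rewrite Cmod_mult, Cmod_pow.
    replace (2 * INR k * Y) with (INR k * Y + INR k * Y) by ring. rewrite exp_plus.
    apply Rmult_le_compat; [apply Cmod_ge_0|apply pow_le, Cmod_ge_0| |].
    - eapply Rle_trans; [apply Bf; lra|]. rewrite Hw. fold L Y. now apply exp_le_compat.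
    - rewrite exp_mult_INR. apply pow_incr. split; [apply Cmod_ge_0|].
      eapply Rle_trans; [apply BB; lra|]. rewrite Hw. fold L Y. lra. }
  (* In the sector either [|B w| < exp (- X)] or [|f w| < exp (- k X)]; each alone contributes the
     factor [exp (- k X)] to the product. *)
  assert (Hsec : forall w, Cmod w = r -> Cmod (w - RtoC r * cis theta) <= h * r ->
     Cmod (f w * B w ^ k)%C <= exp (2 * INR k * Y) * exp (- (INR k * X))).
  { intros w Hw Hws. rewrite Cmod_mult, Cmod_pow, <- exp_plus.
    assert (HBw : Cmod (B w) <= exp Y) by (eapply Rle_trans; [apply BB; lra|]; rewrite Hw; fold L Y; lra).
    assert (Hfw : Cmod (f w) <= exp (INR k * Y)).
    { eapply Rle_trans; [apply Bf; lra|]. rewrite Hw. fold L Y. now apply exp_le_compat. }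
    destruct (Rle_dec (exp (- X)) (Cmod (B w))) as [H1|H1].
    - destruct (Rle_dec (exp (- (INR k * X))) (Cmod (f w))) as [H2|H2].
      + exfalso. apply Hno. exists w. auto.
      + replace (2 * INR k * Y + - (INR k * X)) with (- (INR k * X) + INR k * Y + INR k * Y) by ring.
        rewrite !exp_plus.
        assert (1 <= exp (INR k * Y)) by (rewrite <- exp_0; apply exp_le_compat, Rmult_le_pos; lra).
        assert (0 < exp (- (INR k * X)) * exp (INR k * Y)) by (apply Rmult_lt_0_compat; apply exp_pos).
        apply Rle_trans with (exp (- (INR k * X)) * exp (INR k * Y)); [|nra].
        apply Rmult_le_compat; [apply Cmod_ge_0|apply pow_le, Cmod_ge_0|lra|].
        rewrite exp_mult_INR. apply pow_incr. split; [apply Cmod_ge_0|auto].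
    - replace (2 * INR k * Y + - (INR k * X)) with (INR k * Y + INR k * - X + INR k * Y) by ring.
      rewrite (exp_plus _ (INR k * Y)), exp_plus.
      assert (1 <= exp (INR k * Y)) by (rewrite <- exp_0; apply exp_le_compat, Rmult_le_pos; lra).
      assert (0 < exp (INR k * Y) * exp (INR k * - X)) by (apply Rmult_lt_0_compat; apply exp_pos).
      apply Rle_trans with (exp (INR k * Y) * exp (INR k * - X)); [|nra].
      apply Rmult_le_compat; [apply Cmod_ge_0|apply pow_le, Cmod_ge_0|auto|].
      rewrite (exp_mult_INR k (- X)). apply pow_incr. split; [apply Cmod_ge_0|lra]. }
  set (T := X - 2 * INR N * Y).
  (* At least one of the [N] rotated points lies in the sector and supplies the small factor; the
     others cost at most [exp (2 k Y)] each. *)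
  assert (Hcirc : forall z, Cmod (z - RtoC 0) = r -> Cmod (g z) <= exp (- (INR k * T))).
  { intros z Hz. replace (z - RtoC 0)%C with z in Hz by ring.
    assert (Hrotm : forall j, Cmod (cis (INR j * h) * z + RtoC 0)%C = r).
    { intros j. replace (cis (INR j * h) * z + RtoC 0)%C with (cis (INR j * h) * z)%C by ring.
      rewrite Cmod_mult, Cmod_cis. lra. }
    unfold g, Hpf, HpB. rewrite Cprod_mult_pow.
    replace (- (INR k * T)) with (INR N * (2 * INR k * Y) + - (INR k * X)) by (unfold T; ring).
    rewrite exp_plus, exp_mult_INR.
    destruct (HN z) as [j0 [Hj0 Hj0']]; [lra|].
    apply (Cmod_Cprod_le_one_small _ _ _ _ j0); auto.
    - apply Rlt_le, exp_pos.
    - intros j _. apply Hpt. auto.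
    - apply Hsec; auto. rewrite Hz in Hj0'.
      replace (cis (INR j0 * h) * z + RtoC 0)%C with (cis (INR j0 * h) * z)%C by ring. auto. }
  assert (Hout : forall z, Cmod (z - RtoC 0) = R0 -> Cmod (g z) <= exp (INR k * (2 * C0))).
  { intros z Hz. replace (z - RtoC 0)%C with z in Hz by ring.
    unfold g. rewrite Cmod_mult, Cmod_pow.
    apply Rle_trans with (exp C0 * exp C0 ^ k).
    - apply Rmult_le_compat; [apply Cmod_ge_0|apply pow_le, Cmod_ge_0| |].
      + apply Hup. eapply Rle_trans; [apply HMf'; auto|]. unfold C0. lra.
      + apply pow_incr. split; [apply Cmod_ge_0|]. apply Hup. eapply Rle_trans; [apply HMB'; auto|]. unfold C0. lra.
    - rewrite <- exp_mult_INR, <- exp_plus. apply exp_le_compat. nra. }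
  assert (Hin : exp (- (INR k * (2 * C0))) <= Cmod (g zs)).
  { unfold g. rewrite Cmod_mult, Cmod_pow.
    apply Rle_trans with (exp (- C0) * exp (- C0) ^ k).
    - rewrite <- exp_mult_INR, <- exp_plus. apply exp_le_compat. nra.
    - apply Rmult_le_compat; [apply Rlt_le, exp_pos|apply pow_le, Rlt_le, exp_pos| |].
      + apply Hlow; auto. unfold C0. lra.
      + apply pow_incr. split; [apply Rlt_le, exp_pos|]. apply Hlow; auto. unfold C0. lra. }
  assert (Hzs' : Cmod (zs - RtoC 0) = r1) by (replace (zs - RtoC 0)%C with zs by ring; auto).
  assert (Hann : Cmod (g zs) <= r1 ^ (L0 * k) * Rmax (exp (- (INR k * T)) / r ^ (L0 * k)) (exp (INR k * (2 * C0)) / R0 ^ (L0 * k))).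
  { rewrite <- Hzs'. apply (annulus_bound (RtoC 0) r R0); auto; try lra; try (apply Rlt_le, exp_pos).
    eapply hol2_subset; [|exact Hg]. simpl. intros z Hz. replace (z - RtoC 0)%C with z in Hz by ring.
    unfold punctured_disc. lra. }
  assert (Hkp : (0 < k)%nat) by (apply INR_lt; simpl; lra).
  assert (Hpe : forall x, 0 < x -> x ^ (L0 * k) = exp (INR k * (INR L0 * ln x))).
  { intros x Hx. rewrite exp_mult_INR, exp_mult_INR, exp_ln by auto. apply pow_mult. }
  revert Hann. apply Rlt_not_le. eapply Rlt_le_trans; [|exact Hin].
  assert (Hpr1 : 0 < r1 ^ (L0 * k)) by now apply pow_lt.
  rewrite <- RmaxRmult by lra. apply Rmax_lub_lt.
  - rewrite !Hpe by auto. unfold Rdiv. rewrite <- exp_Ropp, <- !exp_plus. apply exp_increasing.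
    (* Taken [k] times in the exponent, this says that the term of the inner circle is smaller than
       the lower bound for [g] at [zs]. *)
    assert (Hlt : INR L0 * (ln r1 + L) + 2 * C0 < T).
    { assert (ln r1 <= Rabs (ln r1)) by apply Rle_abs.
      assert (HL1 : 0 <= L) by lra.
      assert (INR L0 * (ln r1 + L) <= INR L0 * ((1 + Rabs (ln r1)) * (1 + L))).
      { apply Rmult_le_compat_l; auto. nra. }
      assert (0 <= (1 + Rabs (ln r1)) * (1 + L)) by (apply Rmult_le_pos; lra).
      assert (0 <= C0 * L) by (apply Rmult_le_pos; lra).
      unfold KK in HDb. unfold T. nra. }
    apply (Rmult_lt_compat_l (INR k)) in Hlt; [|lra]. fold L in Hlt. unfold L in Hlt |- *.
    nra.
  - replace (r1 ^ (L0 * k) * (exp (INR k * (2 * C0)) / R0 ^ (L0 * k))) with (((r1 / R0) ^ L0) ^ k * exp (INR k * (2 * C0))).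
    2:{ rewrite <- pow_mult. unfold Rdiv. rewrite Rpow_mult_distr, pow_inv. ring. }
    apply Rlt_le_trans with (exp (- (4 * C0)) ^ k * exp (INR k * (2 * C0))).
    + apply Rmult_lt_compat_r; [apply exp_pos|]. destruct k as [|k]; [lia|].
      assert (Hq0 : 0 <= (r1 / R0) ^ L0) by (apply pow_le, Rdiv_le_0_compat; lra).
      simpl. apply Rle_lt_trans with ((r1 / R0) ^ L0 * exp (- (4 * C0)) ^ k).
      * apply Rmult_le_compat_l; auto. apply pow_incr. lra.
      * apply Rmult_lt_compat_r; auto. apply pow_lt, exp_pos.
    + rewrite <- exp_mult_INR, <- exp_plus. apply exp_le_compat. nra.
Qed.

(** * Lower bound *)

Lemma bernoulli_sub x k : 0 <= x <= 1 -> 1 - INR k * x <= (1 - x) ^ k.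
Proof.
  intros Hx. induction k as [|k IH]; [simpl; lra|].
  rewrite S_INR. simpl. pose proof (pos_INR k).
  assert ((1 - x) * (1 - INR k * x) <= (1 - x) * (1 - x) ^ k) by (apply Rmult_le_compat_l; lra).
  assert (0 <= INR k * (x * x)) by (apply Rmult_le_pos; nra). nra.
Qed.

(** Bernoulli's inequality, [(1 - 1 / (2 k))^k >= 1 / 2]: a relative loss of [1 / (2 k)] costs at
    most a factor 2 in the power [k]. *)
Lemma half_pow_le x y k : (0 < k)%nat -> 0 <= x -> (1 - / (2 * INR k)) * x <= y -> x ^ k / 2 <= y ^ k.
Proof.
  intros Hk Hx Hy. assert (Hk1 : 1 <= INR k) by (change 1 with (INR 1); apply le_INR; lia).
  assert (Hinv : 0 < / (2 * INR k) <= 1).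
  { split; [apply Rinv_0_lt_compat; lra|]. rewrite <- Rinv_1. apply Rinv_le_contravar; lra. }
  pose proof (bernoulli_sub (/ (2 * INR k)) k ltac:(lra)) as HB.
  replace (INR k * / (2 * INR k)) with (/ 2) in HB by (field; lra).
  apply Rle_trans with (((1 - / (2 * INR k)) * x) ^ k).
  - rewrite Rpow_mult_distr. pose proof (pow_le x k Hx). nra.
  - apply pow_incr. split; auto. apply Rmult_le_pos; lra.
Qed.

(* At a maximum w of |f| |B|^k W^m on the disc, m >= 4 k X, the weight W^m keeps w away from the boundary and the factor |B|^k keeps
   |B(w)| from being small; near w both factors vary little, so |f| <= 4 |f(w)| there and Cauchy's estimates bound f'/f and f''/f at w. *)
Lemma local_maximum (f f1 f2 B : C -> C) (z1 : C) (rho X : R) (k : nat) :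
  let D := fun z => Cmod (z - z1) <= rho in
  0 < rho <= 1 -> 15 <= X -> 120 <= rho * exp X -> exp X <= INR k <= 2 * exp X ->
  hol2 D f -> hol2 D f1 -> hol2 D B ->
  (forall z, D z -> Cdiff f z (f1 z) /\ Cdiff f1 z (f2 z)) ->
  (forall z, D z -> Cmod (f z) <= exp (INR k)) ->
  (forall z, D z -> Cmod (B z) <= exp X) ->
  exp (- X) <= Cmod (B z1) -> exp (- (INR k * X)) <= Cmod (f z1) ->
  exists w, D w /\ 0 < Cmod (f w) /\ exp (- (3 * X)) <= Cmod (B w) /\
    Cmod (f1 w) <= 8 * exp (6 * X) * Cmod (f w) /\
    Cmod (f2 w) <= 64 * exp (12 * X) * Cmod (f w).
Proof.
  intros D Hrho HX HrhoX Hk Hf Hf1 HB Hder Bf BB HB1 Hf01.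
  set (W := fun z => 1 - Cmod (z - z1) * Cmod (z - z1) / (rho * rho)).
  set (K := INR k) in *.
  assert (HeX : 15 <= exp X) by (pose proof (exp_ineq1_le X); lra).
  assert (HK : 15 <= K) by lra.
  assert (Hk0 : (0 < k)%nat) by (apply INR_lt; simpl; fold K; lra).
  assert (HKX : 225 <= K * X) by nra.
  (* The lower bound on [m] confines [w] to the region where the weight is at least [/ 3]; the upper
     bound limits how fast the power of the weight can vary. *)
  destruct (nfloor_ex (4 * (K * X))) as [m0 [Hm1 Hm2]]; [lra|].
  set (m := S m0). assert (Hm : 4 * (K * X) <= INR m <= 5 * (K * X)) by (unfold m; rewrite S_INR; lra).
  assert (Hm0 : (0 < m)%nat) by (unfold m; lia).
  assert (Hz1 : D z1) by (unfold D; rewrite Cmod_sub_0; lra).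
  assert (Hrr : 0 < rho * rho) by nra.
  assert (HW : forall z, D z -> 0 <= W z <= 1).
  { intros z Hz. unfold W, D in *. pose proof (Cmod_ge_0 (z - z1)).
    assert (0 <= Cmod (z - z1) * Cmod (z - z1) / (rho * rho)) by (apply Rdiv_le_0_compat; nra).
    assert (Cmod (z - z1) * Cmod (z - z1) / (rho * rho) <= 1).
    { apply Rmult_le_reg_r with (rho * rho); auto. unfold Rdiv. rewrite Rmult_assoc, Rinv_l; nra. }
    lra. }
  set (Phi := fun z => Cmod (f z) * Cmod (B z) ^ k * W z ^ m).
  destruct (compact_max (fun z => 0 <= Cmod (z - z1) <= rho) Phi (Cmod z1 + rho) z1) as [w [[_ Hw] Hmax]].
  { apply Cclosed_annulus. }
  { intros z [_ Hz]. now apply Cmod_le_center. }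
  { rewrite Cmod_sub_0. lra. }
  { intros z [_ Hz].
    assert (cont_at (fun z => Cmod (f z)) z) by (apply Ccont_mod, (hol2_cont D); auto).
    assert (cont_at (fun z => Cmod (B z)) z) by (apply Ccont_mod, (hol2_cont D); auto).
    assert (cont_at (fun z => Cmod (z - z1)) z).
    { apply (Ccont_mod (fun z => z - z1)%C), (hol2_cont (fun _ => True)); auto.
      apply hol2_sub_const. exists (fun _ => RtoC 1), (fun _ => RtoC 0). intros x _. split; [|apply Cdiff_const].
      apply (Cdiff_ext (fun z => (RtoC 1 * z + RtoC 0)%C)); [|apply Cdiff_affine].
      exists 1. split; [lra|]. intros; ring. }
    unfold Phi. apply (cont_at_mult (fun z => Cmod (f z) * Cmod (B z) ^ k)).
    { apply (cont_at_mult (fun z => Cmod (f z))); auto. now apply (cont_at_pow (fun z => Cmod (B z))). }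
    apply (cont_at_pow W). unfold W.
    apply (cont_at_plus (fun _ => 1) (fun w => - (Cmod (w - z1) * Cmod (w - z1) / (rho * rho)))).
    - apply cont_at_const.
    - apply (cont_at_of_continuity_pt Ropp).
      + apply continuity_pt_opp, continuity_pt_id.
      + apply (cont_at_mult (fun w => Cmod (w - z1) * Cmod (w - z1)) (fun _ => / (rho * rho))).
        * now apply cont_at_mult.
        * apply cont_at_const. }
  fold (D w) in Hw.
  assert (Hmax' : forall z, D z -> Phi z <= Phi w).
  { intros z Hz. apply Hmax. split; [apply Cmod_ge_0|exact Hz]. }
  clear Hmax.
  (* The value at the centre [z1]: one half of the exponent comes from [f], the other from the power
     of [B]. *)
  assert (Hlow : exp (- (2 * (K * X))) <= Phi w).
  { eapply Rle_trans; [|apply (Hmax' z1 Hz1)]. unfold Phi.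
    replace (W z1) with 1 by (unfold W; rewrite Cmod_sub_0; field; lra).
    rewrite pow1, Rmult_1_r. replace (- (2 * (K * X))) with (- (K * X) + K * - X) by ring.
    rewrite exp_plus. apply Rmult_le_compat; auto; try (apply Rlt_le, exp_pos).
    unfold K. rewrite exp_mult_INR. apply pow_incr. split; [apply Rlt_le, exp_pos|auto]. }
  destruct (HW w Hw) as [HW0 HW1].
  assert (HWm : 0 <= W w ^ m <= 1).
  { split; [now apply pow_le|]. rewrite <- (pow1 m). apply pow_incr. auto. }
  pose proof (exp_pos (- (2 * (K * X)))) as Hep.
  assert (HBk : Cmod (B w) ^ k <= exp (K * X)).
  { unfold K. rewrite exp_mult_INR. apply pow_incr. split; [apply Cmod_ge_0|auto]. }
  assert (HBk0 : 0 <= Cmod (B w) ^ k) by (apply pow_le, Cmod_ge_0).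
  pose proof (Cmod_ge_0 (f w)) as Hfw0.
  assert (Hfw : 0 < Cmod (f w)).
  { destruct Hfw0 as [|E]; auto. unfold Phi in Hlow. rewrite <- E in Hlow. lra. }
  (* Otherwise [Phi w] is below [exp (K - 3 K X)], which is less than [exp (- 2 K X)] because
     [X > 1]. *)
  assert (HBw : exp (- (3 * X)) <= Cmod (B w)).
  { apply Rnot_lt_le. intro Hlt. revert Hlow. apply Rlt_not_le.
    apply Rle_lt_trans with (exp K * exp (K * - (3 * X)) * 1).
    - unfold Phi. apply Rmult_le_compat; try lra; [apply Rmult_le_pos; lra|].
      apply Rmult_le_compat; auto; try lra. unfold K. rewrite exp_mult_INR. apply pow_incr.
      split; [apply Cmod_ge_0|lra].
    - rewrite Rmult_1_r, <- exp_plus. apply exp_increasing. nra. }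
  (* Otherwise [W w < exp (-1)], so that [Phi w <= exp (K + K X - 4 K X)], again less than
     [exp (- 2 K X)]. *)
  assert (HWw : / 3 <= W w).
  { apply Rnot_lt_le. intro Hlt. revert Hlow. apply Rlt_not_le.
    assert (He3 : / 3 <= exp (-1)).
    { change (-1) with (- (1)). rewrite exp_Ropp. apply Rinv_le_contravar; [apply exp_pos|apply exp_le_3]. }
    assert (HWe : W w ^ m <= exp (- (4 * (K * X)))).
    { apply Rle_trans with (exp (-1) ^ m); [apply pow_incr; lra|].
      rewrite <- exp_mult_INR. apply exp_le_compat. lra. }
    apply Rle_lt_trans with (exp K * exp (K * X) * exp (- (4 * (K * X)))).
    - unfold Phi. apply Rmult_le_compat; try lra; [apply Rmult_le_pos; lra|].
      apply Rmult_le_compat; auto.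
    - rewrite <- !exp_plus. apply exp_increasing. nra. }
  (* The weight needs [12 m eta <= rho], the power of [B] needs [48 K exp (4 X) eta <= rho]. As
     [m <= 5 K X] and [K <= 2 exp X], both follow from [120 exp (5 X) eta <= rho], which is the
     hypothesis [120 <= rho * exp X] for this [eta]. *)
  set (eta := exp (- (6 * X))).
  assert (Heta : 0 < eta) by apply exp_pos.
  assert (Heta1 : 120 * exp (5 * X) * eta <= rho).
  { unfold eta. replace (- (6 * X)) with (- X + - (5 * X)) by ring. rewrite exp_plus, (exp_Ropp (5 * X)), (exp_Ropp X).
    pose proof (exp_pos (5 * X)). pose proof (exp_pos X).
    replace (120 * exp (5 * X) * (/ exp X * / exp (5 * X))) with (120 / exp X) by (field; lra).
    apply Rmult_le_reg_r with (exp X); auto. unfold Rdiv. rewrite Rmult_assoc, Rinv_l; lra. }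
  assert (Hexp5 : exp (5 * X) = exp X * exp (4 * X)) by (rewrite <- exp_plus; f_equal; ring).
  assert (Hexp4 : exp (4 * X) = exp X * exp (3 * X)) by (rewrite <- exp_plus; f_equal; ring).
  assert (Hexp3 : 1 <= exp (3 * X)) by (rewrite <- exp_0; apply exp_le_compat; lra).
  assert (HXe : X <= exp X) by (pose proof (exp_ineq1_le X); lra).
  assert (Heta2 : 12 * INR m * eta <= rho).
  { eapply Rle_trans; [|exact Heta1]. apply Rmult_le_compat_r; [lra|].
    assert (K * X <= 2 * exp X * exp X) by (apply Rmult_le_compat; lra).
    rewrite Hexp5, Hexp4. nra. }
  assert (Heta3 : 48 * K * exp X * exp (3 * X) * eta <= rho).
  { eapply Rle_trans; [|exact Heta1]. apply Rmult_le_compat_r; [lra|].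
    rewrite Hexp5, Hexp4. replace (48 * K * exp X * exp (3 * X)) with (48 * K * (exp X * exp (3 * X))) by ring.
    replace (120 * (exp X * (exp X * exp (3 * X)))) with (120 * exp X * (exp X * exp (3 * X))) by ring.
    apply Rmult_le_compat_r; nra. }
  assert (Hm1' : 1 <= INR m) by lra.
  assert (Heta12 : eta <= rho / 12) by nra.
  (* The weight bound gives [|w - z1|^2 <= 2/3 rho^2], and [2/3 < 25/36]. A disc of radius
     [rho / 12] around [w] therefore fits into [D]. *)
  assert (Hwz1 : Cmod (w - z1) <= 5 / 6 * rho).
  { apply Rnot_lt_le. intro Hlt. unfold W in HWw.
    assert (25 / 36 * (rho * rho) <= Cmod (w - z1) * Cmod (w - z1)) by nra.
    assert (25 / 36 <= Cmod (w - z1) * Cmod (w - z1) / (rho * rho)); [|lra].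
    apply Rmult_le_reg_r with (rho * rho); auto. unfold Rdiv. rewrite !Rmult_assoc, Rinv_l; lra. }
  assert (Hin : forall z, Cmod (z - w) <= rho / 12 -> D z).
  { intros z Hz. unfold D. pose proof (Cmod_sub_triangle z w z1). lra. }
  (* Within [eta] of [w] the weight drops by a relative amount of at most [1 / (2 m)] and [|B|] by
     at most [1 / (2 k)]. Their powers lose at most a factor 2 each, and maximality of [Phi w]
     leaves the factor 4 for [f]. *)
  assert (Hnear : forall z, Cmod (z - w) <= eta -> Cmod (f z) <= 4 * Cmod (f w)).
  { intros z Hz. assert (HDz : D z) by (apply Hin; lra).
    assert (Hz1z : Cmod (z - z1) <= rho) by exact HDz.
    assert (HWz : (1 - / (2 * INR m)) * W w <= W z).
    { assert (Hdiff : W w - W z <= / (6 * INR m)).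
      { pose proof (Cmod_sub_triangle z w z1). pose proof (Cmod_ge_0 (w - z1)). pose proof (Cmod_ge_0 (z - z1)).
        assert (Cmod (z - z1) * Cmod (z - z1) - Cmod (w - z1) * Cmod (w - z1) <= eta * (2 * rho)).
        { destruct (Rle_dec (Cmod (z - z1)) (Cmod (w - z1))); [assert (0 <= eta * (2 * rho)) by nra; nra|].
          replace (Cmod (z - z1) * Cmod (z - z1) - Cmod (w - z1) * Cmod (w - z1))
            with ((Cmod (z - z1) - Cmod (w - z1)) * (Cmod (z - z1) + Cmod (w - z1))) by ring.
          apply Rmult_le_compat; lra. }
        unfold W.
        apply Rmult_le_reg_r with (rho * rho * (6 * INR m)); [apply Rmult_lt_0_compat; lra|].
        replace (/ (6 * INR m) * (rho * rho * (6 * INR m))) with (rho * rho) by (field; lra).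
        replace ((1 - Cmod (w - z1) * Cmod (w - z1) / (rho * rho) - (1 - Cmod (z - z1) * Cmod (z - z1) / (rho * rho))) * (rho * rho * (6 * INR m)))
          with ((Cmod (z - z1) * Cmod (z - z1) - Cmod (w - z1) * Cmod (w - z1)) * (6 * INR m)) by (field; lra).
        apply Rle_trans with (eta * (2 * rho) * (6 * INR m)); [apply Rmult_le_compat_r; lra|].
        replace (eta * (2 * rho) * (6 * INR m)) with ((12 * INR m * eta) * rho) by ring.
        apply Rmult_le_compat_r; lra. }
      assert (E : / (6 * INR m) = / (2 * INR m) * / 3) by (field; lra).
      assert (0 < / (2 * INR m)) by (apply Rinv_0_lt_compat; lra). rewrite E in Hdiff. nra. }
    assert (HBz : (1 - / (2 * INR k)) * Cmod (B w) <= Cmod (B z)).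
    { fold K.
      assert (Hs : Cmod (B z - B w) <= 2 * exp X / (rho / 12) * Cmod (z - w)).
      { apply (schwarz_bound B w (rho / 12) (exp X)); try lra.
        - apply (hol2_subset D); auto.
        - intros x Hx. apply BB, Hin, Hx. }
      assert (Hs2 : Cmod (B z - B w) <= / (2 * K) * exp (- (3 * X))).
      { eapply Rle_trans; [exact Hs|].
        apply Rle_trans with (2 * exp X / (rho / 12) * eta).
        { apply Rmult_le_compat_l; auto. apply Rdiv_le_0_compat; lra. }
        rewrite exp_Ropp.
        apply Rmult_le_reg_r with (rho * (2 * K * exp (3 * X))); [repeat apply Rmult_lt_0_compat; lra|].
        replace (2 * exp X / (rho / 12) * eta * (rho * (2 * K * exp (3 * X)))) with (48 * K * exp X * exp (3 * X) * eta) by (field; lra).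
        replace (/ (2 * K) * / exp (3 * X) * (rho * (2 * K * exp (3 * X)))) with rho by (field; lra). auto. }
      assert (0 < / (2 * K)) by (apply Rinv_0_lt_compat; lra).
      assert (/ (2 * K) * exp (- (3 * X)) <= / (2 * K) * Cmod (B w)) by (apply Rmult_le_compat_l; lra).
      pose proof (Cmod_triangle_rev (B w) (B z)) as HT. rewrite Cmod_sub_sym in HT. lra. }
    pose proof (half_pow_le _ _ _ Hm0 HW0 HWz) as P1.
    pose proof (half_pow_le _ _ _ Hk0 (Cmod_ge_0 (B w)) HBz) as P2.
    assert (PB : 0 < Cmod (B w) ^ k) by (apply pow_lt; pose proof (exp_pos (- (3 * X))); lra).
    assert (PW : 0 < W w ^ m) by (apply pow_lt; lra).
    specialize (Hmax' z HDz). unfold Phi in Hmax'.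
    apply Rmult_le_reg_r with (Cmod (B w) ^ k / 2 * (W w ^ m / 2)); [apply Rmult_lt_0_compat; lra|].
    apply Rle_trans with (Cmod (f z) * (Cmod (B z) ^ k * W z ^ m)).
    - apply Rmult_le_compat_l; [apply Cmod_ge_0|]. apply Rmult_le_compat; lra.
    - rewrite <- Rmult_assoc. eapply Rle_trans; [exact Hmax'|]. right. field. }
  assert (Hsub : forall z, Cmod (z - w) <= eta -> D z) by (intros z Hz; apply Hin; lra).
  exists w. split; [exact Hw|]. split; [auto|]. split; [auto|].
  assert (Hinv : / eta = exp (6 * X)) by (unfold eta; rewrite exp_Ropp, Rinv_inv; auto).
  destruct (Hder w Hw) as [Hd1 Hd2].
  split.
  - replace (8 * exp (6 * X) * Cmod (f w)) with (2 * (4 * Cmod (f w)) / eta) by (unfold Rdiv; rewrite Hinv; ring).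
    apply (cauchy_bound1 f w); auto; try lra. apply (hol2_subset D); auto.
  - replace (64 * exp (12 * X) * Cmod (f w)) with (16 * (4 * Cmod (f w)) / (eta * eta)).
    2:{ unfold Rdiv. rewrite Rinv_mult, Hinv, <- exp_plus. replace (6 * X + 6 * X) with (12 * X) by ring. ring. }
    apply (cauchy_bound2 f f1 (f2 w) w); auto; try lra.
    + apply (hol2_subset D); auto.
    + apply (hol2_subset D); auto.
    + intros z Hz. apply Hder; auto.
Qed.

Lemma ln2_pos : 0 < ln 2.
Proof. rewrite <- ln_1. apply ln_increasing; lra. Qed.

(* Applied with Ra, Rb the real parts of a/w^n, b/w^n, with F, mF1, mF2, mA, mB the moduli of f, f', f'', A, B at w,
   and with mP = |B(w) exp(b/w^n) f(w)|. *)
Lemma coefficient_growth_bound X Ra Rb c F mA mB mP mF1 mF2 : 15 <= X -> 0 <= c < 1 -> 0 <= Rb -> Ra <= c * Rb -> 0 < F ->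
  exp (- (3 * X)) <= mB -> mA <= exp X -> 0 <= mA -> 0 <= mF1 ->
  mP <= mF2 + mA * exp Ra * mF1 -> mP = mB * exp Rb * F ->
  mF1 <= 8 * exp (6 * X) * F -> mF2 <= 64 * exp (12 * X) * F ->
  (1 - c) * Rb <= 20 * X.
Proof.
  intros HX Hc HRb HRa HF HmB HmA HmA0 HmF1 HP EP H1 H2.
  apply Rnot_lt_le. intro Hlt.
  assert (HE : 1 <= exp (c * Rb)) by (rewrite <- exp_0; apply exp_le_compat, Rmult_le_pos; lra).
  assert (E1 : mA * exp Ra * mF1 <= exp X * exp (c * Rb) * (8 * exp (6 * X) * F)).
  { apply Rmult_le_compat; auto; [apply Rmult_le_pos; auto; apply Rlt_le, exp_pos|].
    apply Rmult_le_compat; auto; [apply Rlt_le, exp_pos|now apply exp_le_compat]. }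
  assert (E2 : exp X * (8 * exp (6 * X) * F) <= 8 * exp (12 * X) * F).
  { replace (exp X * (8 * exp (6 * X) * F)) with (8 * (exp X * exp (6 * X)) * F) by ring.
    rewrite <- exp_plus. apply Rmult_le_compat_r; [lra|]. apply Rmult_le_compat_l; [lra|].
    apply exp_le_compat. lra. }
  assert (E3 : exp (- (3 * X)) * exp Rb * F <= mP).
  { rewrite EP. apply Rmult_le_compat_r; [lra|]. apply Rmult_le_compat_r; [apply Rlt_le, exp_pos|auto]. }
  assert (E4 : exp (- (3 * X)) * exp Rb * F <= (72 * exp (12 * X) * exp (c * Rb)) * F).
  { assert (P12 : 0 < exp (12 * X) * F) by (apply Rmult_lt_0_compat; auto; apply exp_pos).
    assert (exp (c * Rb) * (exp X * (8 * exp (6 * X) * F)) <= exp (c * Rb) * (8 * exp (12 * X) * F))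
      by (apply Rmult_le_compat_l; lra).
    nra. }
  apply Rmult_le_reg_r in E4; auto.
  (* Here [72 = 64 + 8] joins the two derivative terms. The exponents [5 X], [12 X] and the [3 X]
     from the lower bound for [mB] add up to [20 X]. *)
  assert (H72 : 72 <= exp (5 * X)) by (pose proof (exp_ineq1_le (5 * X)); lra).
  assert (E5 : exp (- (3 * X)) * exp Rb <= exp (5 * X + 12 * X + c * Rb)).
  { eapply Rle_trans; [exact E4|]. rewrite !exp_plus.
    apply Rmult_le_compat_r; [lra|]. apply Rmult_le_compat_r; [apply Rlt_le, exp_pos|auto]. }
  rewrite <- exp_plus in E5. revert E5. apply Rlt_not_le, exp_increasing. lra.
Qed.

(** A single small radius [r] is enough: at the point [w] of [local_maximum] the equation forces
    [(1 - c) Re (b / w^n) <= 20 X], whereas the sector makes this quantity at least [21 X], as [X]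
    is only [r^-beta1] with [beta1 < n]. *)
Lemma no_slow_solution a b n rho d beta A B f f1 f2 :
  a <> RtoC 0 -> b <> RtoC 0 ->
  (Carg a <> Carg b \/ exists c : R, 0 < c < 1 /\ a = (RtoC c * b)%C) ->
  (0 < n)%nat -> 0 < rho -> 0 < d -> 0 < beta < INR n ->
  hol2 (punctured_disc rho) f -> hol2 (punctured_disc rho) f1 -> hol2 (punctured_disc rho) B ->
  not_identically_zero_on (punctured_disc rho) f -> not_identically_zero_on (punctured_disc rho) B ->
  (forall z, punctured_disc rho z -> Cdiff f z (f1 z) /\ Cdiff f1 z (f2 z) /\
     (f2 z + A z * Cexp (a / z ^ n) * f1 z + B z * Cexp (b / z ^ n) * f z)%C = RtoC 0) ->
  (forall z, 0 < Cmod z < d -> Cmod (A z) <= exp (exp (beta * - ln (Cmod z)))) ->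
  (forall z, 0 < Cmod z < d -> Cmod (B z) <= exp (exp (beta * - ln (Cmod z)))) ->
  (forall z, 0 < Cmod z < d -> Cmod (f z) <= exp (exp (exp (beta * - ln (Cmod z))))) ->
  False.
Proof.
  intros Ha Hb Hab Hn Hrho Hd [Hbeta Hbn] Hf Hf1 HB Hfn HBn Hode BA BB Bf.
  destruct (sector_exists a b n Ha Hb Hn Hab) as [theta [delta [c0 [c [Hdelta [Hc0 [Hc Hsec]]]]]]].
  set (beta1 := (beta + INR n) / 2). assert (Hb1 : beta < beta1 < INR n) by (unfold beta1; lra).
  destruct (large_point_in_sector rho d f B beta beta1 theta (delta / 2)) as [L1 [HL1 Hpt]]; auto; try lra.
  pose proof ln2_pos as Hln2.
  (* The factor [2^beta] allows for points of modulus down to [r / 2]. *)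
  destruct (exp_dominates beta beta1 (exp (beta * ln 2))) as [L2 [HL2 HD2]]; [lra|apply exp_pos|].
  (* The logarithm of [960 / delta = 120 * 8 / delta] provides [120 <= sg * exp X] for the radius
     [sg = delta * r / 8]; the 16 provides [15 <= X] and absorbs [L]. *)
  set (K3 := 16 + Rabs (ln (960 / delta))).
  destruct (exp_dominates_linear beta1 K3) as [L3 [HL3 HD3]]; [lra|unfold K3; pose proof (Rabs_pos (ln (960 / delta))); lra|].
  (* Chosen to obtain [21 X]; the factor [2^-n] in the denominator allows for points of modulus up
     to [2 r]. *)
  set (K4 := 21 / (c0 * (1 - c) * exp (- (INR n * ln 2)))).
  assert (Hden : 0 < c0 * (1 - c) * exp (- (INR n * ln 2))).
  { apply Rmult_lt_0_compat; [apply Rmult_lt_0_compat; lra|apply exp_pos]. }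
  destruct (exp_dominates beta1 (INR n) K4) as [L4 [HL4 HD4]]; [lra|unfold K4; apply Rdiv_lt_0_compat; lra|].
  set (rr := Rmin (Rmin d rho) 1 / 2).
  assert (Hrr : 0 < rr) by (unfold rr; assert (0 < Rmin (Rmin d rho) 1) by (repeat apply Rmin_pos; lra); lra).
  assert (Hrr0 : 2 * rr <= d /\ 2 * rr <= rho /\ 2 * rr <= 1).
  { unfold rr. pose proof (Rmin_l (Rmin d rho) 1). pose proof (Rmin_r (Rmin d rho) 1).
    pose proof (Rmin_l d rho). pose proof (Rmin_r d rho). lra. }
  assert (Hlnrr : 0 < - ln rr) by (apply neg_ln_pos; lra).
  set (L := L1 + L2 + L3 + L4 - ln rr + 1).
  set (r := exp (- L)).
  assert (Hr : 0 < r) by apply exp_pos.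
  assert (HL : - ln r = L) by (unfold r; rewrite ln_exp; ring).
  assert (Hrlt : r < rr) by (apply ln_lt_inv; auto; unfold L in HL; lra).
  assert (HL0 : 1 <= L) by (unfold L; lra).
  set (X := exp (beta1 * L)).
  specialize (HD2 L ltac:(unfold L; lra)). specialize (HD3 L ltac:(unfold L; lra)). specialize (HD4 L ltac:(unfold L; lra)).
  fold X in HD2, HD3, HD4.
  pose proof (Rabs_pos (ln (960 / delta))) as Habs.
  assert (HX : 15 <= X) by (unfold K3 in HD3; nra).
  assert (HeX : 1 <= exp X) by (rewrite <- exp_0; apply exp_le_compat; lra).
  destruct (nfloor_ex (exp X)) as [k0 [Hk1 Hk2]]; [lra|].
  set (k := S k0).
  assert (Hk : exp X <= INR k <= 2 * exp X) by (unfold k; rewrite S_INR; lra).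
  destruct (Hpt r k Hr) as [z1 [Hz1 [Hz1s [HBz1 Hfz1]]]].
  { rewrite HL. unfold L. lra. }
  { rewrite HL. apply Hk. }
  rewrite HL in HBz1, Hfz1. fold X in HBz1, Hfz1.
  (* The point [z1] is within [delta r / 2] of the axis of the cone at radius [r]. Moving by [sg],
     and adjusting the modulus by at most [sg], gives [3/4 delta r], still below [delta |w|] because
     [|w| >= 7/8 r]. *)
  set (sg := delta * r / 8).
  assert (Hsg : 0 < sg) by (unfold sg; apply Rdiv_lt_0_compat; [apply Rmult_lt_0_compat|]; lra).
  assert (Hsg1 : sg <= r / 8) by (unfold sg; nra).
  assert (Hdisc : forall z, Cmod (z - z1) <= sg -> r / 2 <= Cmod z <= 2 * r).
  { intros z Hz. pose proof (Cmod_triangle_rev z z1). pose proof (Cmod_triangle_rev z1 z) as T.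
    rewrite (Cmod_sub_sym z1 z) in T. lra. }
  assert (Hpd : forall z, Cmod (z - z1) <= sg -> punctured_disc rho z /\ 0 < Cmod z < d).
  { intros z Hz. specialize (Hdisc z Hz). unfold punctured_disc. lra. }
  assert (Hgrow : forall z, Cmod (z - z1) <= sg -> exp (beta * - ln (Cmod z)) <= X).
  { intros z Hz. specialize (Hdisc z Hz). eapply Rle_trans; [|exact HD2].
    rewrite <- exp_plus. apply exp_le_compat. rewrite <- Rmult_plus_distr_l. apply Rmult_le_compat_l; [lra|].
    assert (ln (r / 2) <= ln (Cmod z)) by (apply ln_le; lra).
    assert (ln (r / 2) = ln r - ln 2) by (unfold Rdiv; rewrite ln_mult, ln_Rinv; lra). lra. }
  destruct (local_maximum f f1 f2 B z1 sg X k) as [w [Hw [Hfw [HBw [Hf1w Hf2w]]]]].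
  - lra.
  - exact HX.
  - assert (E : 960 / delta * exp L <= exp X).
    { rewrite <- (exp_ln (960 / delta)) by (apply Rdiv_lt_0_compat; lra).
      rewrite <- exp_plus. apply exp_le_compat. pose proof (Rle_abs (ln (960 / delta))).
      unfold K3 in HD3. nra. }
    assert (Er : r * exp L = 1) by (unfold r; rewrite exp_Ropp; apply Rinv_l, Rgt_not_eq, exp_pos).
    apply Rle_trans with (sg * (960 / delta * exp L)); [|apply Rmult_le_compat_l; lra].
    right. unfold sg. replace (delta * r / 8 * (960 / delta * exp L)) with (120 * (r * exp L)) by (field; lra).
    rewrite Er. ring.
  - exact Hk.
  - apply (hol2_subset (punctured_disc rho)); auto. intros z Hz. now apply Hpd.
  - apply (hol2_subset (punctured_disc rho)); auto. intros z Hz. now apply Hpd.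
  - apply (hol2_subset (punctured_disc rho)); auto. intros z Hz. now apply Hpd.
  - intros z Hz. destruct (Hode z) as [H1 [H2 _]]; auto. now apply Hpd.
  - intros z Hz. eapply Rle_trans; [apply Bf; now apply Hpd|]. apply exp_le_compat.
    eapply Rle_trans; [apply exp_le_compat, Hgrow, Hz|apply Hk].
  - intros z Hz. eapply Rle_trans; [apply BB; now apply Hpd|]. apply exp_le_compat, Hgrow, Hz.
  - exact HBz1.
  - exact Hfz1.
  - destruct (Hpd w Hw) as [Hwp Hwd]. pose proof (Hdisc w Hw) as Hwr.
    assert (Hcone : Cmod (w - RtoC (Cmod w) * cis theta) < delta * Cmod w).
    { replace (w - RtoC (Cmod w) * cis theta)%C
        with ((w - z1) + ((z1 - RtoC r * cis theta) + RtoC (r - Cmod w) * cis theta))%C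
        by (rewrite RtoC_minus; ring).
      pose proof (Cmod_triangle_rev w z1) as T1. pose proof (Cmod_triangle_rev z1 w) as T2.
      rewrite (Cmod_sub_sym z1 w) in T2. rewrite Hz1 in T1, T2.
      eapply Rle_lt_trans; [apply Cmod_triangle|].
      eapply Rle_lt_trans; [apply Rplus_le_compat_l, Cmod_triangle|].
      rewrite Cmod_mult, Cmod_cis, Cmod_R, Rmult_1_r.
      assert (Rabs (r - Cmod w) <= sg) by (apply Rabs_le; lra).
      assert (delta * (r - sg) <= delta * Cmod w) by (apply Rmult_le_compat_l; lra).
      assert (delta * sg <= delta * (r / 8)) by (apply Rmult_le_compat_l; lra).
      assert (0 < delta * r) by (apply Rmult_lt_0_compat; lra).
      unfold sg in *. lra. }
    destruct (Hsec w (proj1 Hwp) Hcone) as [Hs1 Hs2].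
    set (Rb := Re (b / w ^ n)%C) in *. set (Ra := Re (a / w ^ n)%C) in *.
    assert (HRb0 : 0 <= Rb).
    { eapply Rle_trans; [|exact Hs1]. apply Rmult_le_pos; [lra|apply Rlt_le, exp_pos]. }
    destruct (Hode w Hwp) as [_ [_ Eq]].
    assert (Hfin : (1 - c) * Rb <= 20 * X).
    { apply (coefficient_growth_bound X Ra Rb c (Cmod (f w)) (Cmod (A w)) (Cmod (B w))
        (Cmod (B w * Cexp (b / w ^ n) * f w)) (Cmod (f1 w)) (Cmod (f2 w))); auto using Cmod_ge_0.
      - eapply Rle_trans; [apply BA; auto|]. apply exp_le_compat, Hgrow, Hw.
      - replace (B w * Cexp (b / w ^ n) * f w)%C with ((f2 w + A w * Cexp (a / w ^ n) * f1 w + B w * Cexp (b / w ^ n) * f w)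
          - (f2 w + A w * Cexp (a / w ^ n) * f1 w))%C by ring.
        rewrite Eq. eapply Rle_trans; [apply Cmod_sub_le|]. rewrite Cmod_0, Rplus_0_l.
        eapply Rle_trans; [apply Cmod_triangle|]. rewrite !Cmod_mult, Cmod_Cexp. apply Rle_refl.
      - rewrite !Cmod_mult, Cmod_Cexp. reflexivity. }
    assert (HLw : exp (- (INR n * ln 2)) * exp (INR n * L) <= exp (INR n * - ln (Cmod w))).
    { rewrite <- exp_plus. apply exp_le_compat.
      replace (- (INR n * ln 2) + INR n * L) with (INR n * (L - ln 2)) by ring.
      apply Rmult_le_compat_l; [apply pos_INR|].
      assert (ln (Cmod w) <= ln (2 * r)) by (apply ln_le; lra).
      assert (ln (2 * r) = ln 2 + ln r) by (apply ln_mult; lra). lra. }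
    assert (H21 : 21 * X <= (1 - c) * Rb).
    { apply Rle_trans with ((1 - c) * (c0 * (exp (- (INR n * ln 2)) * exp (INR n * L)))).
      - replace ((1 - c) * (c0 * (exp (- (INR n * ln 2)) * exp (INR n * L))))
          with (c0 * (1 - c) * exp (- (INR n * ln 2)) * exp (INR n * L)) by ring.
        apply Rle_trans with (c0 * (1 - c) * exp (- (INR n * ln 2)) * (K4 * X)).
        + right. unfold K4. field. pose proof (exp_pos (- (INR n * ln 2))). repeat split; lra.
        + apply Rmult_le_compat_l; lra.
      - apply Rmult_le_compat_l; [lra|]. eapply Rle_trans; [|exact Hs1]. apply Rmult_le_compat_l; lra. }
    lra.
Qed.

Lemma growth_weaken y beta r : y <= beta -> 0 < r < 1 -> exp (y * - ln r) <= exp (beta * - ln r).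
Proof.
  intros Hy Hr. apply exp_le_compat. apply Rmult_le_compat_r; auto. apply Rlt_le, neg_ln_pos, Hr.
Qed.

Theorem theorem4 :
  forall (a b : C) (n : nat) (rho : R) (A B : C -> C),
    a <> RtoC 0 -> b <> RtoC 0 ->
    (Carg a <> Carg b \/ exists c : R, 0 < c < 1 /\ a = (RtoC c * b)%C) ->
    (0 < n)%nat ->
    0 < rho ->
    analytic_on (punctured_disc rho) A ->
    analytic_on (punctured_disc rho) B ->
    not_identically_zero_on (punctured_disc rho) A ->
    not_identically_zero_on (punctured_disc rho) B ->
    Rbar_lt (Rbar_max (order0 A) (order0 B)) (INR n) ->
    forall f : C -> C,
      is_solution_on (punctured_disc rho)
        (fun z => (A z * Cexp (a / z ^ n))%C)
        (fun z => (B z * Cexp (b / z ^ n))%C) f ->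
      not_identically_zero_on (punctured_disc rho) f ->
      hyper_order0 f = Finite (INR n).
Proof.
  intros a b n rho A B Ha Hb Hab Hn Hrho HA HB _ HBn Hord f [Hfa [f1 [f2 Hsol]]] Hfn.
  pose proof (lt_0_INR n Hn) as Hn0.
  pose proof (Copen_punctured_disc rho) as Hop.
  pose proof (analytic_hol2 _ _ Hop HA) as HA2. pose proof (analytic_hol2 _ _ Hop HB) as HB2.
  pose proof (analytic_hol2 _ _ Hop Hfa) as Hf2.
  assert (Hode : forall z, punctured_disc rho z -> Cdiff f z (f1 z) /\ Cdiff f1 z (f2 z) /\
     (f2 z + A z * Cexp (a / z ^ n) * f1 z + B z * Cexp (b / z ^ n) * f z)%C = RtoC 0).
  { intros z Hz. destruct (Hsol z Hz) as [H1 [H2 H3]]. repeat split; auto; now apply is_derive_Cdiff. }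
  assert (Hf12 : hol2 (punctured_disc rho) f1).
  { apply (analytic_hol2_derivative _ f f1 Hop Hfa). intros z Hz. now apply Hode. }
  assert (HoA : Rbar_lt (order0 A) (INR n) /\ Rbar_lt (order0 B) (INR n)).
  { unfold Rbar_max in Hord. destruct (Rbar_le_dec (order0 A) (order0 B)) as [Hle|Hle].
    - split; auto. eapply Rbar_le_lt_trans; eauto.
    - split; auto. apply Rbar_not_le_lt in Hle. eapply Rbar_lt_trans; eauto. }
  destruct HoA as [HoA HoB].
  destruct (order0_lt_bound rho A _ Hrho HA2 HoA) as [yA [dA [HyA [HdA BA]]]].
  destruct (order0_lt_bound rho B _ Hrho HB2 HoB) as [yB [dB [HyB [HdB BB]]]].
  assert (Hle : Rbar_le (hyper_order0 f) (INR n)).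
  { assert (Heps : forall eps, 0 < eps -> Rbar_le (hyper_order0 f) (INR n + eps)).
    { intros eps He. set (y := Rmax yA yB). set (d := Rmin (Rmin dA dB) 1).
      assert (Hd1 : d <= dA) by (unfold d; eapply Rle_trans; [apply Rmin_l|apply Rmin_l]).
      assert (Hd2 : d <= dB) by (unfold d; eapply Rle_trans; [apply Rmin_l|apply Rmin_r]).
      assert (Hd3 : d <= 1) by apply Rmin_r.
      apply (hyper_order0_upper a b n rho A B f f1 f2 y d eps); auto.
      - unfold y. apply Rmax_lub_lt; auto.
      - unfold d. repeat apply Rmin_pos; lra.
      - intros z Hz. eapply Rle_trans; [apply BA; lra|]. apply exp_le_compat, growth_weaken; [apply Rmax_l|lra].
      - intros z Hz. eapply Rle_trans; [apply BB; lra|]. apply exp_le_compat, growth_weaken; [apply Rmax_r|lra].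
      - intros z Hz. eapply hol2_cont; eauto. }
    destruct (hyper_order0 f) as [x| |]; simpl in *.
    - apply Rnot_lt_le. intro Hlt. specialize (Heps ((x - INR n) / 2) ltac:(lra)). lra.
    - apply (Heps 1). lra.
    - exact I. }
  apply Rbar_le_antisym; auto.
  apply Rbar_not_lt_le. intro Hlt.
  destruct (hyper_order0_lt_bound rho f _ Hrho Hf2 Hlt) as [yf [df [Hyf [Hdf Bf]]]].
  (* The growth exponents obtained from the upper limits may be negative; the entry [INR n / 2]
     makes [beta] positive. *)
  set (beta := Rmax (Rmax yA yB) (Rmax yf (INR n / 2))).
  assert (Hb1 : yA <= beta) by (unfold beta; eapply Rle_trans; [|apply Rmax_l]; apply Rmax_l).
  assert (Hb2 : yB <= beta) by (unfold beta; eapply Rle_trans; [|apply Rmax_l]; apply Rmax_r).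
  assert (Hb3 : yf <= beta) by (unfold beta; eapply Rle_trans; [|apply Rmax_r]; apply Rmax_l).
  assert (Hb4 : INR n / 2 <= beta) by (unfold beta; eapply Rle_trans; [|apply Rmax_r]; apply Rmax_r).
  assert (Hb5 : beta < INR n) by (unfold beta; repeat apply Rmax_lub_lt; lra).
  set (d := Rmin (Rmin dA dB) (Rmin df 1)).
  assert (Hd0 : 0 < d) by (unfold d; repeat apply Rmin_pos; lra).
  assert (Hd1 : d <= dA) by (unfold d; eapply Rle_trans; [apply Rmin_l|apply Rmin_l]).
  assert (Hd2 : d <= dB) by (unfold d; eapply Rle_trans; [apply Rmin_l|apply Rmin_r]).
  assert (Hd3 : d <= df) by (unfold d; eapply Rle_trans; [apply Rmin_r|apply Rmin_l]).
  assert (Hd4 : d <= 1) by (unfold d; eapply Rle_trans; [apply Rmin_r|apply Rmin_r]).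
  apply (no_slow_solution a b n rho d beta A B f f1 f2); auto; try lra.
  - intros z Hz. eapply Rle_trans; [apply BA; lra|]. apply exp_le_compat, growth_weaken; lra.
  - intros z Hz. eapply Rle_trans; [apply BB; lra|]. apply exp_le_compat, growth_weaken; lra.
  - intros z Hz. eapply Rle_trans; [apply Bf; lra|].
    apply exp_le_compat, exp_le_compat, growth_weaken; lra.
Qed.
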